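(* Given any barred permutation $\pi$ of $[n]$, there is a unique $B$-orbit of maximum dimension that is contained in the Białynicki-Birula cell $X_\pi^+$. The $\mu$-involution (for the appropriate composition $\mu$) indexing this $B$-orbit is $\sigma(\pi)$.
   Context: Let $k$ be a field of characteristic $0$, $G=SL_n(k)$, $B\subset G$ the Borel subgroup of upper triangular matrices and $T\subset B$ the maximal torus of diagonal matrices. The variety of complete quadrics $\mathcal{X}_n$ is the wonderful compactification (De Concini–Procesi) of the homogeneous space $SL_n/SO_n$, i.e. of the space of nonsingular quadric hypersurfaces in $\mathbb{P}^{n-1}$, with its natural $G$-action. A point of $\mathcal{X}_n$ can be thought of as a complete quadric: a partial flag $0=V_0\subset V_1\subset\dots\subset V_r=k^n$ together with a nondegenerate quadric on (the projectivization of) each successive quotient $V_j/V_{j-1}$. A composition of $n$ is a sequence $\mu=(\mu_1,\dots,\mu_r)$ of positive integers with sum $n$. A $\mu$-involution is a permutation of $[n]$ in one-line notation cut into consecutive strings $\pi=[\pi_1|\dots|\pi_r]$ with $\pi_j$ of length $\mu_j$, such that each $\pi_j$ is an involution when read as the one-line notation of a permutation of its own alphabet $\mathcal{A}_j$ (the set of its letters, in natural order). A degenerate involution is a $\mu$-involution for some $\mu$. The distinguished complete quadric $Q_\pi$ is: $V_j$ is spanned by the standard basis vectors $e_a$ with $a\in\mathcal{A}_1\cup\dots\cup\mathcal{A}_j$, and the quadric on $V_j/V_{j-1}$ is $\sum x_{a}x_{b}+\sum x_{c}^2$, summed over the two-cycles $(a,b)$ and one-cycles $(c)$ of $\pi_j$.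 The $B$-orbits in $\mathcal{X}_n$ are parametrized by the degenerate involutions, the orbit indexed by $\pi$ being the one containing $Q_\pi$. A barred permutation is a $\mu$-involution, for $\mu$ with all parts at most $2$, such that every string of length two is of the form $ji$ with $j>i$. The points $Q_\pi$, $\pi$ a barred permutation, are the $T$-fixed points of $\mathcal{X}_n$. A sequence of integers $\mathbf a=(a_1,\dots,a_n)$ is admissible if (a) $\sum a_i=0$; (b) $a_1<\dots<a_n$; (c) $a_i+a_j<a_k+a_l$ whenever $i,j,k<l$; (d) $2a_i<a_j+a_k$ whenever $i,j<k$. It defines an admissible one-parameter subgroup $\lambda(t)=\mathrm{diag}(t^{a_1},\dots,t^{a_n})$ of $SL_n$, acting on quadrics by $\lambda(t)\cdot x_ix_j=t^{-(a_i+a_j)}x_ix_j$. The Białynicki-Birula cell attached to $Q_\pi$ is $X_\pi^+=\{x\in\mathcal{X}_n:\lim_{t\to0}\lambda(t)\cdot x=Q_\pi\}$, for an admissible $\lambda$. The map $\sigma$ from barred permutations to degenerate involutions: for $\pi=[\pi_1|\dots|\pi_r]$ let $d_j$ be the largest letter of $\pi_j$. Replace each length-one string $i$ by the one-cycle $(i)$ and each length-two string $ji$ by the two-cycle $(i\,j)$; remove the bar between $\pi_j$ and $\pi_{j+1}$ if $d_j<d_{j+1}$ (ascent), and retain it if $d_j>d_{j+1}$ (descent). Example: $\sigma([86|4|52|9|31|7])=(68)|(25)(4)(9)|(13)(7)$.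
   Formalization: B is taken upper triangular for substitutions of the coordinates x_i (lower triangular on k^n), since with B upper triangular on k^n and the given λ(t) the cell of Q_[21] for n=2 contains no B-orbit; orbits are taken over any algebraically closed field containing k. *)

(* Defs.v *)
From HB Require Import structures.
From mathcomp Require Import all_boot all_order all_algebra.
From mathcomp Require Import mpoly.

Set Implicit Arguments.
Unset Strict Implicit.
Unset Printing Implicit Defensive.

Import GRing.Theory Num.Theory.
Local Open Scope ring_scope.

(* The letters 1, ..., n are the elements 0, ..., n-1 of 'I_n; a cut one-line
   notation [pi_1|...|pi_r] is the sequence of its strings. *)
Section Combinatorics.
Variable n : nat.
Implicit Types (w : seq 'I_n) (s : seq (seq 'I_n)).

Definition alphabet w : seq 'I_n := [seq a <- enum 'I_n | a \in w].

(* w as the one-line notation of a map of its alphabet: the k-th smallest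
   letter is sent to the k-th entry of w. *)
Definition string_fun w (a : 'I_n) : 'I_n := nth a w (index a (alphabet w)).

Definition string_involution w : bool :=
  [forall a in w, string_fun w (string_fun w a) == a].

Definition is_composition (mu : seq nat) : bool :=
  (0%N \notin mu) && (sumn mu == n).

Definition mu_involution (mu : seq nat) s : bool :=
  [&& is_composition mu, perm_eq (flatten s) (enum 'I_n), shape s == mu
    & all string_involution s].

Definition barred_permutation s : bool :=
  mu_involution (shape s) s
  && all (fun w => (size w <= 2)%N && sorted (fun j i : 'I_n => i < j)%N w) s.

Definition string_of s (a : 'I_n) : nat := find (fun w => a \in w) s.

Definition involution_of s (a : 'I_n) : 'I_n :=
  string_fun (nth [::] s (string_of s a)) a.

Definition max_letter w : nat := \max_(i <- w) (i : nat).

(* The groups of consecutive strings between which the bars are removed. *)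
Fixpoint ascending_runs s : seq (seq (seq 'I_n)) :=
  match s with
  | [::] => [::]
  | u :: s' =>
      match ascending_runs s' with
      | (v :: g) :: rs =>
          if (max_letter u < max_letter v)%N then (u :: v :: g) :: rs
          else [:: u] :: (v :: g) :: rs
      | _ => [:: [:: u]]
      end
  end.

(* The product of the one- and two-cycles given by the strings of a run g,
   in one-line notation on the union of their alphabets. *)
Definition merge_run (g : seq (seq 'I_n)) : seq 'I_n :=
  [seq involution_of g a | a <- alphabet (flatten g)].

Definition sigma s : seq (seq 'I_n) := map merge_run (ascending_runs s).

End Combinatorics.

(* The wonderful compactification is realized as the closure of the set of
   nonsingular quadrics A (symmetric matrices up to scalars) in the product over
   0 < i < n of the projective spaces of bilinear forms on the i-th exterior
   power, under A |-> (Lambda^1 A, ..., Lambda^(n-1) A).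
   The homogeneous coordinates of this product are indexed by the pairs (I, J)
   of subsets of equal cardinality i. *)
Definition coord (n : nat) : finType :=
  {c : {set 'I_n} * {set 'I_n} | (#|c.1| == #|c.2|) && (0 < #|c.1| < n)%N}.

Definition rows_of n (c : coord n) : {set 'I_n} := (val c).1.
Definition cols_of n (c : coord n) : {set 'I_n} := (val c).2.
Definition degree_of n (c : coord n) : nat := #|rows_of c|.

(* Points of the product are handled through tuples of homogeneous coordinates:
   a tuple is a point when it is nonzero in each factor, and two tuples give the
   same point when they differ by one nonzero scalar in each factor. *)
Notation ambient K n := {ffun coord n -> K}.

Section CompleteQuadrics.
Variables (K : fieldType) (n : nat).
Implicit Types (x y : ambient K n) (S Z O : ambient K n -> Prop).

Definition is_point x : Prop :=
  forall i : nat, (0 < i < n)%N -> exists2 c, degree_of c = i & x c != 0.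

Definition same_point x y : Prop :=
  exists2 s : nat -> K, forall i, s i != 0
    & forall c, y c = s (degree_of c) * x c.

Definition subset S S' : Prop := forall x, S x -> S' x.
Definition same_set S S' : Prop := forall x, S x <-> S' x.

Definition multihomogeneous (d : nat -> nat) (f : {mpoly K[#|coord n|]}) : Prop :=
  forall m, m \in msupp f ->
  forall i : nat, (\sum_(v | degree_of (enum_val v) == i) m v = d i)%N.

Definition zeval (f : {mpoly K[#|coord n|]}) x : K :=
  f.@[fun v => x (enum_val v)].

Definition zclosed Z : Prop :=
  exists2 F : {mpoly K[#|coord n|]} -> Prop,
    forall f, F f -> exists d, multihomogeneous d f
  & forall x, Z x <-> is_point x /\ forall f, F f -> zeval f x = 0.

Definition zclosure S : ambient K n -> Prop :=
  fun x => forall Z, zclosed Z -> subset S Z -> Z x.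

Definition irreducible S : Prop :=
  (exists x, S x) /\
  forall Z1 Z2, zclosed Z1 -> zclosed Z2 ->
    (forall x, S x -> Z1 x \/ Z2 x) -> subset S Z1 \/ subset S Z2.

Definition irreducible_chain S (d : nat) : Prop :=
  exists T : nat -> ambient K n -> Prop,
    (forall i, (i <= d)%N ->
       [/\ zclosed (T i), irreducible (T i) & subset (T i) S]) /\
    (forall i, (i < d)%N ->
       subset (T i) (T i.+1) /\ ~ subset (T i.+1) (T i)).

(* Krull dimension of the closure of S, which is the dimension of S when S is
   locally closed, as orbits are. *)
Definition has_dim S (d : nat) : Prop :=
  irreducible_chain (zclosure S) d /\
  forall d', irreducible_chain (zclosure S) d' -> (d' <= d)%N.

(* Rows I and columns J, both listed increasingly; meant for #|I| = #|J|. *)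
Definition minor (A : 'M[K]_n) (I J : {set 'I_n}) : K :=
  \det (\matrix_(i < #|I|, j < #|I|)
          A (enum_val i) (nth (enum_val i) (enum J) j)).

Definition compounds (A : 'M[K]_n) : ambient K n :=
  [ffun c => minor A (rows_of c) (cols_of c)].

Definition complete_quadrics : ambient K n -> Prop :=
  zclosure (fun x => exists A : 'M[K]_n,
    [/\ A^T = A, A \in unitmx & same_point (compounds A) x]).

(* The matrix g stands for the linear substitution x_j |-> \sum_i g_ij x_i of the
   coordinates x_1, ..., x_n.  It takes the symmetric matrix A of a quadric to
   g A g^T, hence Lambda^i A to (Lambda^i g) (Lambda^i A) (Lambda^i g)^T. *)
Definition act (g : 'M[K]_n) x : ambient K n :=
  [ffun c => \sum_(c' : coord n | degree_of c' == degree_of c)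
     minor g (rows_of c) (rows_of c') * x c'
       * minor g (cols_of c) (cols_of c')].

(* Upper triangular with respect to the coordinates x_1, ..., x_n: b maps x_j
   into the span of x_1, ..., x_j. *)
Definition in_borel (b : 'M[K]_n) : Prop :=
  (forall i j : 'I_n, (j < i)%N -> b i j = 0) /\ \det b = 1.

Definition orbit_of x : ambient K n -> Prop :=
  fun y => exists2 b, in_borel b & same_point (act b x) y.

Definition is_orbit O : Prop :=
  exists2 x, complete_quadrics x & same_set O (orbit_of x).

(* The symmetric matrix of \sum x_a x_b + \sum x_c ^+ 2, over the two-cycles
   (a, b) and one-cycles (c) of all the strings. *)
Definition involution_mx (s : seq (seq 'I_n)) : 'M[K]_n :=
  \matrix_(a, b) if involution_of s a == b then
                   (if a == b then 1 else 2%:R^-1)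
                 else 0.

(* Letters are taken from the last strings first. *)
Definition from_top (s : seq (seq 'I_n)) (I : {set 'I_n}) : bool :=
  [forall a in I, forall b in ~: I, (string_of s b <= string_of s a)%N].

(* A complete quadric (V_j, q_j) has q_r, pulled back to V_r = k^n, as its
   quadric in P^(n-1); the next quadrics live on the successive vertices.  As a
   point of the product of projective spaces it is the limit for t -> 0 of
   q_r + t q_(r-1) + ... + t^(r-1) q_1 (any extensions of the q_j to k^n).  The
   lowest power of t in the minors of size i is attained exactly on the sets
   that exhaust the last strings before using earlier ones. *)
Definition quadric_of (s : seq (seq 'I_n)) : ambient K n :=
  [ffun c => if from_top s (rows_of c) && from_top s (cols_of c)
             then minor (involution_mx s) (rows_of c) (cols_of c) else 0].

Definition admissible (a : 'I_n -> int) : Prop :=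
  [/\ \sum_i a i = 0,
      forall i j : 'I_n, (i < j)%N -> a i < a j,
      forall i j k l : 'I_n, (i < l)%N -> (j < l)%N -> (k < l)%N ->
        a i + a j < a k + a l
    & forall i j k : 'I_n, (i < k)%N -> (j < k)%N -> a i *+ 2 < a j + a k].

(* diag(t^(a_1), ..., t^(a_n)) on k^n, given as above by its matrix on the
   coordinate functions: x_i |-> t^(- a_i) x_i, so that the monomial x_i x_j is
   multiplied by t^(- (a_i + a_j)).
   The Borel group has to be upper triangular in the coordinates x_i for this:
   lambda(t) b lambda(t)^-1 then has a limit for t -> 0, so that the cells are
   stable under it, which fails for upper triangular matrices acting on k^n. *)
Definition lambda (a : 'I_n -> int) (t : K) : 'M[K]_n :=
  diag_mx (\row_i t ^ (- a i)).

(* The morphism gamma on the punctured line extends to a morphism phi on the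
   whole line, with value p at 0. *)
Definition limit_at0 (gamma : K -> ambient K n) (p : ambient K n) : Prop :=
  exists phi : coord n -> {poly K},
    let phi_ t : ambient K n := [ffun c => (phi c).[t]] in
    [/\ forall t, is_point (phi_ t),
        forall t, t != 0 -> same_point (gamma t) (phi_ t)
      & same_point (phi_ 0) p].

Definition bb_cell (a : 'I_n -> int) (q : ambient K n) : ambient K n -> Prop :=
  fun x => complete_quadrics x /\ limit_at0 (fun t => act (lambda a t) x) q.

Definition max_orbit_in (C O : ambient K n -> Prop) : Prop :=
  [/\ is_orbit O, subset O C
    & exists2 d, has_dim O d
      & forall O', is_orbit O' -> subset O' C ->
          exists2 d', has_dim O' d' & (d' <= d)%N].

End CompleteQuadrics.

(* Varieties over a field k are given by their points over an algebraically
   closed field K containing k (B(k)-orbits of k-points are finer than B-orbits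
   in general); the Q_pi are k-rational points. *)
Definition base_change (k K : fieldType) (iota : k -> K) n (x : ambient k n) :
  ambient K n := [ffun c => iota (x c)].

(* Main.v *)
(* Idea. Let str a be the index of the string of the letter a, and J the symmetric
   matrix of the involution attached to pi. For parameters z_l, one for each bar,
   let D_z be the limit of the compounds of J with its blocks rescaled so that the
   ratio of the scale of string l to that of string l+1 tends to z_l. Then
   Q_pi = D_0, and Q_(sigma pi) is D_z with z_l = 1 at the ascents and 0 at the
   descents. The torus multiplies z_l by a character of lambda-weight equal to the
   difference of the weights of two consecutive strings, which by admissibility is
   positive exactly at the ascents; hence B D_z lies in the cell when z is supported
   on the ascents.
   Conversely, near a point of the cell a symmetric matrix is block diagonalized by
   elimination with coefficients that are rational in its compounds. The vanishing
   of the coordinates of too large weight forces the elimination at the point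
   itself to be upper triangular, so every point of the cell is in some B D_z, with
   z supported on the ascents. Letting z vary along a line, D_z is in the closure of
   the orbit of Q_(sigma pi); if z_l = 0 at an ascent l, the closure of B D_z is
   strictly smaller, because there the form whose degree is the number of letters
   after the bar l has rank 1, and its dimension drops as the Krull dimension of an
   irreducible set is finite. *)

Require Import Defs.
From mathcomp Require Import all_boot all_order all_algebra all_fingroup.
From mathcomp Require Import mpoly zify ring.
From Stdlib Require Import Classical.
Set Implicit Arguments.
Unset Strict Implicit.
Unset Printing Implicit Defensive.
Import Order.TTheory GRing.Theory Num.Theory Defs.
Local Open Scope ring_scope.

(** * Minors and compound matrices *)

Section Minors.
Variables (K : fieldType) (n : nat).
Implicit Types (A B g h : 'M[K]_n) (I J L S : {set 'I_n}).

(** A point of the cell is in general not the tuple of compounds of a matrix, so elimination cannot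
    be performed on it directly. The elimination is written with rational functions of the
    coordinates defined at [x0], its properties are proved for nonsingular symmetric matrices in a
    neighbourhood h != 0 of [x0], and they pass to [x0] one equation at a time: after clearing
    denominators, a multihomogeneous function vanishes on all nonsingular quadrics, hence on their
    closure ([generic_eq0]). Degenerations are taken along polynomial curves, where a nonzero
    polynomial has a nonroot because K is infinite; this also gives the irreducibility of orbit
    closures. Dimensions of orbits are never computed, only compared through strict inclusions of
    irreducible closed sets. The finiteness this requires comes from counting monomials: N + 1
    polynomials in N variables satisfy a relation, whereas polynomials separating the members of a
    chain do not. *)

Definition list_set (m : nat) S (e : m = #|S|) (i : 'I_m) : 'I_n :=
  enum_val (cast_ord e i).

Lemma list_set_inj m S (e : m = #|S|) : injective (list_set e).
Proof. by move=> i j /enum_val_inj /cast_ord_inj. Qed.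

Lemma list_set_in m S (e : m = #|S|) i : list_set e i \in S.
Proof. exact: enum_valP. Qed.

Lemma list_setP m S (e : m = #|S|) a : a \in S -> exists i, list_set e i = a.
Proof.
move=> aS; exists (cast_ord (esym e) (enum_rank_in aS a)).
by rewrite /list_set cast_ordKV enum_rankK_in.
Qed.

Lemma prod_list_set m S (e : m = #|S|) (F : 'I_n -> K) :
  \prod_(a in S) F a = \prod_(i < m) F (list_set e i).
Proof.
subst m; rewrite big_enum_val; apply: eq_bigr => i _.
by rewrite /list_set cast_ord_id.
Qed.

(** [minor] lists the columns through [nth]; here rows and columns share one index type ['I_m], to
    which matrix identities apply. *)
Lemma minor_mxsub A I J m (eI : m = #|I|) (eJ : m = #|J|) :
  minor A I J = \det (mxsub (list_set eI) (list_set eJ) A).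
Proof.
subst m; congr (\det _); apply/matrixP => i j; rewrite !mxE.
by rewrite /list_set cast_ord_id [enum_val (cast_ord _ _)](enum_val_nth (enum_val i)).
Qed.

(** The multilinear half of Cauchy-Binet: f chooses the row of Y that is paired with each row of
    X. *)
Lemma det_mul_ffun m (X : 'M[K]_(m, n)) (Y : 'M[K]_(n, m)) :
  \det (X *m Y) =
  \sum_(f : {ffun 'I_m -> 'I_n}) (\prod_i X i (f i)) * \det (rowsub f Y).
Proof.
rewrite /determinant.
under eq_bigr => s _.
  under eq_bigr => i _ do rewrite mxE.
  rewrite bigA_distr_bigA /= big_distrr /=; over.
rewrite exchange_big /=; apply: eq_bigr => f _; rewrite big_distrr /=.
apply: eq_bigr => s _; rewrite big_split /= mulrCA; congr (_ * (_ * _)).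
by apply: eq_bigr => i _; rewrite !mxE.
Qed.

Lemma det_rowsub_perm m (Y : 'M[K]_m) (s : 'S_m) :
  \det (rowsub s Y) = (-1) ^+ s * \det Y.
Proof.
rewrite -det_perm -det_mulmx -row_permE; congr (\det _).
by apply/matrixP => i j; rewrite !mxE.
Qed.

(** A total version of [perm], which wants a proof of injectivity: [reindex_onto] needs an inverse
    defined on all maps. *)
Definition perm_near m (f : 'I_m -> 'I_m) : 'S_m :=
  odflt 1%g [pick s : 'S_m | [forall i, s i == f i]].

Lemma perm_nearE m (f : 'I_m -> 'I_m) : injective f -> perm_near f =1 f.
Proof.
move=> fi i; rewrite /perm_near; case: pickP => [s /forallP /(_ i) /eqP //|].
by move/(_ (perm fi)) => /negP[]; apply/forallP => j; rewrite permE.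
Qed.

(** Non-injective f give a repeated row. Injective ones are grouped by their image L: they are the
    listing of L composed with a permutation, whose sign rebuilds the minor of A. *)
Lemma cauchy_binet A B I J : #|I| = #|J| ->
  minor (A *m B) I J =
  \sum_(L : {set 'I_n} | #|L| == #|I|) minor A I L * minor B L J.
Proof.
move=> eIJ; pose m := #|I|.
rewrite (minor_mxsub _ (erefl m : m = #|I|) eIJ).
set eI := list_set _; set eJ := list_set _.
have -> : mxsub eI eJ (A *m B) = mxsub eI id A *m mxsub id eJ B.
  by apply/matrixP => i j; rewrite !mxE; apply: eq_bigr => k _; rewrite !mxE.
rewrite det_mul_ffun (bigID (fun f : {ffun 'I_m -> 'I_n} => injectiveb f)) /=.
rewrite [X in _ + X]big1 ?addr0; last first.
  move=> f /injectivePn [i [j ij fij]].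
  rewrite (determinant_alternate ij) ?mulr0 // => k.
  by rewrite !mxE fij.
rewrite (partition_big (fun f : {ffun _ -> _} => f @: setT)
          (fun L : {set 'I_n} => #|L| == m)) /=; last first.
  by move=> f /injectiveP fi; rewrite card_imset // cardsT card_ord.
apply: eq_bigr => L /eqP eL; have {}eL := esym eL.
rewrite (minor_mxsub _ (erefl m : m = #|I|) eL) (minor_mxsub _ eL eIJ).
rewrite -/eI -/eJ; set l := list_set eL.
pose ix (f : {ffun 'I_m -> 'I_n}) := [ffun i => odflt i [pick k | l k == f i]].
have l_inj : injective l by exact: list_set_inj.
have ixE (f : {ffun 'I_m -> 'I_n}) i : f i \in L -> l (ix f i) = f i.
  move=> fL; rewrite ffunE; case: pickP => [k /eqP //|].
  by have [k <-] := list_setP eL fL; move/(_ k); rewrite eqxx.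
have l_in i : l i \in L by exact: list_set_in.
have l_onto a : a \in L -> exists i, l i = a by exact: list_setP.
clearbody l ix.
rewrite (reindex_onto (fun s : 'S_m => [ffun i => l (s i)])
  (fun f => perm_near (ix f))) /=; last first.
  move=> f /andP[/injectiveP fi /eqP fL].
  have fin i : f i \in L by rewrite -fL imset_f.
  apply/ffunP => i; rewrite ffunE perm_nearE ?ixE //.
  by move=> a b e; apply: fi; rewrite -[f a]ixE // -[f b]ixE // e.
rewrite [X in X * _]/determinant big_distrl /=.
apply: eq_big => [s|s _].
  have ixs k : ix [ffun i => l (s i)] k = s k.
    by apply: l_inj; rewrite ixE ffunE.
  apply/andP; split; first (apply/andP; split).
  - by apply/injectiveP => i j; rewrite !ffunE => /l_inj /perm_inj.
  - apply/eqP/setP => a; apply/imsetP/idP => [[i _ ->]|aL].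
      by rewrite ffunE l_in.
    have [i <-] := l_onto a aL; exists (s^-1 i)%g => //.
    by rewrite ffunE permKV.
  - apply/eqP/permP => i; rewrite perm_nearE ?ixs // => j k.
    by rewrite !ixs => /perm_inj.
rewrite -mulrA [RHS]mulrA [RHS]mulrC mulrA [RHS]mulrC; congr (_ * _).
  by apply: eq_bigr => i _; rewrite !mxE ffunE.
rewrite mulrC -det_rowsub_perm; congr (\det _).
by apply/matrixP => i j; rewrite !mxE ffunE.
Qed.

(** A nonzero term of the Leibniz expansion, read as a bijection from I to J along nonzero entries.
    Support and weight arguments on minors start from it. *)
Lemma minor_neq0 A I J : #|I| = #|J| -> minor A I J != 0 ->
  exists f : 'I_n -> 'I_n,
    [/\ {in I &, injective f}, f @: I = J & forall a, a \in I -> A a (f a) != 0].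
Proof.
move=> eIJ; rewrite (minor_mxsub _ (erefl #|I|) eIJ) /determinant => nz.
have [s snz|z] := pickP (fun s : 'S_#|I| => \prod_i
  mxsub (list_set (erefl #|I|)) (list_set eIJ) A i (s i) != 0); last first.
  by case/eqP: nz; rewrite big1 // => s _; rewrite (eqP (negbFE (z s))) mulr0.
pose k a := odflt a (omap (fun i => list_set eIJ (s i))
  [pick i | list_set (erefl #|I|) i == a]).
have kE i : k (list_set (erefl #|I|) i) = list_set eIJ (s i).
  rewrite /k; case: pickP => [j /eqP /list_set_inj -> //|].
  by move/(_ i); rewrite eqxx.
exists k; split.
- move=> a b /(list_setP (erefl _))[i <-] /(list_setP (erefl _))[j <-].
  by rewrite !kE => /list_set_inj /perm_inj ->.
- apply/setP => b; apply/imsetP/idP => [[a /(list_setP (erefl _))[i <-] ->]|].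
    by rewrite kE list_set_in.
  move=> /(list_setP eIJ)[i <-]; exists (list_set (erefl #|I|) (s^-1 i)%g).
    exact: list_set_in.
  by rewrite kE permKV.
- move=> a /(list_setP (erefl _))[i <-]; rewrite kE.
  by have /prodf_neq0 /(_ i isT) := snz; rewrite mxE.
Qed.

Lemma eq_minor A B I J : #|I| = #|J| ->
  (forall a b, a \in I -> b \in J -> A a b = B a b) -> minor A I J = minor B I J.
Proof.
move=> eIJ eAB; rewrite !(minor_mxsub _ (erefl #|I|) eIJ); congr (\det _).
by apply/matrixP => i j; rewrite !mxE eAB ?list_set_in.
Qed.

Lemma minor_tr A I J : #|I| = #|J| -> minor A^T I J = minor A J I.
Proof.
move=> eIJ; rewrite (minor_mxsub _ (erefl #|I|) eIJ).
rewrite (minor_mxsub _ eIJ (erefl #|I|)) -det_tr; congr (\det _).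
by apply/matrixP => i j; rewrite !mxE.
Qed.

Lemma minor_row_scale (d : 'rV[K]_n) A I J : #|I| = #|J| ->
  minor (diag_mx d *m A) I J = (\prod_(a in I) d 0 a) * minor A I J.
Proof.
move=> eIJ; rewrite !(minor_mxsub _ (erefl #|I|) eIJ).
have -> : mxsub (list_set (erefl #|I|)) (list_set eIJ) (diag_mx d *m A) =
    diag_mx (\row_i d 0 (list_set (erefl #|I|) i)) *m
    mxsub (list_set (erefl #|I|)) (list_set eIJ) A.
  by apply/matrixP => i j; rewrite !mul_diag_mx !mxE.
rewrite det_mulmx det_diag; congr (_ * _).
by rewrite (prod_list_set (erefl #|I|)); apply: eq_bigr => i _; rewrite !mxE.
Qed.

Lemma minor1 I J : #|I| = #|J| -> minor (1%:M : 'M[K]_n) I J = (I == J)%:R.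
Proof.
move=> eIJ; have [<-|neIJ] := eqVneq I J.
  rewrite (minor_mxsub _ (erefl #|I|) (erefl #|I|)) -[RHS](@det1 _ #|I|).
  congr (\det _); apply/matrixP => i j; rewrite !mxE.
  by rewrite (inj_eq (@list_set_inj _ _ _)).
apply/eqP; case: eqP => // /eqP /(minor_neq0 eIJ)[f [_ fIJ fa]].
case/eqP: neIJ; rewrite -fIJ -[LHS]imset_id; apply: eq_in_imset => a /fa.
by rewrite mxE; case: (a =P f a) => [<- //|_]; rewrite eqxx.
Qed.

Lemma minor_diag (d : 'rV[K]_n) I J : #|I| = #|J| ->
  minor (diag_mx d) I J = (\prod_(a in I) d 0 a) * (I == J)%:R.
Proof. by move=> eIJ; rewrite -[diag_mx d]mulmx1 minor_row_scale // minor1. Qed.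

Lemma minor_setT A : minor A setT setT = \det A.
Proof.
have e : n = #|[set: 'I_n]| by rewrite cardsT card_ord.
rewrite (minor_mxsub _ e e).
have inj := @list_set_inj _ _ e.
have -> : mxsub (list_set e) (list_set e) A =
   row_perm (perm inj) (col_perm (perm inj) A).
  by apply/matrixP => i j; rewrite !mxE !permE.
rewrite row_permE col_permE !det_mulmx !det_perm odd_permV.
by rewrite mulrCA -signr_addb addbb mulr1.
Qed.

Lemma minor_upper A I : (forall i j : 'I_n, (j < i)%N -> A i j = 0) ->
  minor A I I = \prod_(a in I) A a a.
Proof.
move=> up.
have incr (i j : 'I_#|I|) : (i < j)%N ->
    (list_set (erefl #|I|) i < list_set (erefl #|I|) j)%N.
  move=> ij; rewrite /list_set !cast_ord_id.
  have a0 : 'I_n := enum_val i.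
  rewrite !(enum_val_nth a0).
  have st : sorted (fun a b : 'I_n => a < b)%N (enum I).
    rewrite {1}/enum_mem -enumT; apply: sorted_filter => [? ? ?|]; first exact: ltn_trans.
    have := iota_ltn_sorted 0 n; rewrite -val_enum_ord sorted_map.
    exact.
  apply: (sorted_ltn_nth _ a0 st) => //=; rewrite ?inE -?cardE //.
  by move=> ? ? ?; exact: ltn_trans.
rewrite (minor_mxsub _ (erefl #|I|) (erefl #|I|)) -det_tr det_trig.
  by rewrite (prod_list_set (erefl #|I|)); apply: eq_bigr => i _; rewrite !mxE.
by apply/is_trig_mxP => i j ij; rewrite !mxE up // incr.
Qed.

End Minors.

(** * Expansions of particular minors *)

Section MinorExpansions.
Variables (K : fieldType) (n : nat).
Implicit Types (A B g h : 'M[K]_n) (I J L S : {set 'I_n}).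

(** In a principal minor the listing order contributes the same sign for the rows and for the
    columns. *)
Lemma minor_enum A S m (f : 'I_m -> 'I_n) : injective f -> f @: setT = S ->
  minor A S S = \det (mxsub f f A).
Proof.
move=> fi fS.
have e : m = #|S| by rewrite -fS card_imset // cardsT card_ord.
pose k i := odflt i [pick j | list_set e j == f i].
have kE i : list_set e (k i) = f i.
  have fin : f i \in S by rewrite -fS imset_f.
  have [j ej] := list_setP e fin.
  by rewrite /k; case: pickP => [? /eqP //|/(_ j)]; rewrite ej eqxx.
have ki : injective k by move=> i j ij; apply: fi; rewrite -!kE ij.
rewrite (minor_mxsub _ e e).
have -> : mxsub f f A = row_perm (perm ki) (col_perm (perm ki)
    (mxsub (list_set e) (list_set e) A)).
  by apply/matrixP => i j; rewrite !mxE !permE !kE.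
rewrite row_permE col_permE !det_mulmx !det_perm odd_permV.
by rewrite mulrCA -signr_addb addbb mulr1.
Qed.

Lemma minor_setU1 A S a : a \notin S -> (forall s, s \in S -> A s a = 0) ->
  minor A (a |: S) (a |: S) = A a a * minor A S S.
Proof.
move=> aS As.
(* Listing a before S makes the submatrix block upper triangular. *)
pose f (i : 'I_(1 + #|S|)) := match split i with
  | inl _ => a | inr j => list_set (erefl #|S|) j end.
have fl i : f (lshift _ i) = a by rewrite /f (unsplitK (inl i)).
have fr i : f (rshift _ i) = list_set (erefl #|S|) i by rewrite /f (unsplitK (inr i)).
have Sl i : list_set (erefl #|S|) i \in S by exact: list_set_in.
have fi : injective f.
  move=> i j; case: (splitP i) => i' ei; case: (splitP j) => j' ej.
  - by move=> _; apply: val_inj; rewrite /= ei ej !ord1.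
  - rewrite (_ : i = lshift _ i'); last exact: val_inj.
    rewrite (_ : j = rshift _ j'); last exact: val_inj.
    by rewrite fl fr => e; case/negP: aS; rewrite e.
  - rewrite (_ : j = lshift _ j'); last exact: val_inj.
    rewrite (_ : i = rshift _ i'); last exact: val_inj.
    by rewrite fl fr => e; case/negP: aS; rewrite -e.
  - rewrite (_ : i = rshift _ i'); last exact: val_inj.
    rewrite (_ : j = rshift _ j'); last exact: val_inj.
    by rewrite !fr => /list_set_inj ->.
have fim : f @: setT = a |: S.
  apply/setP => b; rewrite !inE; apply/imsetP/orP.
    move=> [i _ ->]; rewrite -(splitK i); case: (split i) => j /=.
      by rewrite fl eqxx; left.
    by rewrite fr Sl; right.
  move=> [/eqP ->|/(list_setP (erefl _))[j <-]].
    by exists (lshift _ ord0); rewrite ?fl.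
  by exists (rshift _ j); rewrite ?fr.
rewrite (minor_enum _ fi fim) (minor_mxsub _ (erefl #|S|) (erefl #|S|)).
rewrite -[mxsub f f A]submxK (_ : dlsubmx _ = 0); last first.
  by apply/matrixP => i j; rewrite !mxE fr fl As.
rewrite det_ublock; congr (_ * _); first by rewrite det_mx11 !mxE fl.
by congr (\det _); apply/matrixP => i j; rewrite !mxE !fr.
Qed.

(** By linearity in row s, the difference is the determinant of the S x S submatrix C with row s
    replaced by row j of A. These Cramer numerators form the row v adj(C), with v the row j, and
    adj(C) C = det C. *)
Lemma minor_cramer A S j t : t \in S ->
  \sum_(s in S) (minor ((1%:M + delta_mx s j) *m A) S S - minor A S S) * A s t
  = minor A S S * A j t.
Proof.
pose f := list_set (erefl #|S|).
move=> /(list_setP (erefl #|S|))[t' <-]; rewrite -/f.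
pose C := mxsub f f A.
have mC : minor A S S = \det C by exact: minor_mxsub.
pose v : 'rV_#|S| := \row_k A j (f k).
have rowE i : minor ((1%:M + delta_mx (f i) j) *m A) S S - minor A S S =
    (v *m \adj C) 0 i.
  rewrite (minor_mxsub _ (erefl #|S|) (erefl #|S|)) -/f mC.
  set C' := mxsub f f _.
  have C'E k l : C' k l = C k l + (k == i)%:R * v 0 l.
    rewrite [C' k l]mxE [C k l]mxE [v _ _]mxE mulmxDl mul1mx mxE; congr (_ + _).
    rewrite mxE (bigD1 j) //= big1 ?addr0 => [|l0 /negbTE l0j].
      by rewrite mxE eqxx andbT (inj_eq (@list_set_inj _ _ _ _)).
    by rewrite mxE l0j andbF mul0r.
  rewrite (expand_det_row C' i) (expand_det_row C i) -sumrB mxE.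
  apply: eq_bigr => k _; rewrite C'E eqxx mul1r /cofactor.
  rewrite [\adj C k i]mxE /cofactor.
  have -> : row' i (col' k C') = row' i (col' k C).
    apply/matrixP => p q; rewrite ![row' _ _ _ _]mxE ![col' _ _ _ _]mxE C'E.
    by rewrite eq_sym (negbTE (neq_lift _ _)) mul0r addr0.
  by rewrite -mulrBl addrAC subrr add0r.
rewrite [X in _ = X * _]mC.
have -> : \det C * A j (f t') = (v *m \adj C *m C) 0 t'.
  by rewrite -mulmxA mul_adj_mx mul_mx_scalar !mxE.
rewrite [RHS]mxE.
rewrite (reindex_onto f (fun s => if [pick k | f k == s] is Some k then k else t'))
   /=; last first.
  move=> s sS; have [k ek] := list_setP (erefl #|S|) sS.
  by case: pickP => [? /eqP //|/(_ k)]; rewrite -ek eqxx.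
apply: eq_big => [i|i _]; last by rewrite rowE [C i t']mxE.
rewrite list_set_in /=; case: pickP => [k /eqP /list_set_inj -> |/(_ i)].
  by rewrite eqxx.
by rewrite eqxx.
Qed.

Lemma minor_mono_support A I J (s : 'I_n -> 'I_n) : #|I| = #|J| ->
  (forall a b, A a b != 0 -> b = s a) -> minor A I J != 0 -> J = s @: I.
Proof.
move=> eIJ As /(minor_neq0 eIJ)[f [_ <- fa]].
by apply: eq_in_imset => a /fa /As.
Qed.

(** By Cauchy-Binet the minor 1 of A A^-1 at (I, I) is a sum of products of minors, one of which is
    nonzero. *)
Lemma unit_minor_neq0 A I : A \in unitmx ->
  exists2 J : {set 'I_n}, #|I| = #|J| & minor A I J != 0.
Proof.
move=> Au; have : minor (A *m invmx A) I I != 0.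
  by rewrite mulmxV // minor1 // eqxx oner_neq0.
rewrite cauchy_binet // => nz.
have [J /andP[/eqP JI mJ]|z] :=
    pickP (fun J : {set 'I_n} => (#|J| == #|I|) && (minor A I J != 0)).
  by exists J.
case/eqP: nz; rewrite big1 // => J JI; have := z J; rewrite JI /=.
by move=> /negbFE /eqP ->; rewrite mul0r.
Qed.

Lemma cardsU1_notin S a b : a \notin S -> b \notin S -> #|a |: S| = #|b |: S|.
Proof. by move=> aS bS; rewrite !cardsU1 aS bS. Qed.

Lemma imset_tperm_setU1 S a b : a \notin S -> b \notin S ->
  tperm a b @: (a |: S) = b |: S.
Proof.
move=> aS bS; rewrite imsetU1 tpermL; congr (_ |: _).
rewrite -[RHS]imset_id; apply: eq_in_imset => s sS; rewrite tpermD //.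
  by apply: contraNneq aS => ->.
by apply: contraNneq bS => ->.
Qed.

Lemma tperm_mx_neq0 a b c d : (tperm_mx a b : 'M[K]_n) c d != 0 -> d = tperm a b c.
Proof. by rewrite !mxE; case: (_ =P d) => // _; rewrite eqxx. Qed.

(** A sign, due to the increasing listing of rows and columns; only its nonvanishing matters. *)
Definition swap_sign S a b : K := minor (tperm_mx a b) (b |: S) (a |: S).

Lemma swap_sign_neq0 S a b : a \notin S -> b \notin S -> swap_sign S a b != 0.
Proof.
move=> aS bS; have [J eJ nz] := 
  @unit_minor_neq0 (tperm_mx a b) (b |: S) (unitmx_perm _ _).
rewrite /swap_sign; have -> // : a |: S = J.
  by rewrite (minor_mono_support eJ (@tperm_mx_neq0 a b) nz) tpermC imset_tperm_setU1.
Qed.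

(* With columns a and b exchanged, [minor_setU1] applies; the exchange only
   contributes a factor which does not depend on A. *)
Lemma minor_setU1_swap A S a b : a \notin S -> b \notin S ->
  (forall s, s \in S -> A s b = 0) ->
  minor A (a |: S) (b |: S) * swap_sign S a b = A a b * minor A S S.
Proof.
move=> aS bS As; pose T : 'M[K]_n := tperm_mx a b.
have colT i j : (A *m T) i j = A i (tperm a b j).
  by rewrite /T /tperm_mx -[tperm a b]tpermV -col_permE mxE tpermV.
have imT : tperm a b @: (b |: S) = a |: S by rewrite tpermC imset_tperm_setU1.
have neqS s : s \in S -> tperm a b s = s.
  move=> sS; rewrite tpermD //; first by apply: contraNneq aS => ->.
  by apply: contraNneq bS => ->.
have := @minor_setU1 (A *m T) S a aS.
rewrite colT tpermL (@eq_minor _ _ (A *m T) A S S) //; last first.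
  by move=> s t sS tS; rewrite colT neqS.
move=> <-; last by move=> s sS; rewrite colT tpermL As.
rewrite cauchy_binet // (bigD1 (b |: S)) /=; last by rewrite (cardsU1_notin aS bS).
rewrite big1 ?addr0 // => L /andP[/eqP eL neL].
apply/eqP; rewrite mulf_eq0; apply/orP; right; apply: contraNT neL => nz.
have := minor_mono_support eL (@tperm_mx_neq0 a b) nz.
by rewrite -imT => /(imset_inj (@perm_inj _ (tperm a b))) ->.
Qed.

(* In the Leibniz expansion the columns chosen by a nonzero term add up to at
   most \sum_(a in I) s a, with equality only for the term of s itself. *)
Lemma minor_dominant A B I (s : 'I_n -> 'I_n) : injective s ->
  (forall a b : 'I_n, (s a < b)%N -> A a b = 0) ->
  (forall a b : 'I_n, (s a < b)%N -> B a b = 0) ->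
  (forall a, A a (s a) = B a (s a)) -> minor A I (s @: I) = minor B I (s @: I).
Proof.
move=> si As Bs AB; have eI : #|I| = #|s @: I| by rewrite card_imset.
rewrite !(minor_mxsub _ (erefl #|I|) eI) /determinant.
apply: eq_bigr => p _; congr (_ * _).
pose e := list_set (erefl #|I|); pose f := list_set eI.
have [le|] := boolP [forall i, (f (p i) <= s (e i))%N]; last first.
  move=> /forallPn [i]; rewrite -ltnNge => lt.
  by rewrite (bigD1 i) //= [RHS](bigD1 i) //= !mxE As // Bs // !mul0r.
have eqf i : f (p i) = s (e i).
  have sumE : (\sum_i (f (p i) : nat) = \sum_i (s (e i) : nat))%N.
    transitivity (\sum_i (f i : nat))%N; first by rewrite [RHS](reindex_inj (@perm_inj _ p)).
    pose q i := odflt i [pick j | f j == s (e i)].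
    have qE i0 : f (q i0) = s (e i0).
      have : s (e i0) \in s @: I by rewrite imset_f ?list_set_in.
      move=> /(list_setP eI)[j ej].
      by rewrite /q; case: pickP => [? /eqP //|/(_ j)]; rewrite /f ej eqxx.
    rewrite (reindex_inj (h := q)); last first.
      by move=> j k jk; apply: (@list_set_inj _ _ _ (erefl #|I|)); apply: si;
         rewrite -/e -!qE jk.
    by apply: eq_bigr => j _; rewrite qE.
  apply: val_inj; apply/eqP; move: sumE => /eqP.
  have /leqif_sum := fun i (_ : true) => leqif_eq (forallP le i).
  by move=> /= [_ ->] /forallP /(_ i).
by apply: eq_bigr => i _; rewrite !mxE -/e -/f eqf.
Qed.

End MinorExpansions.

(** * Homogeneous coordinates and the action of matrices *)

Section Tuples.
Variables (K : fieldType) (n : nat).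
Implicit Types (A g h : 'M[K]_n) (I J L S : {set 'I_n}) (x y : ambient K n).

(** Coordinates indexed by arbitrary pairs of sets, 0 outside the index type, so that sums can run
    over sets. *)
Definition entry x I J : K := if insub (I, J) is Some c then x c else 0.

Lemma entryE x (c : coord n) : entry x (rows_of c) (cols_of c) = x c.
Proof. by rewrite /entry -surjective_pairing valK. Qed.

Lemma coordP (c : coord n) :
  #|rows_of c| = #|cols_of c| /\ (0 < #|rows_of c| < n)%N.
Proof. by have /andP[/eqP ? ?] := valP c. Qed.

Lemma coord_ex I J : #|I| = #|J| -> (0 < #|I| < n)%N ->
  exists c : coord n, rows_of c = I /\ cols_of c = J.
Proof.
move=> eIJ lI.
have h : (#|(I, J).1| == #|(I, J).2|) && (0 < #|(I, J).1| < n)%N.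
  by rewrite /= eIJ eqxx -eIJ.
by exists (Sub (I, J) h); rewrite /rows_of /cols_of SubK.
Qed.

Lemma entry_compounds A I J : #|I| = #|J| -> (0 < #|I| < n)%N ->
  entry (compounds A) I J = minor A I J.
Proof.
by move=> eIJ /(coord_ex eIJ)[c [<- <-]]; rewrite entryE ffunE.
Qed.

Lemma sum_coord (F : {set 'I_n} -> {set 'I_n} -> K) i : (0 < i < n)%N ->
  \sum_(c : coord n | degree_of c == i) F (rows_of c) (cols_of c) =
  \sum_(I : {set 'I_n} | #|I| == i) \sum_(J : {set 'I_n} | #|J| == i) F I J.
Proof.
move=> hi; rewrite pair_big /=.
have i_coord (p : {set 'I_n} * {set 'I_n}) : (#|p.1| == i) && (#|p.2| == i) ->
    (#|p.1| == #|p.2|) && (0 < #|p.1| < n)%N.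
  by move=> /andP[/eqP -> /eqP ->]; rewrite eqxx.
have [c0 _|none] := pickP (fun c : coord n => degree_of c == i); last first.
  rewrite big_pred0 // big_pred0 // => p; apply/negP => hp0.
  have hp := i_coord p hp0; have /andP[p1 _] := hp0.
  by have := none (Sub p hp); rewrite /degree_of /rows_of SubK p1.
rewrite [RHS](reindex_onto (val : coord n -> _) (insubd c0)) /=; last first.
  by move=> p /i_coord hp; rewrite insubdK.
apply: eq_bigl => c; rewrite valKd eqxx andbT /degree_of.
have [e _] := coordP c; rewrite -/(rows_of c) -/(cols_of c) -e.
by rewrite andbb.
Qed.

Lemma actE g x c : act g x c =
  \sum_(I : {set 'I_n} | #|I| == degree_of c) \sum_(J : {set 'I_n} | #|J| == degree_of c)
    minor g (rows_of c) I * entry x I J * minor g (cols_of c) J.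
Proof.
rewrite ffunE -sum_coord; last by have [] := coordP c.
by apply: eq_bigr => c' _; rewrite entryE.
Qed.

Lemma act_compounds g A : act g (compounds A) = compounds (g *m A *m g^T).
Proof.
apply/ffunP => c; rewrite actE ffunE; have [e lt] := coordP c.
rewrite cauchy_binet // exchange_big /=; apply: eq_bigr => J /eqP eJ.
rewrite cauchy_binet ?eJ // minor_tr ?eJ -?e // big_distrl /=.
by apply: eq_big => // I /eqP eI; rewrite entry_compounds ?eI ?eJ.
Qed.

(** Functoriality of exterior powers: Cauchy-Binet once for the rows and once for the columns. *)
Lemma act_mul g h x : act g (act h x) = act (g *m h) x.
Proof.
apply/ffunP => c; rewrite ffunE [RHS]ffunE; have [e lt] := coordP c.
under eq_bigr => c' /eqP dc'.
  rewrite ffunE [X in X * _]big_distrr big_distrl /= dc'; over.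
rewrite exchange_big /=.
apply: eq_bigr => c2 /eqP dc2.
have [e2 _] := coordP c2.
rewrite cauchy_binet ?cauchy_binet;
  try by rewrite -?e -?e2 -/(degree_of c) -/(degree_of c2).
rewrite -e.
pose G I J := minor g (rows_of c) I *
  (minor h I (rows_of c2) * x c2 * minor h J (cols_of c2)) * minor g (cols_of c) J.
rewrite (eq_bigr (fun c' => G (rows_of c') (cols_of c'))) //.
rewrite (sum_coord G) // [X in _ = X * _]big_distrl [RHS]big_distrl /=.
apply: eq_bigr => I _; rewrite [RHS]big_distrr /=.
by apply: eq_bigr => J _; rewrite /G -!mulrA; do 3!congr (_ * _); rewrite mulrC.
Qed.

Lemma same_point_refl x : same_point x x.
Proof. by exists (fun=> 1) => [i|c]; rewrite ?oner_neq0 ?mul1r. Qed.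

Lemma same_point_sym x y : same_point x y -> same_point y x.
Proof.
move=> [s s0 e]; exists (fun i => (s i)^-1) => [i|c]; first by rewrite invr_eq0.
by rewrite e mulKf.
Qed.

Lemma same_point_trans y x z : same_point x y -> same_point y z -> same_point x z.
Proof.
move=> [s s0 e] [s' s0' e']; exists (fun i => s' i * s i) => [i|c].
  by rewrite mulf_neq0.
by rewrite e' e mulrA.
Qed.

Lemma act_same_point g x y : same_point x y -> same_point (act g x) (act g y).
Proof.
move=> [s s0 e]; exists s => // c; rewrite !ffunE big_distrr /=.
apply: eq_bigr => c' /eqP dc'; rewrite e dc' !mulrA; congr (_ * _ * _).
by rewrite mulrC.
Qed.

Lemma act_diag (d : 'rV[K]_n) x c : act (diag_mx d) x c =
  (\prod_(a in rows_of c) d 0 a) * x c * \prod_(a in cols_of c) d 0 a.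
Proof.
have [e _] := coordP c.
rewrite ffunE (bigD1 c) //= big1 ?addr0 => [|c' /andP[/eqP dc' nc']].
  by rewrite !minor_diag // !eqxx !mulr1.
have [e' _] := coordP c'; rewrite !minor_diag //; last by rewrite -e -e'.
case: eqP => [er|]; last by rewrite mulr0 !mul0r.
case: eqP => [ec|]; last by rewrite !mulr0.
case/eqP: nc'; apply: val_inj; rewrite (surjective_pairing (val c')).
by rewrite (surjective_pairing (val c)); congr (_, _).
Qed.

Lemma act_one x : act 1%:M x = x.
Proof.
apply/ffunP => c; rewrite -diag_const_mx act_diag !big1 ?mul1r ?mulr1 //.
  by move=> a _; rewrite mxE.
by move=> a _; rewrite mxE.
Qed.

Lemma act_scalar (a : K) x : a != 0 -> same_point x (act a%:M x).
Proof.
move=> a0; exists (fun i => a ^+ i * a ^+ i) => [i|c].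
  by rewrite mulf_neq0 // expf_neq0.
have [e _] := coordP c; rewrite -diag_const_mx act_diag.
under eq_bigr do rewrite mxE; under [X in _ * X]eq_bigr do rewrite mxE.
by rewrite !prodr_const -e mulrAC.
Qed.

Lemma is_point_same x y : same_point x y -> is_point x -> is_point y.
Proof.
move=> [s s0 e] px i /px[c dc xc]; exists c => //; rewrite e mulf_neq0 //.
Qed.

Lemma is_point_act g x : g \in unitmx -> is_point x -> is_point (act g x).
Proof.
move=> gu px i hi; apply: NNPP => none.
have [c dc] := px i hi; rewrite -[x]act_one -(mulVmx gu) -act_mul ffunE big1 ?eqxx //.
move=> c' /eqP dc'; have [->|nz] := eqVneq (act g x c') 0.
  by rewrite mulr0 mul0r.
by case: none; exists c'; rewrite // dc'.
Qed.

Lemma is_point_act_inv g x : g \in unitmx -> is_point (act g x) -> is_point x.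
Proof.
move=> gu px; rewrite -[x]act_one -(mulVmx gu) -act_mul.
by apply: is_point_act; rewrite ?unitmx_inv.
Qed.

Lemma is_point_compounds A : A \in unitmx -> is_point (compounds A).
Proof.
move=> Au i hi.
have [I /eqP eI] : exists I : {set 'I_n}, #|I| == i.
  have/card_geqP[s [us ss _]] : (i <= #|'I_n|)%N by rewrite card_ord ltnW; case/andP: hi.
  by exists [set:: s]; rewrite cardsE -ss; apply/eqP/card_uniqP.
have [J eJ nz] := unit_minor_neq0 I Au.
have hI : (0 < #|I| < n)%N by rewrite eI.
have [c [rc cc]] := coord_ex eJ hI.
by exists c; rewrite ?ffunE /degree_of rc ?cc.
Qed.

End Tuples.

(** * Closed sets and polynomial curves *)

Section MultiHom.
Variables (K : fieldType) (n : nat).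
Implicit Types (g : 'M[K]_n) (x y : ambient K n) (S Z : ambient K n -> Prop).
Implicit Types (f : ambient K n -> K) (d : nat -> nat).

(** A multihomogeneous polynomial seen as a function, d i being its degree in the i-th factor; later
    arguments then handle values instead of supports. *)
Definition mhfun d f := exists2 F, multihomogeneous d F & forall x, f x = zeval F x.

Lemma mhfun_ext d d' f f' : mhfun d f -> d =1 d' -> f =1 f' -> mhfun d' f'.
Proof.
move=> [F hF e] ed ef; exists F => [m mF i|x]; first by rewrite hF.
by rewrite -ef.
Qed.

Lemma mhfun_coord (c : coord n) : mhfun (fun i => degree_of c == i) (fun x => x c).
Proof.
exists 'X_(enum_rank c) => [m|x]; last by rewrite /zeval mevalXU enum_rankK.
rewrite msuppX inE => /eqP -> i; rewrite big_mkcond /=.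
rewrite (bigD1 (enum_rank c)) //= enum_rankK mnm1E eqxx big1 ?addn0 => [|v /negbTE nv].
  by case: ifP.
by rewrite mnm1E [_ == v]eq_sym nv; case: ifP.
Qed.

Lemma mhfun_const (a : K) : mhfun (fun=> 0%N) (fun=> a).
Proof.
exists a%:MP => [m|x]; last by rewrite /zeval mevalC.
rewrite msuppC; case: eqP => // _; rewrite inE => /eqP -> i.
by rewrite big1 // => v _; rewrite mnm0E.
Qed.

Lemma mhfunM d1 d2 f1 f2 : mhfun d1 f1 -> mhfun d2 f2 ->
  mhfun (fun i => d1 i + d2 i)%N (fun x => f1 x * f2 x).
Proof.
move=> [F1 h1 e1] [F2 h2 e2]; exists (F1 * F2) => [m|x]; last first.
  by rewrite /zeval mevalM e1 e2.
move=> /msuppM_le /allpairsP[[m1 m2] /= [m1F m2F ->]] i.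
rewrite -(h1 _ m1F) -(h2 _ m2F) -big_split /=.
by apply: eq_bigr => v _; rewrite mnmDE.
Qed.

Lemma mhfunD d f1 f2 : mhfun d f1 -> mhfun d f2 -> mhfun d (fun x => f1 x + f2 x).
Proof.
move=> [F1 h1 e1] [F2 h2 e2]; exists (F1 + F2) => [m|x]; last first.
  by rewrite /zeval mevalD e1 e2.
by move=> /msuppD_le; rewrite mem_cat => /orP[/h1|/h2].
Qed.

Lemma mhfun0 d : mhfun d (fun=> 0).
Proof. by exists 0 => [m|x]; rewrite ?msupp0 // /zeval meval0. Qed.

Lemma mhfunZ d a f : mhfun d f -> mhfun d (fun x => a * f x).
Proof. by move=> hf; apply: mhfun_ext (mhfunM (mhfun_const a) hf) _ _. Qed.

Lemma mhfunB d f1 f2 : mhfun d f1 -> mhfun d f2 -> mhfun d (fun x => f1 x - f2 x).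
Proof.
move=> h1 h2; apply: mhfun_ext (mhfunD h1 (mhfunZ (-1) h2)) _ _ => // x.
by rewrite mulN1r.
Qed.

Lemma mhfun_sum d (I : eqType) (r : seq I) (P : pred I) (F : I -> ambient K n -> K) :
  (forall i, i \in r -> P i -> mhfun d (F i)) ->
  mhfun d (fun x => \sum_(i <- r | P i) F i x).
Proof.
elim: r => [|i r IH] h; first by apply: mhfun_ext (mhfun0 d) _ _ => // x; rewrite big_nil.
have {}IH := IH (fun j jr => h j (mem_behead (s := i :: r) jr)).
case Pi : (P i).
  apply: mhfun_ext (mhfunD (h i (mem_head _ _) Pi) IH) _ _ => // x.
  by rewrite big_cons Pi.
by apply: mhfun_ext IH _ _ => // x; rewrite big_cons Pi.
Qed.

Lemma mhfunX d f k : mhfun d f -> mhfun (fun i => k * d i)%N (fun x => f x ^+ k).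
Proof.
move=> hf; elim: k => [|k IH]; first exact: mhfun_const.
apply: mhfun_ext (mhfunM hf IH) _ _ => [i|x]; first by rewrite mulSn.
by rewrite exprS.
Qed.

Lemma mhfun_prod (I : Type) (r : seq I) (P : pred I) (D : I -> nat -> nat)
    (F : I -> ambient K n -> K) : (forall i, P i -> mhfun (D i) (F i)) ->
  mhfun (fun k => \sum_(i <- r | P i) D i k)%N (fun x => \prod_(i <- r | P i) F i x).
Proof.
move=> h; elim: r => [|i r IH].
  by apply: mhfun_ext (mhfun_const 1) _ _ => ?; rewrite big_nil.
case Pi : (P i).
  by apply: mhfun_ext (mhfunM (h i Pi) IH) _ _ => ?; rewrite big_cons Pi.
by apply: mhfun_ext IH _ _ => ?; rewrite big_cons Pi.
Qed.

(** Rescaling the i-th factor by s i multiplies f by the product of the [s i ^+ d i], so vanishing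
    depends only on the point. *)
Lemma mhfun_same_point d f x y : mhfun d f -> same_point x y ->
  exists2 u, u != 0 & f y = u * f x.
Proof.
move=> [F hF e] [s s0 exy].
exists (\prod_(i < n) s i ^+ d i).
  by rewrite prodf_seq_neq0; apply/allP => i _ /=; rewrite expf_neq0.
rewrite !e /zeval !mevalE big_distrr /= big_seq [RHS]big_seq.
apply: eq_bigr => m mF; rewrite mulrCA; congr (_ * _).
under eq_bigr do rewrite exy exprMn.
rewrite big_split /=; congr (_ * _).
have deg_lt (v : 'I_#|coord n|) : (degree_of (enum_val v) < n)%N.
  by have [_ /andP[]] := coordP (enum_val v).
rewrite (partition_big (fun v => Ordinal (deg_lt v)) predT) //=.
apply: eq_bigr => i _; rewrite -(hF _ mF) -prodrXr.
by apply: eq_big => [v //|v /eqP <-].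
Qed.

Lemma mhfun_comp d f (phi : ambient K n -> ambient K n) : mhfun d f ->
  (forall c, mhfun (fun i => degree_of c == i) (fun x => phi x c)) ->
  mhfun d (fun x => f (phi x)).
Proof.
move=> [F hF e] hphi.
suff : mhfun d (fun x => \sum_(m <- msupp F) F@_m * \prod_v phi x (enum_val v) ^+ m v).
  by move=> h; apply: mhfun_ext h _ _ => // x; rewrite e /zeval mevalE.
apply: mhfun_sum => m mF _; apply: mhfunZ.
have := mhfun_prod (index_enum _) (P := predT)
  (fun v _ => mhfunX (m v) (hphi (enum_val v))).
move=> h; apply: mhfun_ext h _ _ => // i.
rewrite -(hF _ mF i) [RHS]big_mkcond /=; apply: eq_bigr => v _.
by case: ifP; rewrite ?muln1 ?muln0.
Qed.

Lemma mhfun_act d f g : mhfun d f -> mhfun d (fun x => f (act g x)).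
Proof.
move=> hf; apply: mhfun_comp hf _ => c.
suff h : mhfun (fun i => degree_of c == i) (fun x =>
    \sum_(c' : coord n | degree_of c' == degree_of c)
     minor g (rows_of c) (rows_of c') * minor g (cols_of c) (cols_of c') * x c').
  apply: mhfun_ext h _ _ => // x; rewrite ffunE.
  by apply: eq_bigr => c' _; rewrite mulrAC.
apply: mhfun_sum => c' _ /eqP dc'; apply: mhfunZ.
by apply: mhfun_ext (mhfun_coord c') _ _ => // i; rewrite dc'.
Qed.

Lemma mhfun_entry k (I J : {set 'I_n}) : #|I| = k ->
  mhfun (fun i => k == i) (fun y : ambient K n => entry y I J).
Proof.
move=> cI; rewrite /entry; case: insubP => [c _ e|_]; last exact: mhfun0.
by apply: mhfun_ext (mhfun_coord c) _ _ => // i; rewrite /degree_of /rows_of e cI.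
Qed.

Lemma zclosed_fun (Fs : (ambient K n -> K) -> Prop) :
  (forall f, Fs f -> exists d, mhfun d f) ->
  zclosed (fun x => is_point x /\ forall f, Fs f -> f x = 0).
Proof.
move=> h; exists (fun F => (exists d, multihomogeneous d F) /\
    exists2 f, Fs f & forall x, f x = zeval F x) => [F [] //|x].
split=> -[px H]; split=> //.
  by move=> F [_ [f /H <- ->]].
move=> f /[dup] hf /h [d [F hF e]]; rewrite e; apply: H; split; first by exists d.
by exists f.
Qed.

Lemma zclosed_fam Z : zclosed Z -> exists2 Fs : (ambient K n -> K) -> Prop,
  forall f, Fs f -> exists d, mhfun d f &
  forall x, Z x <-> is_point x /\ forall f, Fs f -> f x = 0.
Proof.
move=> [F hF e]; exists (fun f => exists2 p, F p & f =1 zeval p).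
  by move=> f [p /hF[d hp] ef]; exists d, p.
move=> x; rewrite e; split=> -[px H]; split=> //.
  by move=> f [p /H <- ->].
by move=> p Fp; apply: H; exists p.
Qed.

Lemma zclosed_ext Z Z' : zclosed Z -> (forall x, Z x <-> Z' x) -> zclosed Z'.
Proof. by move=> [F hF e] ee; exists F => // x; rewrite -ee. Qed.

Lemma zclosed_point Z x : zclosed Z -> Z x -> is_point x.
Proof. by move=> [F _ e] /e[]. Qed.

Lemma zclosed_same Z x y : zclosed Z -> same_point x y -> Z x -> Z y.
Proof.
move=> /zclosed_fam [Fs h e] xy /e[px H]; apply/e; split.
  exact: is_point_same xy px.
move=> f /[dup] /H fx /h [d /mhfun_same_point hf].
by have [u _ ->] := hf _ _ xy; rewrite fx mulr0.
Qed.

(** The hypothesis excludes a degenerate case: no closed set contains a tuple that is not a point,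
    and the intersection defining [zclosure] would then be everything. *)
Lemma zclosureP S : subset S (@is_point K n) -> forall x, zclosure S x <->
  is_point x /\ forall d f, mhfun d f -> (forall y, S y -> f y = 0) -> f x = 0.
Proof.
move=> Sp x; split=> [H|[px H] Z cZ SZ].
  pose Fs f := (exists d, mhfun d f) /\ forall y, S y -> f y = 0.
  have cl : zclosed (fun x => is_point x /\ forall f, Fs f -> f x = 0).
    by apply: zclosed_fun => f [].
  have [|px hx] := H _ cl; first by move=> y Sy; split; [exact: Sp|move=> f [_]; exact].
  by split=> // d f hf fS; apply: hx; split => //; exists d.
have [Fs h e] := zclosed_fam cZ; apply/e; split=> // f /[dup] Ff /h[d hf].
by apply: H hf _ => y /SZ /e[_]; apply.
Qed.

Lemma zclosure_closed S : subset S (@is_point K n) -> zclosed (zclosure S).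
Proof.
move=> Sp; have cl : zclosed (fun x => is_point x /\ forall f : ambient K n -> K,
   (exists d, mhfun d f) /\ (forall y, S y -> f y = 0) -> f x = 0).
  by apply: zclosed_fun => f [].
apply: zclosed_ext cl _ => x; rewrite zclosureP //; split=> -[px H]; split=> //.
  by move=> d f hf fS; apply: H; split => //; exists d.
by move=> f [[d hf] fS]; apply: H hf fS.
Qed.

Lemma zclosure_sub S : subset S (zclosure S).
Proof. by move=> x Sx Z _; exact. Qed.

Lemma zclosure_min S Z : zclosed Z -> subset S Z -> subset (zclosure S) Z.
Proof. by move=> cZ SZ x; apply. Qed.

Lemma zclosed_act Z g : g \in unitmx -> zclosed Z -> zclosed (fun x => Z (act g x)).
Proof.
move=> gu /zclosed_fam[Fs h e].
have cl : zclosed (fun x => is_point x /\ forall f : ambient K n -> K,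
   (exists2 f', Fs f' & f = fun x => f' (act g x)) -> f x = 0).
  by apply: zclosed_fun => f [f' /h[d hf] ->]; exists d; exact: mhfun_act.
apply: zclosed_ext cl _ => x; rewrite e; split=> -[px H]; split.
- exact: is_point_act.
- by move=> f Ff; apply: (H (fun x => f (act g x))); exists f.
- exact: is_point_act_inv px.
- by move=> f [f' Ff ->]; apply: H.
Qed.

Definition nonsingular_quadrics : ambient K n -> Prop :=
  fun x => exists A : 'M[K]_n, [/\ A^T = A, A \in unitmx & same_point (compounds A) x].

Lemma nonsingular_point : subset nonsingular_quadrics (@is_point K n).
Proof.
by move=> x [A [_ Au e]]; apply: is_point_same e _; exact: is_point_compounds.
Qed.

Lemma complete_quadrics_closed : zclosed (@complete_quadrics K n).
Proof. exact: zclosure_closed nonsingular_point. Qed.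

Lemma complete_quadrics_act g x : g \in unitmx ->
  complete_quadrics x -> complete_quadrics (act g x).
Proof.
move=> gu Xx; move: x Xx; apply: zclosure_min.
  exact: zclosed_act complete_quadrics_closed.
move=> x [A [sA uA e]]; apply: zclosure_sub; exists (g *m A *m g^T); split.
- by rewrite !trmx_mul trmxK sA mulmxA.
- by rewrite !unitmx_mul gu uA unitmx_tr.
- by rewrite -act_compounds; apply: act_same_point.
Qed.

End MultiHom.

Section Curves.
Variable (K : closedFieldType).
Implicit Types (phi : K -> K).

Definition polyfun phi := exists p : {poly K}, forall t, phi t = p.[t].

Lemma polyfun_const a : polyfun (fun=> a).
Proof. by exists a%:P => t; rewrite hornerC. Qed.

Lemma polyfun_id : polyfun id.
Proof. by exists 'X => t; rewrite hornerX. Qed.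

Lemma polyfunD f g : polyfun f -> polyfun g -> polyfun (fun t => f t + g t).
Proof. by move=> [p hp] [q hq]; exists (p + q) => t; rewrite hornerD hp hq. Qed.

Lemma polyfunM f g : polyfun f -> polyfun g -> polyfun (fun t => f t * g t).
Proof. by move=> [p hp] [q hq]; exists (p * q) => t; rewrite hornerM hp hq. Qed.

Lemma polyfunX f k : polyfun f -> polyfun (fun t => f t ^+ k).
Proof. by move=> [p hp]; exists (p ^+ k) => t; rewrite horner_exp hp. Qed.

Lemma polyfun_ext f g : polyfun f -> f =1 g -> polyfun g.
Proof. by move=> [p hp] e; exists p => t; rewrite -e. Qed.

Lemma polyfun_segment (u v : K) : polyfun (fun t => u + t * (v - u)).
Proof.
apply: polyfunD; first exact: polyfun_const.
by apply: polyfunM; [exact: polyfun_id|exact: polyfun_const].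
Qed.

Lemma polyfun_sum (I : Type) (r : seq I) (P : pred I) (F : I -> K -> K) :
  (forall i, P i -> polyfun (F i)) -> polyfun (fun t => \sum_(i <- r | P i) F i t).
Proof.
move=> h; elim: r => [|i r IH].
  by apply: polyfun_ext (polyfun_const 0) _ => t; rewrite big_nil.
case Pi : (P i).
  by apply: polyfun_ext (polyfunD (h i Pi) IH) _ => t; rewrite big_cons Pi.
by apply: polyfun_ext IH _ => t; rewrite big_cons Pi.
Qed.

Lemma polyfun_prod (I : Type) (r : seq I) (P : pred I) (F : I -> K -> K) :
  (forall i, P i -> polyfun (F i)) -> polyfun (fun t => \prod_(i <- r | P i) F i t).
Proof.
move=> h; elim: r => [|i r IH].
  by apply: polyfun_ext (polyfun_const 1) _ => t; rewrite big_nil.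
case Pi : (P i).
  by apply: polyfun_ext (polyfunM (h i Pi) IH) _ => t; rewrite big_cons Pi.
by apply: polyfun_ext IH _ => t; rewrite big_cons Pi.
Qed.

Lemma polyfun_det m (A : K -> 'M[K]_m) : (forall i j, polyfun (fun t => A t i j)) ->
  polyfun (fun t => \det (A t)).
Proof.
move=> h; apply: polyfun_sum => s _; apply: polyfunM; first exact: polyfun_const.
by apply: polyfun_prod.
Qed.

(** An algebraically closed field is infinite, so a product of two nonzero polynomials has a
    nonroot. *)
Lemma polyfun_nonroots f g : polyfun f -> polyfun g -> (exists t, f t != 0) ->
  (exists t, g t != 0) -> exists t, f t * g t != 0.
Proof.
move=> [p hp] [q hq] [t ft] [u gu].
have pq : p * q != 0.
  rewrite mulf_neq0 //.
    by apply: contraNneq ft => p0; rewrite hp p0 horner0.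
  by apply: contraNneq gu => q0; rewrite hq q0 horner0.
have [x nx] := closed_nonrootP _ pq.
by exists x; rewrite hp hq -hornerM.
Qed.

Lemma polyfun_density f g : polyfun f -> polyfun g -> (exists t, g t != 0) ->
  (forall t, g t != 0 -> f t = 0) -> forall t, f t = 0.
Proof.
move=> pf pg gn fg t; apply: NNPP => ft.
have [u] := polyfun_nonroots pf pg (ex_intro _ t (introN eqP ft)) gn.
rewrite mulf_eq0; case: eqP => // fu; rewrite /= => gu.
by case: fu; apply: fg.
Qed.

Variable n : nat.

Lemma polyfun_minor (A : K -> 'M[K]_n) I J : (forall i j, polyfun (fun t => A t i j)) ->
  polyfun (fun t => minor (A t) I J).
Proof.
move=> h; apply: polyfun_det => i j.
by apply: polyfun_ext (h _ _) _ => t; rewrite mxE.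
Qed.

Lemma polyfun_act (A : K -> 'M[K]_n) (x : K -> ambient K n) :
  (forall i j, polyfun (fun t => A t i j)) -> (forall c, polyfun (fun t => x t c)) ->
  forall c, polyfun (fun t => act (A t) (x t) c).
Proof.
move=> hA hx c; apply: (@polyfun_ext (fun t => \sum_(c' | degree_of c' == degree_of c)
     minor (A t) (rows_of c) (rows_of c') * x t c'
       * minor (A t) (cols_of c) (cols_of c'))); last by move=> t; rewrite ffunE.
apply: polyfun_sum => c' _; apply: polyfunM; last exact: polyfun_minor.
by apply: polyfunM => //; apply: polyfun_minor.
Qed.

Lemma polyfun_mhfun d (f : ambient K n -> K) (x : K -> ambient K n) : mhfun d f ->
  (forall c, polyfun (fun t => x t c)) -> polyfun (fun t => f (x t)).
Proof.
move=> [F _ e] hx; apply: (@polyfun_ext (fun t => \sum_(m <- msupp F) F@_m *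
   \prod_v x t (enum_val v) ^+ m v)); last by move=> t; rewrite e /zeval mevalE.
apply: polyfun_sum => m _; apply: polyfunM; first exact: polyfun_const.
by apply: polyfun_prod => v _; apply: polyfunX.
Qed.

(** Specialization: the equations of Z are polynomial in t and hold off the finitely many roots of
    q. Limit points are put in closed sets this way. *)
Lemma zclosed_curve Z (x : K -> ambient K n) (q : K -> K) t0 : zclosed Z ->
  (forall c, polyfun (fun t => x t c)) -> polyfun q -> (exists t, q t != 0) ->
  (forall t, q t != 0 -> Z (x t)) -> is_point (x t0) -> Z (x t0).
Proof.
move=> /zclosed_fam[Fs h e] hx hq q0 hZ p0; apply/e; split=> // f Ff.
have [d hf] := h _ Ff.
apply: (polyfun_density (polyfun_mhfun hf hx) hq q0) => t /hZ /e[_]; exact.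
Qed.

End Curves.

(** * Finiteness of the Krull dimension *)

Section AlgebraicDependence.
Variables (K : fieldType) (N : nat).
Implicit Types (f : {mpoly K[N]}) (fs : seq {mpoly K[N]}) (q : seq nat -> K).

(* The coefficients q are indexed by the sequences of exponents, all < m. *)
Fixpoint poly_in (m : nat) fs q : {mpoly K[N]} :=
  match fs with
  | [::] => (q [::])%:MP
  | f :: fs' => \sum_(0 <= e < m) f ^+ e * poly_in m fs' (fun l => q (e :: l))
  end.

Fixpoint exponents (m d : nat) : seq (seq nat) :=
  match d with
  | 0 => [:: [::]]
  | d'.+1 => [seq e :: l | e <- iota 0 m, l <- exponents m d']
  end.

Fixpoint power_product fs (l : seq nat) : {mpoly K[N]} :=
  match fs, l with
  | f :: fs', e :: l' => f ^+ e * power_product fs' l'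
  | _, _ => 1
  end.

Lemma leq_pow2 a b e : (a <= b)%N -> (a ^ e <= b ^ e)%N.
Proof. by case: e => // e ab; rewrite leq_exp2r. Qed.

Lemma size_exponents m d : size (exponents m d) = (m ^ d)%N.
Proof.
by elim: d => //= d IH; rewrite size_allpairs size_iota IH expnS.
Qed.

Lemma exponents_uniq m d : uniq (exponents m d).
Proof.
elim: d => //= d IH; apply: allpairs_uniq => //; first exact: iota_uniq.
by move=> [e l] [e' l'] _ _ /= [-> ->].
Qed.

Lemma exponentsP m d l : (l \in exponents m d) = (size l == d) && all (gtn m) l.
Proof.
elim: d l => [|d IH] [|e l] //=.
  by apply/negbTE/negP => /allpairsP[[? ?] /= []].
apply/allpairsP/idP => [[[e' l'] /= [+ + [-> ->]]]|].
  by rewrite mem_iota IH eqSS => /= -> /andP[-> ->].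
rewrite eqSS => /and3P[sl em al]; exists (e, l); split => //=.
  by rewrite mem_iota.
by rewrite IH sl al.
Qed.

Lemma poly_inE m fs q :
  poly_in m fs q = \sum_(l <- exponents m (size fs)) q l *: power_product fs l.
Proof.
elim: fs q => [|f fs IH] q /=; first by rewrite big_seq1 -mul_mpolyC mulr1.
rewrite big_allpairs_dep /= /index_iota subn0; apply: eq_bigr => e _.
by rewrite IH big_distrr /=; apply: eq_bigr => l _; rewrite scalerAr.
Qed.

Lemma poly_in_eq0 m fs q :
  (forall l, size l = size fs -> all (gtn m) l -> q l = 0) -> poly_in m fs q = 0.
Proof.
move=> h; rewrite poly_inE big_seq big1 // => l.
by rewrite exponentsP => /andP[/eqP sl al]; rewrite h ?scale0r.
Qed.

Lemma msizeM_leS a b (p r : {mpoly K[N]}) : (msize p <= a.+1)%N ->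
  (msize r <= b.+1)%N -> (msize (p * r) <= (a + b).+1)%N.
Proof.
move=> hp hr; rewrite [leqLHS]msizeE; apply/bigmax_leqP_seq => m.
move=> /msuppM_le /allpairsP[[m1 m2] /= [/msize_mdeg_lt l1 /msize_mdeg_lt l2 ->]] _.
rewrite mdegD; lia.
Qed.

Lemma msize_expr_le D f e : (msize f <= D.+1)%N -> (msize (f ^+ e) <= (e * D).+1)%N.
Proof.
move=> hf; elim: e => [|e IH]; first by rewrite expr0 msize1.
by rewrite exprS mulSn; apply: msizeM_leS.
Qed.

Lemma msize_power_product D m fs l : all (fun f => msize f <= D.+1)%N fs ->
  all (gtn m) l -> (msize (power_product fs l) <= (size fs * (m * D)).+1)%N.
Proof.
elim: fs l => [|f fs IH] [|e l] //=; try by rewrite msize1.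
move=> /andP[hf hfs] /andP[em al].
have := msizeM_leS (msize_expr_le e hf) (IH l hfs al).
have : (e * D <= m * D)%N by rewrite leq_mul2r ltnW ?orbT.
rewrite mulSn; lia.
Qed.

Lemma card_bmultinom_le b : (#|{: 'X_{1..N < b}}| <= b ^ N)%N.
Proof.
case: b => [|b].
  case: (pickP {: 'X_{1..N < 0}}) => [m _|/eq_card0 -> //].
  by have := bmdeg m; rewrite ltn0.
have -> : (b.+1 ^ N = #|{ffun 'I_N -> 'I_b.+1}|)%N by rewrite card_ffun !card_ord.
apply: (@leq_card _ _ (fun m : 'X_{1..N < b.+1} => [ffun i => inord (m i)])).
move=> m1 m2 /ffunP e.
apply: val_inj; apply/mnmP => i; have := e i; rewrite !ffunE => /(congr1 val) /=.
have lt (m : 'X_{1..N < b.+1}) : (m i < b.+1)%N.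
  apply: leq_ltn_trans (bmdeg m); rewrite mdegE (bigD1 i) //= leq_addr //.
by rewrite !inordK.
Qed.

(** With exponents below m there are m^(N+1) power products, while their degrees grow linearly in m,
    so they lie in a space of dimension O(m^N). A kernel vector of the coefficient matrix is the
    relation. *)
Lemma algebraically_dependent fs : size fs = N.+1 -> exists m q,
  poly_in m fs q = 0 /\ exists l, [/\ size l = size fs, all (gtn m) l & q l != 0].
Proof.
move=> sfs; pose D := (\max_(f <- fs) msize f)%N.
have hD : all (fun f => msize f <= D.+1)%N fs.
  by apply/allP => f ff; apply: leqW; apply: leq_bigmax_seq.
(* The bound b on the degrees is at most m ((N+1) D + 1), and at most b^N monomials have degree
   below b; so b^N < m^(N+1) as soon as m > ((N+1) D + 1)^N. *)
pose m := (((N.+1 * D).+1) ^ N).+1; pose b := (N.+1 * (m * D)).+1.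
pose L := exponents m N.+1.
pose A : 'M[K]_(size L, #|{: 'X_{1..N < b}}|) :=
  \matrix_(i, j) (power_product fs (nth [::] L i))@_(enum_val j : 'X_{1..N < b}).
have lt : (#|{: 'X_{1..N < b}}| < size L)%N.
  apply: leq_ltn_trans (card_bmultinom_le _) _.
  rewrite size_exponents expnS; apply: (@leq_ltn_trans ((m * (N.+1 * D).+1) ^ N)).
    apply: leq_pow2; rewrite /b; have : (0 < m)%N by [].
    by move=> m0; rewrite mulnS mulnCA -add1n leq_add2r.
  by rewrite expnMn mulnC ltn_pmul2r ?expn_gt0.
have : kermx A != 0.
  rewrite -mxrank_eq0 mxrank_ker -lt0n subn_gt0.
  exact: leq_ltn_trans (rank_leq_col _) lt.
move=> /rowV0Pn[u /sub_kermxP uA u0].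
have [i ui] : exists i, u 0 i != 0 by apply/rV0Pn.
exists m, (fun l => if insub (index l L) is Some i then u 0 i else 0).
split; last first.
  have := mem_nth [::] (ltn_ord i); rewrite exponentsP => /andP[/eqP sl al].
  exists (nth [::] L i); split; rewrite ?sl //.
  by rewrite index_uniq ?exponents_uniq // valK.
rewrite poly_inE sfs -/L; apply/mpolyP => k; rewrite mcoeff0 raddf_sum /=.
have [kb|kb] := ltnP (mdeg k) b; last first.
  rewrite big_seq big1 // => l; rewrite exponentsP => /andP[/eqP sl al].
  rewrite mcoeffZ [X in _ * X]memN_msupp_eq0 ?mulr0 //.
  apply: msize_mdeg_ge; apply: leq_trans kb.
  by rewrite /b -sfs; apply: msize_power_product.
have := congr1 (fun M : 'rV_ _ => M 0 (enum_rank (BMultinom kb))) uA.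
rewrite mxE [RHS]mxE => uA0; rewrite -[RHS]uA0 (big_nth [::]) big_mkord.
apply: eq_bigr => j _.
by rewrite mcoeffZ mxE enum_rankK index_uniq ?exponents_uniq // valK.
Qed.

End AlgebraicDependence.

(** * Chains of irreducible closed sets *)

Section Dimension.
Variables (K : fieldType) (n : nat).
Implicit Types (x y : ambient K n) (S T : ambient K n -> Prop).
Local Notation N := #|coord n|.

Section Chart.
Variable (x0 : ambient K n).

(** An affine chart around [x0]: in each factor a coordinate that is nonzero at [x0] is normalized
    to 1. Degrees without a pivot get the gauge 1, so that they impose no condition. *)
Definition pivot (i : nat) : option (coord n) :=
  [pick c : coord n | (degree_of c == i) && (x0 c != 0)].
Definition gauge (i : nat) x : K := if pivot i is Some c then x c else 1.
Definition in_chart x : Prop := forall i, gauge i x = 1.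

Lemma pivotP i c : pivot i = Some c -> degree_of c = i /\ x0 c != 0.
Proof. by rewrite /pivot; case: pickP => // c' /andP[/eqP <- h] [<-]. Qed.

Lemma gauge0 i : gauge i x0 != 0.
Proof.
rewrite /gauge; case e : pivot => [c|]; last exact: oner_neq0.
by have [] := pivotP e.
Qed.

Lemma gauge_normalize x : \prod_(i < n) gauge i x != 0 ->
  exists2 y, same_point x y & in_chart y.
Proof.
rewrite prodf_seq_neq0 => /allP g0.
have h i : gauge i x != 0.
  have [lt|ge] := ltnP i n; first exact: (g0 (Ordinal lt) (mem_index_enum _)).
  rewrite /gauge; case e : pivot => [c|]; last exact: oner_neq0.
  have [dc _] := pivotP e; have [_ /andP[_]] := coordP c.
  by rewrite -/(degree_of c) dc ltnNge ge.
pose s i := (gauge i x)^-1.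
exists [ffun c => s (degree_of c) * x c].
  by exists s => [i|c]; rewrite ?ffunE // invr_eq0.
move=> i; rewrite {1}/gauge; case e : (pivot i) => [c|] //.
have [dc _] := pivotP e; rewrite ffunE dc /s.
by have := h i; rewrite /gauge e => ?; rewrite mulVf.
Qed.

Lemma mhfun_gauge i : mhfun (fun j => (pivot i != None) && (i == j)) (gauge i).
Proof.
rewrite /gauge; case e : pivot => [c|] /=; last exact: mhfun_const.
by have [<- _] := pivotP e; apply: mhfun_coord.
Qed.

Hypothesis x0_point : is_point x0.

Lemma pivot_ex i : (0 < i < n)%N -> pivot i != None.
Proof.
move=> /x0_point[c dc xc]; rewrite /pivot; case: pickP => // /(_ c).
by rewrite dc eqxx xc.
Qed.

Definition mdeg_in (i : nat) (m : 'X_{1..N}) : nat :=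
  \sum_(v | degree_of (enum_val v) == i) m v.

(** Each monomial is completed by powers of the pivots to degree [msize p] in every factor;
    [msize p] exceeds the degree of each monomial of p, so the subtraction is never truncated. *)
Definition homogenize (p : {mpoly K[N]}) x : K :=
  \sum_(m <- msupp p) p@_m *
    ((\prod_v x (enum_val v) ^+ m v) *
     \prod_(i < n) gauge i x ^+ (msize p - mdeg_in i m)).

Lemma homogenize_chart p x : in_chart x -> homogenize p x = zeval p x.
Proof.
move=> hx; rewrite /zeval mevalE; apply: eq_bigr => m _; congr (_ * _).
by rewrite [X in _ * X]big1 ?mulr1 // => i _; rewrite hx expr1n.
Qed.

Lemma mhfun_homogenize p :
  mhfun (fun i => if (0 < i < n)%N then msize p else 0%N) (homogenize p).
Proof.
apply: mhfun_sum => m mp _; apply: mhfunZ.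
have h1 := mhfun_prod (index_enum _) (P := predT)
  (fun v _ => mhfunX (m v) (mhfun_coord K (enum_val v))).
have h2 := mhfun_prod (index_enum 'I_n) (P := predT)
  (fun i _ => mhfunX (msize p - mdeg_in i m) (mhfun_gauge i)).
apply: mhfun_ext (mhfunM h1 h2) _ _ => // i.
have -> : (\sum_v m v * (degree_of (enum_val v) == i) = mdeg_in i m)%N.
  rewrite /mdeg_in [RHS]big_mkcond /=; apply: eq_bigr => v _.
  by case: ifP; rewrite ?muln1 ?muln0.
case: ifP => hi; last first.
  rewrite /mdeg_in big_pred0 => [|v]; last first.
    by apply: contraFF hi => /eqP <-; have [] := coordP (enum_val v : coord n).
  rewrite big1 // => j _; case e : (pivot j) => [c|] /=; rewrite ?muln0 //.
  have [dc _] := pivotP e; case: eqP => [ji|]; rewrite ?muln0 //.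
  by move: hi; rewrite -ji -dc; have [_ ->] := coordP c.
have /andP[i0 i_n] := hi.
rewrite (bigD1 (Ordinal i_n)) //= pivot_ex // eqxx muln1 big1 ?addn0 => [|j nj].
  rewrite subnKC //; apply: leq_trans (ltnW (msize_mdeg_lt mp)).
  by rewrite mdegE [leqRHS](bigID (fun v => degree_of (enum_val v) == i)) leq_addr.
by rewrite (_ : (_ == i) = false) ?andbF ?muln0 //; apply/negbTE.
Qed.

Definition vanishes T (p : {mpoly K[N]}) : Prop :=
  forall x, T x -> in_chart x -> zeval p x = 0.

(** Irreducibility of T is a statement on closed sets of the whole product; it is carried to the
    chart by homogenizing p and r. *)
Lemma vanishes_prime T p r : zclosed T -> irreducible T ->
  vanishes T (p * r) -> vanishes T p \/ vanishes T r.
Proof.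
move=> cT [_ iT] pr.
(* G vanishes at the points that have no representative in the chart; as a factor it puts them all
   in the second closed set. *)
pose G x := \prod_(i < n) gauge i x.
have hG := mhfun_prod (index_enum 'I_n) (P := predT) (fun i _ => mhfun_gauge i).
have hr := mhfunM (mhfun_homogenize r) hG.
have cl1 : zclosed (fun x => is_point x /\ forall f, f = homogenize p -> f x = 0).
  by apply: zclosed_fun => f ->; eexists; exact: mhfun_homogenize.
have cl2 : zclosed (fun x => is_point x /\
     forall f, f = (fun x => homogenize r x * G x) -> f x = 0).
  by apply: zclosed_fun => f ->; eexists; exact: hr.
have [|sub|sub] := iT _ _ cl1 cl2.
- move=> x Tx; have px := zclosed_point cT Tx.
  have [g0|] := boolP (G x == 0).
    by right; split=> // f ->; rewrite (eqP g0) mulr0.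
  move=> /gauge_normalize[y xy hy].
  have Ty := zclosed_same cT xy Tx.
  have := pr y Ty hy; rewrite /zeval mevalM => /eqP; rewrite mulf_eq0.
  rewrite -!/(zeval _ _) -!homogenize_chart // => /orP[] /eqP h0;
    [left|right]; split=> // f ->.
    have [u u0] := mhfun_same_point (mhfun_homogenize p) xy.
    by rewrite h0 => /esym/eqP; rewrite mulf_eq0 (negbTE u0) => /eqP.
  have [u u0] := mhfun_same_point (mhfun_homogenize r) xy.
  by rewrite h0 => /esym/eqP; rewrite mulf_eq0 (negbTE u0) => /eqP ->; rewrite mul0r.
- by left => x Tx hx; rewrite -homogenize_chart //; have [_ ->] := sub x Tx.
- right => x Tx hx; have [_ /(_ _ erefl)] := sub x Tx.
  rewrite [G x]big1 ?mulr1 => [|i _]; last exact: hx.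
  by rewrite homogenize_chart.
Qed.

(** A function vanishing on T and not on T' might still vanish on T' within the chart. Then T' would
    be covered by its zeros and those of the product G of the gauges; both are excluded by
    irreducibility, the second because G is nonzero at [x0]. *)
Lemma separating_poly T T' : zclosed T -> zclosed T' -> irreducible T' -> T' x0 ->
  ~ subset T' T -> exists p, vanishes T p /\ ~ vanishes T' p.
Proof.
move=> cT cT' iT' T'0 nsub.
have [x [T'x nTx]] : exists x, T' x /\ ~ T x.
  by apply: NNPP => h; apply: nsub => x T'x; apply: NNPP => nTx; apply: h; exists x.
have [Fs h e] := zclosed_fam cT.
have [f [Ff fx]] : exists f, Fs f /\ f x <> 0.
  apply: NNPP => h'; apply: nTx; apply/e; split; first exact: zclosed_point cT' T'x.
  by move=> f Ff; apply: NNPP => fx; apply: h'; exists f.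
have [d hf] := h f Ff; have [p hp ep] := hf.
exists p; split=> [y Ty _|van]; first by rewrite -ep; have /e[_ ->] := Ty.
pose G x := \prod_(i < n) gauge i x.
have hG := mhfun_prod (index_enum 'I_n) (P := predT) (fun i _ => mhfun_gauge i).
have cl1 : zclosed (fun x => is_point x /\ forall f', f' = f -> f' x = 0).
  by apply: zclosed_fun => f' ->; exists d.
have cl2 : zclosed (fun x => is_point x /\ forall f', f' = G -> f' x = 0).
  by apply: zclosed_fun => f' ->; eexists; exact: hG.
have [|sub|sub] := iT'.2 _ _ cl1 cl2.
- move=> y T'y; have py := zclosed_point cT' T'y.
  have [g0|] := boolP (G y == 0); first by right; split=> // f' ->; apply/eqP.
  move=> /gauge_normalize[z yz hz].
  left; split=> // f' ->.
  have [u u0] := mhfun_same_point hf yz.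
  rewrite ep van //; last exact: zclosed_same cT' yz T'y.
  by move=> /esym/eqP; rewrite mulf_eq0 (negbTE u0) => /eqP.
- by have [_ /(_ _ erefl)] := sub x T'x.
- have [_ /(_ _ erefl) /eqP] := sub x0 T'0.
  by rewrite prodf_seq_eq0 => /hasP[i _ /=]; rewrite (negbTE (gauge0 i)).
Qed.

Section Chain.
Variables (T : nat -> ambient K n -> Prop) (d : nat).
Hypotheses (T_closed : forall i, (i <= d)%N -> zclosed (T i))
  (T_irr : forall i, (i <= d)%N -> irreducible (T i))
  (T_mono : forall i, (i < d)%N -> subset (T i) (T i.+1))
  (T0 : T 0 x0).

(** The polynomials are listed from the largest set of the chain downwards. *)
Fixpoint separates (k : nat) (fs : seq {mpoly K[N]}) : Prop :=
  match fs with
  | [::] => k = 0%N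
  | f :: fs' => exists k', [/\ k = k'.+1, vanishes (T k') f, ~ vanishes (T k) f
                 & separates k' fs']
  end.

Lemma vanishes_exp k p r e : (k <= d)%N -> ~ vanishes (T k) p ->
  vanishes (T k) (p ^+ e * r) -> vanishes (T k) r.
Proof.
move=> kd np; elim: e => [|e IH]; first by rewrite expr0 mul1r.
rewrite exprS -mulrA => /vanishes_prime [||//|]; [exact: T_closed|exact: T_irr|exact: IH].
Qed.

(* Among the exponents of the first polynomial in fs, consider the least one
   that occurs: dividing by the corresponding power and restricting to the next
   smaller set leaves a relation between the remaining polynomials. *)
Lemma separates_independent m fs k q : (k <= d)%N -> separates k fs ->
  vanishes (T k) (poly_in m fs q) ->
  forall l, size l = size fs -> all (gtn m) l -> q l = 0.
Proof.
elim: fs k q => [|f fs IH] k q kd /=.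
  move=> -> van [|//] _ _.
  have [|y xy hy] := @gauge_normalize x0.
    by rewrite prodf_seq_neq0; apply/allP => i _; exact: gauge0.
  have := van y (zclosed_same (T_closed (leq0n d)) xy T0) hy.
  by rewrite /zeval mevalC.
move=> [k' [ek vf nf sep]] van [//|e l] /= [sl] /andP[em al].
elim/ltn_ind: e l sl al em => e IHe l sl al em.
have k'd : (k' < d)%N by rewrite -ek.
pose F e' : {mpoly K[N]} := poly_in m fs (fun l => q (e' :: l)).
have F0 e' : (e' < e)%N -> F e' = 0.
  move=> lt; apply: poly_in_eq0 => l' sl' al'.
  by apply: IHe => //; apply: ltn_trans lt em.
have := van; rewrite (big_cat_nat (n := e)) ?leq0n 1?ltnW //=.
rewrite [X in X + _]big_nat big1 ?add0r => [|e' /andP[_ lt]]; last first.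
  by rewrite -/(F e') F0 ?mulr0.
have -> : \sum_(e <= e' < m) f ^+ e' * poly_in m fs (fun l => q (e' :: l)) =
    f ^+ e * (F e + f * \sum_(e.+1 <= e' < m) f ^+ (e' - e.+1) * F e').
  rewrite big_ltn // mulrDr; congr (_ + _); rewrite mulrA -exprSr big_distrr /=.
  rewrite [LHS]big_nat [RHS]big_nat; apply: eq_bigr => e' /andP[lt _].
  by rewrite mulrA -exprD subnKC.
move=> /(vanishes_exp kd nf) vh.
apply: (IH k' (fun l => q (e :: l))) => //; first exact: ltnW.
move=> x Tx cx; have := vh x; rewrite ek => /(_ (T_mono k'd Tx) cx).
rewrite /zeval mevalD mevalM => <-.
by rewrite -[X in _ + X * _]/(zeval f x) vf // mul0r addr0.
Qed.

End Chain.

End Chart.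

(** A longer chain would yield N + 1 polynomials in N variables that are independent by
    [separates_independent]. Only the finiteness of the bound is used. *)
Lemma irreducible_chain_bound S d : irreducible_chain S d -> (d <= N)%N.
Proof.
move=> [T [hT hlt]]; rewrite leqNgt; apply/negP => dN.
have [x0 T0x0] : exists x, T 0 x by have [_ [] ] := hT 0 (leq0n d).
have x0p : is_point x0 by have [c _ _] := hT 0 (leq0n d); exact: zclosed_point c T0x0.
have Tmono i : (i < d)%N -> subset (T i) (T i.+1) by move=> /hlt[].
have Tx0 i : (i <= d)%N -> T i x0.
  by elim: i => // i IH lt; apply: (Tmono i lt); apply: IH; exact: ltnW.
have [fs [sfs sep]] : exists fs, size fs = N.+1 /\ separates x0 T N.+1 fs.
  elim: N.+1 dN => [|k IH] kd; first by exists [::].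
  have [fs [sfs sep]] := IH (ltnW kd).
  have [c1 _ _] := hT k (ltnW kd); have [c2 i2 _] := hT _ kd.
  have [_ ns] := hlt k kd.
  have [p [vp np]] := separating_poly c1 c2 i2 (Tx0 _ kd) ns.
  by exists (p :: fs); split; [rewrite /= sfs|exists k].
have [m [q [q0 [l [sl al ql]]]]] := algebraically_dependent sfs.
case/eqP: ql.
apply: (separates_independent x0p (T := T) (d := d) (q := q) (m := m) _ _ _ _ dN sep) => //.
- by move=> i /hT[].
- by move=> i /hT[].
- by rewrite q0 => x _ _; rewrite /zeval meval0.
Qed.

(** A chain is lengthened as long as possible, which is decided classically; the induction is on the
    distance of its length to N. *)
Lemma has_dim_ex S : subset S (@is_point K n) -> irreducible (zclosure S) ->
  exists d, has_dim S d.
Proof.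
move=> Sp irr.
have ch0 : irreducible_chain (zclosure S) 0.
  exists (fun=> zclosure S); split=> // i _; split=> //; exact: zclosure_closed.
have : exists d, irreducible_chain (zclosure S) d by exists 0%N.
suff : forall k d, (N - d <= k)%N -> irreducible_chain (zclosure S) d ->
    exists d, has_dim S d by move=> h [d hd]; apply: h (leqnn _) hd.
elim=> [|k IH] d dk hd; have dN := irreducible_chain_bound hd.
  exists d; split=> // d' hd'; have := irreducible_chain_bound hd'; lia.
have [[d' [hd' lt]]|no] :=
  classic (exists d', irreducible_chain (zclosure S) d' /\ (d < d')%N).
  by apply: (IH d') => //; lia.
exists d; split=> // d' hd'; rewrite leqNgt; apply/negP => lt; apply: no; by exists d'.
Qed.

(** A longest chain for S is extended by the closure of S' as a new top, and x makes the last
    inclusion strict. *)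
Lemma has_dim_lt S S' d d' x : subset S' (@is_point K n) -> irreducible (zclosure S') ->
  subset S (zclosure S') -> zclosure S' x -> ~ zclosure S x ->
  has_dim S d -> has_dim S' d' -> (d < d')%N.
Proof.
move=> Sp' irr' sub S'x nSx [[T [hT hlt]] _] [_ max]; apply: max.
have cS' := zclosure_closed Sp'.
have sub' : subset (zclosure S) (zclosure S') by apply: zclosure_min.
exists (fun i => if (i <= d)%N then T i else zclosure S'); split=> i id.
  case: leqP => [le|_]; last by split.
  by have [? ? TS] := hT i le; split=> // y /TS /sub'.
rewrite -ltnS id; have [lt|ge] := ltnP i d; first exact: hlt.
have [_ _ TS] := hT i id; split=> [y /TS /sub' //|TS']; apply: nSx.
by apply: TS; apply: TS'.
Qed.

Lemma has_dim_same S S' d : same_set S S' -> has_dim S d -> has_dim S' d.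
Proof.
move=> e [[T [hT hlt]] max].
have eT x : zclosure S x <-> zclosure S' x.
  by split=> h Z cZ SZ; apply: (h Z cZ) => y /e /SZ.
split; first by exists T; split=> // i /hT[? ? s]; split=> // y /s /eT.
move=> d' [T' [hT' hlt']]; apply: max; exists T'; split=> // i /hT'[? ? s].
by split=> // y /s /eT.
Qed.

End Dimension.

(** * Block diagonal degenerations *)

Section Strings.
Variables (n r : nat) (str : 'I_n -> nat).
Hypothesis str_lt : forall a, (str a < r)%N.
Implicit Types (I J L : {set 'I_n}).

Definition upper (l : nat) : {set 'I_n} := [set a | (l < str a)%N].

(** The deficiency of I at the bar l: how many letters after l are missing, compared with the most a
    set of this size can have. It is the exponent of z l in the minors on I, once the common factor
    of the degree is divided out. *)
Definition expo (l : nat) I : nat := (minn #|upper l| #|I| - #|I :&: upper l|)%N.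

Lemma cardI_upper_le l I : (#|I :&: upper l| <= minn #|upper l| #|I|)%N.
Proof. by rewrite leq_min !subset_leq_card ?subsetIl ?subsetIr. Qed.

Lemma expo_eq0 l I : (expo l I == 0%N) = (I \subset upper l) || (upper l \subset I).
Proof.
rewrite /expo subn_eq0 geq_min orbC; congr orb.
  by rewrite (sameP setIidPl eqP) eqEcard subsetIl.
by rewrite (sameP setIidPr eqP) eqEcard subsetIr.
Qed.

Definition top_set I : bool := [forall l : 'I_r, expo l I == 0%N].

Lemma top_setP I : reflect (forall l, (I \subset upper l) \/ (upper l \subset I)) (top_set I).
Proof.
apply: (iffP forallP) => h l; last by rewrite expo_eq0; apply/orP.
have [lr|rl] := ltnP l r; first by have := h (Ordinal lr); rewrite expo_eq0 => /orP.
right; apply/subsetP => a; rewrite inE => la.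
by have := ltn_trans (leq_ltn_trans rl la) (str_lt a); rewrite ltnn.
Qed.

Lemma upper_mono l l' : (l <= l')%N -> upper l' \subset upper l.
Proof. by move=> ll; apply/subsetP => a; rewrite !inE; exact: leq_ltn_trans. Qed.

Lemma card_upper_between a b : (str a < str b)%N -> (0 < #|upper (str a)| < n)%N.
Proof.
move=> ab; apply/andP; split; first by apply/card_gt0P; exists b; rewrite inE.
rewrite -[ltnRHS]card_ord -cardsT; apply: proper_card; rewrite properT.
by apply/eqP => /setP/(_ a); rewrite !inE ltnn.
Qed.

Lemma top_set_upper l : top_set (upper l).
Proof.
apply/top_setP => k; have [kl|lk] := leqP k l; [left|right]; apply: upper_mono => //.
exact: ltnW.
Qed.

(** Greedy choice: always add a remaining letter of the latest possible string. *)
Lemma top_set_ex i : (i <= n)%N -> exists2 I : {set 'I_n}, #|I| = i & top_set I.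
Proof.
elim: i => [|i IH] lt.
  by exists set0; [rewrite cards0|apply/top_setP => l; left; rewrite sub0set].
have [I cI /top_setP tI] := IH (ltnW lt).
have [a0 _ a0I] : exists2 a, a \in [set: 'I_n] & a \notin I.
  apply/subsetPn; apply: contraL lt => /subset_leq_card.
  by rewrite cardsT card_ord cI -leqNgt.
rewrite -in_setC in a0I.
case: (@arg_maxnP _ a0 (mem (~: I)) str a0I) => a aI amax.
have aI' : a \notin I by rewrite -in_setC.
exists (a |: I); first by rewrite cardsU1 aI' cI.
apply/top_setP => l; have [sub|nsub] := boolP (upper l \subset I).
  by right; apply: subset_trans sub (subsetU1 _ _).
have [sub|] := tI l; last by rewrite (negbTE nsub).
left; rewrite subUset sub andbT sub1set inE.
have /subsetPn[b bu bI] := nsub.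
rewrite inE in bu; apply: leq_trans bu _; by apply: amax; rewrite /= in_setC.
Qed.

Section Factor.
Variable K : fieldType.
Implicit Types (z W : nat -> K) (g E : 'M[K]_n) (x : ambient K n).

Definition zfac z I : K := \prod_(l < r) z l ^+ expo l I.

Lemma zfac_top z I : top_set I -> zfac z I = 1.
Proof. by move=> /forallP h; apply: big1 => l _; rewrite (eqP (h l)) expr0. Qed.

Lemma zfacM z z' I : zfac (fun l => z l * z' l) I = zfac z I * zfac z' I.
Proof. by rewrite -big_split /=; apply: eq_bigr => l _; rewrite exprMn. Qed.

(** There is no bar after the last string: [upper l] is empty when l + 1 >= r, so its exponent is
    0. *)
Lemma eq_zfac z z' I : (forall l, (l.+1 < r)%N -> z l = z' l) -> zfac z I = zfac z' I.
Proof.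
move=> e; apply: eq_bigr => l _; have [lr|rl] := ltnP l.+1 r; first by rewrite e.
suff /eqP -> : expo l I == 0%N by rewrite !expr0.
rewrite expo_eq0; apply/orP; right; apply/subsetP => a; rewrite inE => la.
by have := leq_ltn_trans (leq_trans rl la) (str_lt a); rewrite ltnn.
Qed.

Lemma zfac_card z I J : #|I| = #|J| -> (forall l, #|I :&: upper l| = #|J :&: upper l|) ->
  zfac z I = zfac z J.
Proof. by move=> e eu; apply: eq_bigr => l _; rewrite /expo e eu. Qed.

(** The product of i scales taken from the last strings first, that is, of W over a top set of size
    i. *)
Definition wscale W (i : nat) : K :=
  W 0%N ^+ i * \prod_(l < r) (W l.+1 / W l) ^+ minn #|upper l| i.

Lemma wscale_neq0 W i : (forall l, W l != 0) -> wscale W i != 0.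
Proof.
move=> W0; rewrite mulf_neq0 ?expf_neq0 //.
rewrite prodf_seq_neq0; apply/allP => l _ /=.
by rewrite expf_neq0 // mulf_neq0 // invr_eq0.
Qed.

(* Telescoping: W (str a) is the product of W 0 and of the ratios W l.+1 / W l
   over the l with a \in upper l. *)
Lemma prod_str W I : (forall l, W l != 0) ->
  \prod_(a in I) W (str a) = wscale W #|I| * zfac (fun l => W l / W l.+1) I.
Proof.
move=> W0.
have WE a : W (str a) = W 0%N * \prod_(l < r) (W l.+1 / W l) ^+ (a \in upper l).
  under eq_bigr => l _ do rewrite inE.
  have : (str a <= r)%N by exact: ltnW.
  elim: (str a) => [|k IH] kr; first by rewrite big1 ?mulr1.
  transitivity (W k * (W k.+1 / W k)); first by rewrite mulrC divfK.
  rewrite {1}IH 1?ltnW // -mulrA (bigD1 (Ordinal kr)) //= [in RHS](bigD1 (Ordinal kr)) //=.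
  rewrite ltnn ltnSn expr0 mul1r expr1; congr (_ * _); rewrite mulrC; congr (_ * _).
  apply: eq_bigr => l; rewrite -val_eqE /= => lk.
  by rewrite [(l < k.+1)%N]ltnS [(l <= k)%N]leq_eqVlt (negbTE lk).
under eq_bigr => a _ do rewrite WE.
rewrite big_split /= prodr_const /wscale -mulrA; congr (_ * _).
rewrite exchange_big /= -big_split /=; apply: eq_bigr => l _.
rewrite prodrXr.
have -> : (\sum_(a in I) (a \in upper l) = #|I :&: upper l|)%N.
  by rewrite -sum1_card big_mkcond [RHS]big_mkcond /=; 
     apply: eq_bigr => a _; rewrite in_setI; case: (a \in I) => //; case: (a \in upper l).
rewrite -[W l / W l.+1]invf_div exprVn /expo -exprB ?leq_subr //; last first.
  by rewrite unitfE mulf_neq0 ?invr_eq0.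
by rewrite subKn // cardI_upper_le.
Qed.

Definition str_block g := forall a b, g a b != 0 -> str a = str b.

Lemma block_minor_card g I J : str_block g -> #|I| = #|J| -> minor g I J != 0 ->
  forall l, #|I :&: upper l| = #|J :&: upper l|.
Proof.
move=> gb eIJ /(minor_neq0 eIJ)[f [fi <- fa]] l.
have -> : f @: I :&: upper l = f @: (I :&: upper l).
  apply/setP => b; apply/setIP/imsetP => [[/imsetP[a aI ->]]|[a /setIP[aI aU] ->]].
    by rewrite inE -(gb _ _ (fa a aI)) => lt; exists a; rewrite // !inE aI.
  split; first exact: imset_f.
  by rewrite inE -(gb _ _ (fa a aI)); rewrite inE in aU.
by rewrite card_in_imset // => a b /setIP[aI _] /setIP[bI _]; exact: fi.
Qed.

Lemma block_minor_zfac g z I J : str_block g -> #|I| = #|J| ->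
  minor g I J * zfac z J = zfac z I * minor g I J.
Proof.
move=> gb eIJ; have [->|nz] := eqVneq (minor g I J) 0; first by rewrite mul0r mulr0.
by rewrite mulrC (zfac_card z eIJ (block_minor_card gb eIJ nz)).
Qed.

(* For z without zeros these are the compounds of a block diagonal matrix, with
   the blocks of E rescaled by factors whose successive ratios are the z l; the
   coordinates of each degree are divided by the leading monomial in z. *)
Definition twist z E : ambient K n :=
  [ffun c => zfac z (rows_of c) * minor E (rows_of c) (cols_of c)].

Lemma entry_twist z E I J : entry (twist z E) I J = zfac z I * entry (compounds E) I J.
Proof.
rewrite /entry; case: insubP => [c _ e|]; last by rewrite mulr0.
by rewrite !ffunE /rows_of e.
Qed.

Lemma eq_twist z z' E : (forall l, (l.+1 < r)%N -> z l = z' l) -> twist z E = twist z' E.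
Proof. by move=> e; apply/ffunP => c; rewrite !ffunE (eq_zfac _ e). Qed.

(** A nonzero minor of a block diagonal g relates sets with equally many letters in each [upper l],
    hence with the same [zfac]: g commutes with the rescaling. *)
Lemma act_twist g z E : str_block g -> act g (twist z E) = twist z (g *m E *m g^T).
Proof.
move=> gb; apply/ffunP => c.
have -> : twist z (g *m E *m g^T) c = zfac z (rows_of c) * act g (compounds E) c.
  by rewrite act_compounds !ffunE.
rewrite !actE big_distrr /=; apply: eq_bigr => I /eqP eI; rewrite big_distrr /=.
apply: eq_bigr => J _; rewrite entry_twist !mulrA; congr (_ * _ * _).
exact: block_minor_zfac.
Qed.

(** The torus moves the parameter z: letters a and f a matched in a nonzero minor of E contribute
    [be a * be (f a)], which depends only on the string, so [prod_str] applies. *)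
Lemma act_diag_twist (be : 'I_n -> K) W z E : (forall l, W l != 0) ->
  (forall a b, E a b != 0 -> be a * be b = W (str a)) ->
  same_point (twist (fun l => z l * (W l / W l.+1)) E)
             (act (diag_mx (\row_a be a)) (twist z E)).
Proof.
move=> W0 hE; exists (wscale W) => [i|c]; first exact: wscale_neq0.
have [e _] := coordP c.
rewrite act_diag [twist z E c]ffunE [twist _ _ c]ffunE zfacM.
have [->|nz] := eqVneq (minor E (rows_of c) (cols_of c)) 0.
  by rewrite !mulr0 mul0r.
suff -> : \prod_(a in rows_of c) (\row_a be a) 0 a *
    (zfac z (rows_of c) * minor E (rows_of c) (cols_of c)) *
    \prod_(a in cols_of c) (\row_a be a) 0 a =
    (\prod_(a in rows_of c) W (str a)) *
    (zfac z (rows_of c) * minor E (rows_of c) (cols_of c)).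
  by rewrite prod_str // -/(degree_of c); ring.
rewrite mulrAC; congr (_ * _).
have [f [fi <- fa]] := minor_neq0 e nz.
rewrite big_imset //= -big_split /=; apply: eq_bigr => a aI.
by rewrite !mxE hE // fa.
Qed.

Lemma twist_point z E : E \in unitmx -> is_point (twist z E).
Proof.
move=> Eu i hi; have /andP[_ /ltnW le_i] := hi.
have [I cI tI] := top_set_ex le_i.
have [J eJ nz] := unit_minor_neq0 I Eu.
have [|c [rc cc]] := @coord_ex _ I J eJ; first by rewrite cI.
exists c; first by rewrite /degree_of rc.
by rewrite ffunE rc cc zfac_top // mul1r.
Qed.

Lemma twist_compounds z E : (forall l, (l < r)%N -> z l != 0) -> E^T = E ->
  str_block E -> E \in unitmx -> exists A : 'M[K]_n,
  [/\ A^T = A, A \in unitmx & same_point (compounds A) (twist z E)].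
Proof.
(* Beyond r the parameter is reset to 1, so that the scales W are nonzero at every index. *)
move=> z0 Es Eb Eu; pose z' l := if (l < r)%N then z l else 1.
have z'0 l : z' l != 0 by rewrite /z'; case: ifP => [/z0 //|_]; exact: oner_neq0.
pose W l := \prod_(k < l) (z' k)^-1.
have W0 l : W l != 0.
  by rewrite prodf_seq_neq0; apply/allP => k _ /=; rewrite invr_eq0.
have Wz l : W l / W l.+1 = z' l.
  by rewrite /W big_ord_recr /= invfM invrK mulrA mulfV ?mul1r // -/(W l).
exists (diag_mx (\row_a W (str a)) *m E); split.
- apply/matrixP => a b; rewrite trmx_mul Es tr_diag_mx mul_mx_diag mul_diag_mx !mxE.
  have [->|/Eb <-] := eqVneq (E a b) 0; first by rewrite mulr0 mul0r.
  by rewrite mulrC.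
- rewrite unitmx_mul Eu andbT unitmxE det_diag unitfE prodf_seq_neq0.
  by apply/allP => a _ /=; rewrite mxE.
- apply: same_point_sym; exists (wscale W) => [i|c]; first exact: wscale_neq0.
  have [e _] := coordP c; rewrite !ffunE minor_row_scale //.
  under eq_bigr => a _ do rewrite mxE.
  rewrite prod_str // -mulrA; congr (_ * (_ * _)).
  by apply: eq_zfac => l lr; rewrite Wz /z' ltnW.
Qed.

End Factor.

Section Closed.
Variable K : closedFieldType.
Implicit Types (z : nat -> K) (E : 'M[K]_n).

Lemma polyfun_twist (z : K -> nat -> K) E : (forall l, polyfun (fun t => z t l)) ->
  forall c, polyfun (fun t => twist (z t) E c).
Proof.
move=> hz c; apply: (@polyfun_ext _ (fun t => zfac (z t) (rows_of c) *
   minor E (rows_of c) (cols_of c))); last by move=> t; rewrite ffunE.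
apply: polyfunM; last exact: polyfun_const.
by apply: polyfun_prod => l _; apply: polyfunX.
Qed.

Lemma twist_complete z E : E^T = E -> str_block E -> E \in unitmx ->
  complete_quadrics (twist z E).
Proof.
(* The line from z to the constant 1: almost all its members have no zero coordinate and are
   nonsingular quadrics. *)
move=> Es Eb Eu; pose zt t l := z l + t * (1 - z l).
have -> : twist z E = twist (zt 0) E by apply: eq_twist => l _; rewrite /zt mul0r addr0.
apply: (@zclosed_curve K n _ (fun t => twist (zt t) E) (fun t => \prod_(l < r) zt t l)).
- exact: complete_quadrics_closed.
- by apply: polyfun_twist => l; exact: polyfun_segment.
- by apply: polyfun_prod => l _; exact: polyfun_segment.
- by exists 1; rewrite big1 ?oner_neq0 // => l _; rewrite /zt mul1r addrC subrK.
- move=> t; rewrite prodf_seq_neq0 => /allP nz; apply: zclosure_sub.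
  apply: twist_compounds => // l lr.
  exact: (nz (Ordinal lr) (mem_index_enum _)).
- exact: twist_point.
Qed.

End Closed.

End Strings.

(** * Orbits of the Borel group *)

Section Borel.
Variables (K : closedFieldType) (n : nat).
Implicit Types (b g : 'M[K]_n) (x y : ambient K n).

Definition upper_mx b : Prop := forall i j : 'I_n, (j < i)%N -> b i j = 0.

Lemma upper_mx_det b : upper_mx b -> \det b = \prod_i b i i.
Proof.
by move=> bu; rewrite -minor_setT minor_upper //; apply: eq_bigl => i; rewrite inE.
Qed.

Lemma upper_mx_diag_neq0 b i : upper_mx b -> b \in unitmx -> b i i != 0.
Proof.
move=> bu; rewrite unitmxE unitfE upper_mx_det // prodf_seq_neq0 => /allP h.
exact: (h i (mem_index_enum _)).
Qed.

Lemma upper_mxM b b' : upper_mx b -> upper_mx b' -> upper_mx (b *m b').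
Proof.
move=> bu bu' i j ji; rewrite mxE big1 // => k _.
have [ki|ik] := ltnP k i; first by rewrite bu ?mul0r.
by rewrite bu' ?mulr0 // (leq_trans ji).
Qed.

Lemma upper_mx_inv b : upper_mx b -> b \in unitmx -> upper_mx (invmx b).
Proof.
move=> bu b_unit i j ji.
suff h k : forall i : 'I_n, (n - i <= k)%N -> (j < i)%N -> invmx b i j = 0.
  exact: h (leqnn _) ji.
elim: k => [|k IH] {ji}i ik ji; first by have := ltn_ord i; lia.
have := congr1 (fun M : 'M_n => M i j) (mulmxV b_unit).
rewrite !mxE (bigD1 i) //= big1 ?addr0 => [|l li]; last first.
  have [le|lt] := leqP l i.
    by rewrite bu ?mul0r // ltn_neqAle le andbT.
  by rewrite IH ?mulr0 //; [have := ltn_ord i; lia|exact: ltn_trans lt].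
rewrite -[i == j]val_eqE /= gtn_eqF // => /eqP; rewrite mulf_eq0.
by rewrite (negbTE (upper_mx_diag_neq0 _ bu b_unit)) => /eqP.
Qed.

Lemma in_borel_unit b : in_borel b -> b \in unitmx.
Proof. by move=> [_ d1]; rewrite unitmxE d1 unitr1. Qed.

Lemma root_exists (k : nat) (a : K) : (0 < k)%N -> exists u, u ^+ k = a.
Proof.
move=> k0; have [u hu] := @solve_monicpoly K k (fun i => if i == 0%N then a else 0) k0.
exists u; rewrite hu; case: k k0 {hu} => // k _.
by rewrite big_ord_recl big1 => [|i _]; rewrite /= ?mul0r // expr0 mulr1 addr0.
Qed.

(** Scalars act trivially on points, so an n-th root of the inverse determinant reaches determinant
    1. Orbits can thus be handled with all invertible upper triangular matrices. *)
Lemma in_borel_scale b : (0 < n)%N -> upper_mx b -> b \in unitmx ->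
  exists2 b', in_borel b' & forall x, same_point (act b' x) (act b x).
Proof.
move=> n0 bu b_unit; have d0 : \det b != 0 by rewrite -unitfE -unitmxE.
have [u hu] := root_exists (\det b)^-1 n0.
have u0 : u != 0.
  by apply: contra_eq_neq hu => ->; rewrite expr0n gtn_eqF // eq_sym invr_eq0.
exists (u%:M *m b).
  split=> [i j ji|]; first by rewrite mul_scalar_mx mxE bu ?mulr0.
  by rewrite det_mulmx det_scalar hu mulVf.
by move=> x; rewrite -act_mul; apply: same_point_sym; exact: act_scalar.
Qed.

Lemma orbit_ofP x y : (0 < n)%N ->
  orbit_of x y <-> exists b, [/\ upper_mx b, b \in unitmx & same_point (act b x) y].
Proof.
move=> n0; split=> [[b bB e]|[b [bu b_unit e]]].
  by exists b; split=> //; [case: bB|exact: in_borel_unit].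
have [b' b'B hb'] := in_borel_scale n0 bu b_unit.
by exists b' => //; apply: same_point_trans (hb' x) e.
Qed.

Lemma in_borel1 : in_borel (1%:M : 'M[K]_n).
Proof.
by split=> [i j ji|]; [rewrite mxE -val_eqE /= gtn_eqF|rewrite det1].
Qed.

Lemma orbit_of_refl x : orbit_of x x.
Proof. by exists 1%:M; [exact: in_borel1|rewrite act_one; exact: same_point_refl]. Qed.

Lemma orbit_of_sub x y : (0 < n)%N -> orbit_of x y -> subset (orbit_of y) (orbit_of x).
Proof.
move=> n0 /(orbit_ofP _ _ n0)[b [bu b_unit e]] y'.
move=> /(orbit_ofP _ _ n0)[b' [bu' b_unit' e']].
apply/(orbit_ofP _ _ n0); exists (b' *m b); split.
- exact: upper_mxM.
- by rewrite unitmx_mul b_unit b_unit'.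
- rewrite -act_mul; apply: same_point_trans e'; exact: act_same_point.
Qed.

Lemma orbit_of_sym x y : (0 < n)%N -> orbit_of x y -> orbit_of y x.
Proof.
move=> n0 /(orbit_ofP _ _ n0)[b [bu b_unit e]].
apply/(orbit_ofP _ _ n0); exists (invmx b); split; rewrite ?unitmx_inv //.
  exact: upper_mx_inv.
apply: same_point_sym; have := act_same_point (invmx b) e.
by rewrite act_mul mulVmx // act_one.
Qed.

Lemma orbit_of_eq x y : (0 < n)%N -> orbit_of x y -> same_set (orbit_of x) (orbit_of y).
Proof.
by move=> n0 xy z; split; apply: orbit_of_sub => //; exact: orbit_of_sym.
Qed.

Lemma orbit_of_point x : is_point x -> subset (orbit_of x) (@is_point K n).
Proof.
move=> px y [b bB e]; apply: is_point_same e _; apply: is_point_act => //.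
exact: in_borel_unit.
Qed.

(** If neither Z1 nor Z2 suffices, choose b1 and b2 moving x off each of them. On the line of upper
    triangular matrices through b1 and b2, a generic member is invertible and avoids both sets. *)
Lemma zclosure_orbit_irreducible x : (0 < n)%N -> is_point x ->
  irreducible (zclosure (orbit_of x)).
Proof.
move=> n0 px; split; first by exists x; apply: zclosure_sub; exact: orbit_of_refl.
move=> Z1 Z2 cZ1 cZ2 cover; apply: NNPP => /not_or_and[n1 n2].
have witness Z : zclosed Z -> ~ subset (zclosure (orbit_of x)) Z ->
    exists b, [/\ upper_mx b, b \in unitmx & exists d f, [/\ mhfun d f, f (act b x) != 0 &
      forall y, Z y -> f y = 0]].
  move=> cZ nZ; apply: NNPP => none; apply: nZ; apply: zclosure_min => // y [b bB e].
  apply: (zclosed_same cZ e); apply: NNPP => nZb; apply: none; exists b.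
  split; [by case: bB|exact: in_borel_unit|].
  have [Fs h eZ] := zclosed_fam cZ; apply: NNPP => none; apply: nZb; apply/eZ.
  split; first by apply: is_point_act => //; exact: in_borel_unit.
  move=> f Ff; apply: NNPP => fb; apply: none; have [d hf] := h f Ff.
  by exists d, f; split=> //; [apply/eqP|move=> z /eZ[_]; apply].
have [b1 [u1 i1 [d1 [f1 [h1 f1b Z1f]]]]] := witness _ cZ1 n1.
have [b2 [u2 i2 [d2 [f2 [h2 f2b Z2f]]]]] := witness _ cZ2 n2.
pose line t : 'M[K]_n := \matrix_(i, j) (b1 i j + t * (b2 i j - b1 i j)).
have pline i j : polyfun (fun t => line t i j).
  by apply: polyfun_ext (polyfun_segment (b1 i j) (b2 i j)) _ => t; rewrite mxE.
have line0 : line 0 = b1 by apply/matrixP => i j; rewrite mxE mul0r addr0.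
have line1 : line 1 = b2 by apply/matrixP => i j; rewrite mxE mul1r addrC subrK.
have line_up t : upper_mx (line t).
  by move=> i j ji; rewrite mxE u1 // u2 // subr0 mulr0 addr0.
have pf d f : mhfun d f -> polyfun (fun t => f (act (line t) x)).
  move=> hf; apply: (polyfun_mhfun hf); apply: polyfun_act => // c.
  exact: polyfun_const.
have p12 := polyfunM (pf _ _ h1) (pf _ _ h2).
have pd : polyfun (fun t => \det (line t)) by exact: polyfun_det.
have n12 : exists t, f1 (act (line t) x) * f2 (act (line t) x) != 0.
  apply: polyfun_nonroots (pf _ _ h1) (pf _ _ h2) _ _.
    by exists 0; rewrite line0.
  by exists 1; rewrite line1.
have nd : exists t, \det (line t) != 0.
  by exists 0; rewrite line0 -unitfE -unitmxE.
have [t] := polyfun_nonroots p12 pd n12 nd.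
rewrite !mulf_eq0 !negb_or => /andP[/andP[/eqP ne1 /eqP ne2]].
rewrite -unitfE -unitmxE => lu.
have Ot : zclosure (orbit_of x) (act (line t) x).
  apply: zclosure_sub; apply/orbit_ofP => //; exists (line t).
  by split=> //; exact: same_point_refl.
by have [/Z1f|/Z2f] := cover _ Ot.
Qed.

Lemma orbit_curve x (z : K -> ambient K n) (q : K -> K) t0 : is_point x ->
  (forall c, polyfun (fun t => z t c)) -> polyfun q -> (exists t, q t != 0) ->
  (forall t, q t != 0 -> orbit_of x (z t)) -> is_point (z t0) ->
  zclosure (orbit_of x) (z t0).
Proof.
move=> px hz hq q0 hO p0; apply: (@zclosed_curve K n _ z q) => //.
  exact: zclosure_closed (orbit_of_point px).
by move=> t /hO; apply: zclosure_sub.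
Qed.

End Borel.

(* str a is the index of the string of the letter a, and inv the product of all
   the strings; the strings are the orbits of inv. *)
Record string_involution_data n (r : nat) (str : 'I_n -> nat) (inv : 'I_n -> 'I_n) :
    Prop := {
  sid_lt : forall a, (str a < r)%N;
  sid_invK : involutive inv;
  sid_inv : forall a, str (inv a) = str a;
  sid_eq : forall a b, str a = str b -> b = a \/ b = inv a;
  sid_onto : forall l, (l < r)%N -> exists a, str a = l }.

Lemma entry_act (K : fieldType) n (g : 'M[K]_n) x (I J : {set 'I_n}) :
  #|I| = #|J| -> (0 < #|I| < n)%N ->
  entry (act g x) I J =
  \sum_(L : {set 'I_n} | #|L| == #|I|) \sum_(L' : {set 'I_n} | #|L'| == #|I|)
    minor g I L * entry x L L' * minor g J L'.
Proof. by move=> e /(coord_ex e)[c [<- <-]]; rewrite entryE actE. Qed.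

(** * The points D_z attached to an involution *)

Section Involution.
Variables (n r : nat) (str : 'I_n -> nat) (inv : 'I_n -> 'I_n).
Hypothesis sid : string_involution_data r str inv.
Implicit Types (I J L : {set 'I_n}) (a b : 'I_n).
Local Notation upper := (upper str).
Local Notation expo := (expo str).
Local Notation top_set := (top_set r str).

Let str_lt := sid_lt sid.
Let invK := sid_invK sid.
Let inv_inj := inv_inj invK.

Lemma inv_upper l : inv @: upper l = upper l.
Proof.
apply/setP => a; apply/imsetP/idP => [[b bU ->]|aU].
  by rewrite inE (sid_inv sid); rewrite inE in bU.
by exists (inv a); rewrite ?invK // inE (sid_inv sid); rewrite inE in aU.
Qed.

Lemma card_upper_bounds k : (k.+1 < r)%N -> (0 < #|upper k| < n)%N.
Proof.
move=> kr; have [u uk] := sid_onto sid kr; have [v vk] := sid_onto sid (ltnW kr).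
by have := @card_upper_between n str v u; rewrite vk uk; apply.
Qed.

(** The value on string l of a function constant on strings; d serves for an l that is no string. *)
Definition string_value T (d : T) (F : 'I_n -> T) (l : nat) : T :=
  if [pick a | str a == l] is Some a then F a else d.

Lemma string_valueE T (d : T) (F : 'I_n -> T) a : (forall b, F (inv b) = F b) ->
  string_value d F (str a) = F a.
Proof.
move=> h; rewrite /string_value; case: pickP => [b /eqP e|/(_ a)]; last by rewrite eqxx.
by have [->|->] := sid_eq sid e.
Qed.

(** A set detecting a single bar: for u in the string after that of v, its only nonzero exponent is
    the one at [str v], equal to 1, so z is read off there. *)
Definition swap_set u v : {set 'I_n} := v |: (upper (str v) :\ u).

Lemma card_swap_set u v : str u = (str v).+1 -> #|swap_set u v| = #|upper (str v)|.
Proof.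
move=> uv; rewrite cardsU1 !inE ltnn andbF /= add1n.
by rewrite (cardsD1 u (upper (str v))) inE uv ltnSn.
Qed.

Lemma expo_swap_set u v k : str u = (str v).+1 -> expo k (swap_set u v) = (k == str v).
Proof.
move=> uv; have [->|neq] := eqVneq k (str v).
  rewrite /expo card_swap_set // minnn.
  have -> : swap_set u v :&: upper (str v) = upper (str v) :\ u.
    apply/setP => a; rewrite !inE; case: (a =P v) => [->|_] /=; last by rewrite -andbA andbb.
    by rewrite ltnn !andbF.
  by rewrite (cardsD1 u (upper (str v))) inE uv ltnSn addnK.
apply/eqP; rewrite expo_eq0; apply/orP; have [lt|gt|e] := ltngtP k (str v).
- left; rewrite subUset sub1set inE lt /=; apply: subset_trans (subsetDl _ _) _.
  by apply: upper_mono; exact: ltnW.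
- right; apply/subsetP => a; rewrite !inE => ka; rewrite (ltn_trans gt ka) andbT.
  apply/orP; right; apply: contraTneq ka => ->; rewrite uv -leqNgt //.
- by case/eqP: neq.
Qed.

Section OverField.
Variable K : fieldType.
Hypothesis two_neq0 : 2%:R != 0 :> K.

Definition inv_mx : 'M[K]_n := \matrix_(a, b) if inv a == b then
  (if a == b then 1 else 2%:R^-1) else 0.

Lemma inv_mx_neq0 a b : inv_mx a b != 0 -> b = inv a.
Proof. by rewrite mxE; case: (inv a =P b) => // _; rewrite eqxx. Qed.

Lemma inv_mx_inv a : inv_mx a (inv a) != 0.
Proof. by rewrite mxE eqxx; case: ifP; rewrite ?oner_neq0 // invr_eq0. Qed.

Lemma inv_mx_tr : inv_mx^T = inv_mx.
Proof.
apply/matrixP => a b; rewrite !mxE [b == a]eq_sym.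
by rewrite (can2_eq invK invK) [b == _]eq_sym.
Qed.

Lemma inv_mx_block : str_block str inv_mx.
Proof. by move=> a b /inv_mx_neq0 ->; rewrite (sid_inv sid). Qed.

Lemma inv_mx_unit : inv_mx \in unitmx.
Proof.
pose M : 'M[K]_n := \matrix_(a, b) if inv a == b then (inv_mx b a)^-1 else 0.
suff e : inv_mx *m M = 1%:M by have [] := mulmx1_unit e.
apply/matrixP => a b; rewrite mxE (bigD1 (inv a)) //= big1 ?addr0 => [|c ca].
  rewrite [M _ _]mxE invK [RHS]mxE; case: eqP => [<-|_]; last by rewrite mulr0.
  by rewrite mulfV // inv_mx_inv.
by rewrite [inv_mx _ _]mxE eq_sym (negbTE ca) mul0r.
Qed.

Lemma inv_mx_minor_support I J : #|I| = #|J| -> minor inv_mx I J != 0 -> J = inv @: I.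
Proof. by move=> e; apply: minor_mono_support => // a b; exact: inv_mx_neq0. Qed.

Lemma inv_mx_minor_neq0 I : minor inv_mx I (inv @: I) != 0.
Proof.
have [J e nz] := unit_minor_neq0 I inv_mx_unit.
by rewrite -(inv_mx_minor_support e nz).
Qed.

Definition quadric_point (z : nat -> K) : ambient K n := twist r str z inv_mx.

Lemma quadric_point_is_point z : is_point (quadric_point z).
Proof. by apply: twist_point => //; exact: inv_mx_unit. Qed.

Lemma act_diag_quadric_point (be : 'I_n -> K) z : (forall a, be a != 0) ->
  same_point
    (quadric_point (fun l => z l * (string_value 1 (fun a => be a * be (inv a)) l /
                                    string_value 1 (fun a => be a * be (inv a)) l.+1)))
    (act (diag_mx (\row_a be a)) (quadric_point z)).
Proof.
move=> be0; apply: act_diag_twist => //.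
  move=> l; rewrite /string_value; case: pickP => [a _|_]; last exact: oner_neq0.
  by rewrite mulf_neq0.
move=> a b /inv_mx_neq0 ->; rewrite string_valueE // => c.
by rewrite invK mulrC.
Qed.

(** For z k = 0 a set of this size other than [upper k] has positive exponent at k and its
    coordinates vanish; before g acts, the form has a single nonzero coordinate in this degree. *)
Lemma act_quadric_point_rank1 (g : 'M[K]_n) z k I J : (k.+1 < r)%N -> z k = 0 ->
  #|I| = #|upper k| -> #|J| = #|upper k| ->
  entry (act g (quadric_point z)) I J =
  minor g I (upper k) * entry (quadric_point z) (upper k) (upper k) * minor g J (upper k).
Proof.
move=> kr zk cI cJ.
have h := card_upper_bounds kr.
rewrite entry_act ?cI ?cJ //.
have only L L' : #|L| = #|upper k| -> #|L'| = #|upper k| ->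
    entry (quadric_point z) L L' != 0 -> L = upper k /\ L' = upper k.
  move=> cL cL'; rewrite entry_twist mulf_eq0 negb_or => /andP[zL].
  rewrite entry_compounds ?cL ?cL' // => nz.
  suff eL : L = upper k.
    split=> //; rewrite eL in cL nz.
    by rewrite (inv_mx_minor_support (esym cL') nz) inv_upper.
  have : expo k L == 0%N.
    rewrite -leqn0 leqNgt; apply/negP => gt0; case/eqP: zL.
    by rewrite /zfac (bigD1 (Ordinal (ltnW kr))) //= zk expr0n gtn_eqF // mul0r.
  by rewrite expo_eq0 => /orP[sub|sub]; [|symmetry]; apply/eqP; rewrite eqEcard sub cL /=.
rewrite (bigD1 (upper k)) ?eqxx //= [X in _ + X]big1 ?addr0; last first.
  move=> L /andP[/eqP cL nL]; rewrite big1 // => L' /eqP cL'.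
  have [->|/only[//|//|eL _]] := eqVneq (entry (quadric_point z) L L') 0.
    by rewrite mulr0 mul0r.
  by rewrite eL eqxx in nL.
rewrite (bigD1 (upper k)) ?eqxx //= [X in _ + X]big1 ?addr0 // => L' /andP[/eqP cL' nL].
have [->|/only[//|//|_ eL]] := eqVneq (entry (quadric_point z) (upper k) L') 0.
  by rewrite mulr0 mul0r.
by rewrite eL eqxx in nL.
Qed.

(** Rank at most 1 for the form of degree k, expressed by 2 x 2 minors so as to be a closed
    condition. *)
Definition rank1_at (k : nat) (y : ambient K n) : Prop :=
  is_point y /\ forall I J I' J' : {set 'I_n},
    #|I| = k -> #|J| = k -> #|I'| = k -> #|J'| = k ->
    entry y I J * entry y I' J' = entry y I J' * entry y I' J.

Lemma rank1_at_closed k : zclosed (rank1_at k).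
Proof.
pose Fs (f : ambient K n -> K) := exists I J I' J' : {set 'I_n},
  [/\ #|I| = k, #|J| = k, #|I'| = k,
  #|J'| = k & f = fun y => entry y I J * entry y I' J' - entry y I J' * entry y I' J].
have cl : zclosed (fun y => is_point y /\ forall f, Fs f -> f y = 0).
  apply: zclosed_fun => f [I [J [I' [J' [cI cJ cI' cJ' ->]]]]].
  by eexists; apply: mhfunB; apply: mhfunM; apply: mhfun_entry.
apply: zclosed_ext cl _ => y; split=> -[py h]; split=> //.
  move=> I J I' J' cI cJ cI' cJ'; apply/eqP; rewrite -subr_eq0; apply/eqP.
  by apply: (h (fun y => entry y I J * entry y I' J' - entry y I J' * entry y I' J));
     exists I, J, I', J'.
by move=> f [I [J [I' [J' [cI cJ cI' cJ' ->]]]]]; rewrite h // subrr.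
Qed.

Lemma quadric_point_rank1 z k : (k.+1 < r)%N -> z k = 0 ->
  subset (zclosure (orbit_of (quadric_point z))) (rank1_at #|upper k|).
Proof.
move=> kr zk; apply: zclosure_min; first exact: rank1_at_closed.
move=> y [b bB e]; apply: (zclosed_same (rank1_at_closed _) e); split.
  apply: is_point_act; last exact: quadric_point_is_point.
  by rewrite unitmxE (proj2 bB) unitr1.
by move=> I J I' J' cI cJ cI' cJ'; rewrite !(@act_quadric_point_rank1 _ _ k) //; ring.
Qed.

(** The 2 x 2 minor on rows [upper k], S and columns [upper k], [inv @: S] is nonzero: [inv]
    preserves [upper k], so an off-diagonal coordinate vanishes, and z k != 0 keeps the second
    diagonal one. *)
Lemma quadric_point_not_rank1 z k : (k.+1 < r)%N -> z k != 0 ->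
  ~ rank1_at #|upper k| (quadric_point z).
Proof.
move=> kr zk [_ h].
have [u uk] := sid_onto sid kr; have [v vk] := sid_onto sid (ltnW kr).
have uv : str u = (str v).+1 by rewrite uk vk.
pose S := swap_set u v.
have cS : #|S| = #|upper k| by rewrite card_swap_set // vk.
have ciS : #|inv @: S| = #|upper k| by rewrite card_imset.
have hk := card_upper_bounds kr.
have := h (upper k) (upper k) S (inv @: S) erefl erefl cS ciS.
rewrite !entry_twist !entry_compounds ?cS ?ciS //.
have -> : minor inv_mx (upper k) (inv @: S) = 0.
  apply/eqP/negPn/negP => /inv_mx_minor_support; rewrite ciS => /(_ erefl).
  move=> /(imset_inj inv_inj) /setP /(_ v).
  by rewrite !inE eqxx vk ltnn.
move/eqP; rewrite mulr0 mul0r; apply/negP; rewrite !mulf_neq0 ?inv_mx_minor_neq0 //.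
- by rewrite zfac_top ?top_set_upper ?oner_neq0.
- by rewrite -{2}inv_upper inv_mx_minor_neq0.
rewrite prodf_seq_neq0; apply/allP => l _ /=; rewrite expo_swap_set // vk.
by case: (_ =P k) => [->|_]; rewrite ?expr1 ?expr0 ?oner_neq0.
Qed.


End OverField.
End Involution.

(** * Limits under the one-parameter subgroup, and torus orbits *)

Section Cell.
Variables (n r : nat) (str : 'I_n -> nat) (inv : 'I_n -> 'I_n).
Hypothesis sid : string_involution_data r str inv.
Variable K : closedFieldType.
Hypothesis two_neq0 : 2%:R != 0 :> K.
Variable wt : 'I_n -> int.
Hypothesis wt_incr : forall i j : 'I_n, (i < j)%N -> wt i < wt j.
Implicit Types (I J L : {set 'I_n}) (a b : 'I_n) (z : nat -> K).
Local Notation upper := (upper str).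
Local Notation quadric_point := (quadric_point r str inv (K := K)).

Let str_lt := sid_lt sid.
Let invK := sid_invK sid.
Let inv_inj := inv_inj invK.

Definition string_weight (a : 'I_n) : int := wt a + wt (inv a).

Lemma string_weight_inv a : string_weight (inv a) = string_weight a.
Proof. by rewrite /string_weight invK addrC. Qed.

Definition rising (l : nat) : Prop :=
  forall u v, str u = l -> str v = l.+1 -> string_weight u < string_weight v.

Let level_weight (l : nat) : int := string_value str 0 string_weight l.
Let gap (l : nat) : nat :=
  absz (level_weight l.+1 - level_weight l).

(** Conjugation by lambda(t) multiplies g i j by t^(wt j - wt i), a nonnegative power where g is
    nonzero, and lambda(t) multiplies z l by t^(gap l), a positive power where z l != 0. Both extend
    to t = 0, with values the diagonal of g, which fixes D_0, and z = 0. *)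
Lemma quadric_point_limit (g : 'M[K]_n) z : upper_mx g -> g \in unitmx ->
  (forall l, (l.+1 < r)%N -> z l != 0 -> rising l) ->
  limit_at0 (fun t => act (lambda wt t) (act g (quadric_point z)))
            (quadric_point (fun=> 0)).
Proof.
move=> gu g_unit zr.
pose gt t : 'M[K]_n := \matrix_(i, j) (g i j * t ^+ absz (wt j - wt i)).
pose zt t l := z l * t ^+ gap l.
have gtu t : upper_mx (gt t) by move=> i j ji; rewrite mxE gu // mul0r.
have gt_unit t : gt t \in unitmx.
  rewrite unitmxE unitfE upper_mx_det // prodf_seq_neq0; apply/allP => i _ /=.
  by rewrite mxE subrr expr0 mulr1 upper_mx_diag_neq0.
have wle (i j : 'I_n) : (i <= j)%N -> wt i <= wt j.
  rewrite leq_eqVlt => /orP[/eqP/val_inj -> //|/wt_incr]; exact: ltW.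
have gapE l : (l.+1 < r)%N -> z l != 0 -> exists u v, [/\ str u = l, str v = l.+1,
    (gap l)%:Z = string_weight v - string_weight u & (0 < gap l)%N].
  move=> lr zl; have [v vl] := sid_onto sid lr; have [u ul] := sid_onto sid (ltnW lr).
  have lt := zr l lr zl u v ul vl; exists u, v.
  have eg : (gap l)%:Z = string_weight v - string_weight u.
    rewrite /gap /level_weight -{1}vl -{1}ul !(string_valueE sid) //;
      try exact: string_weight_inv.
    by rewrite gez0_abs // subr_ge0 ltW.
  by split=> //; rewrite -ltz_nat eg subr_gt0.
have pf c : polyfun (fun t => act (gt t) (quadric_point (zt t)) c).
  apply: polyfun_act => [i j|c'].
    apply: (@polyfun_ext _ (fun t => g i j * t ^+ absz (wt j - wt i)));
      last by move=> t; rewrite mxE.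
    by apply: polyfunM; [exact: polyfun_const|apply: polyfunX; exact: polyfun_id].
  apply: polyfun_twist => l; apply: polyfunM; first exact: polyfun_const.
  by apply: polyfunX; exact: polyfun_id.
have [phi hphi] := fin_all_exists pf.
have phiE t : [ffun c => (phi c).[t]] = act (gt t) (quadric_point (zt t)).
  by apply/ffunP => c; rewrite ffunE hphi.
exists phi; split=> /= [t|t t0|]; rewrite phiE.
- by apply: is_point_act => //; exact: quadric_point_is_point.
- have -> : act (lambda wt t) (act g (quadric_point z)) =
      act (gt t) (act (lambda wt t) (quadric_point z)).
    rewrite !act_mul; congr (act _ _); apply/matrixP => i j.
    rewrite mul_diag_mx mul_mx_diag !mxE.
    have [ji|ij] := ltnP j i; first by rewrite gu // !(mul0r, mulr0).
    rewrite mulrC -mulrA; congr (_ * _); rewrite exprnP gez0_abs ?subr_ge0 ?wle //.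
    by rewrite -expfzDr // addrAC subrr add0r.
  apply: act_same_point; apply: same_point_sym.
  have -> : quadric_point (zt t) = quadric_point (fun l => z l *
     (string_value str 1 (fun a => t ^ (- wt a) * t ^ (- wt (inv a))) l /
      string_value str 1 (fun a => t ^ (- wt a) * t ^ (- wt (inv a))) l.+1)).
    apply: eq_twist => // l lr; rewrite /zt; have [->|zl] := eqVneq (z l) 0.
      by rewrite !mul0r.
    have [u [v [ul vl eg _]]] := gapE l lr zl; congr (_ * _).
    rewrite -{2}ul -{1}vl !(string_valueE sid); try by move=> a; rewrite invK mulrC.
    rewrite -!expfzDr // invr_expz -expfzDr // exprnP eg /string_weight.
    by congr (_ ^ _); lia.
  apply: (act_diag_quadric_point sid (be := fun a => t ^ (- wt a))) => a.
  by rewrite expfz_neq0.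
- have -> : gt 0 = diag_mx (\row_i g i i).
    apply/matrixP => i j; rewrite !mxE; have [->|ne] := eqVneq i j.
      by rewrite subrr expr0 mulr1n mulr1.
    rewrite mulr0n; have [ji|ij] := leqP j i.
      by rewrite gu ?mul0r // ltn_neqAle ji andbT eq_sym.
    by rewrite expr0n absz_eq0 subr_eq0 gt_eqF ?mulr0 // wt_incr.
  have -> : quadric_point (zt 0) = quadric_point (fun=> 0).
    apply: eq_twist => // l lr; rewrite /zt; have [->|zl] := eqVneq (z l) 0.
      by rewrite mul0r.
    by have [u [v [_ _ _ gl]]] := gapE l lr zl; rewrite expr0n gtn_eqF // mulr0.
  apply: same_point_sym.
  have := @act_diag_quadric_point _ _ _ _ sid K (fun i => g i i) (fun=> 0)
    (fun i => upper_mx_diag_neq0 i gu g_unit).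
  have eZ z1 : (forall l, z1 l = 0) -> quadric_point z1 = quadric_point (fun=> 0).
    by move=> h; apply: eq_twist => // l _; rewrite h.
  by rewrite eZ // => l; rewrite mul0r.
Qed.

Lemma orbit_sub_cell z : (forall l, (l.+1 < r)%N -> z l != 0 -> rising l) ->
  subset (orbit_of (quadric_point z)) (bb_cell wt (quadric_point (fun=> 0))).
Proof.
move=> zr y [g gB e]; have g_unit := in_borel_unit gB; split.
  apply: (zclosed_same (@complete_quadrics_closed K n) e).
  apply: complete_quadrics_act => //; apply: twist_complete => //.
  - exact: (inv_mx_tr sid).
  - exact: (inv_mx_block sid).
  - exact: (inv_mx_unit sid).
have [phi [h1 h2 h3]] := quadric_point_limit (proj1 gB) g_unit zr.
exists phi; split=> // t t0; apply: same_point_trans (h2 t t0).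
by apply: act_same_point; apply: same_point_sym.
Qed.

(** Quotients of nonzero values of z' and z are ratios of scales W l, realized by a torus element
    constant on strings; the orbit depends only on where z vanishes. *)
Lemma torus_orbit z z' : (0 < n)%N ->
  (forall l, (l.+1 < r)%N -> (z l == 0) = (z' l == 0)) ->
  orbit_of (quadric_point z) (quadric_point z').
Proof.
move=> n0 hz; pose rho l := if z l == 0 then 1 else if z' l == 0 then 1 else z' l / z l.
have rho0 l : rho l != 0.
  rewrite /rho; case: (z l =P 0) => [_|/eqP zl]; first exact: oner_neq0.
  case: (z' l =P 0) => [_|/eqP zl']; first exact: oner_neq0.
  by rewrite mulf_neq0 ?invr_eq0.
pose W l := \prod_(k < l) (rho k)^-1.
have W0 l : W l != 0.
  by rewrite prodf_seq_neq0; apply/allP => k _ /=; rewrite invr_eq0.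
have Wrho l : W l / W l.+1 = rho l.
  by rewrite /W big_ord_recr /= invfM invrK mulrA mulfV ?mul1r // -/(W l).
have [be hbe] : exists be : 'I_n -> K,
    forall a, be a * be a = W (str a) /\ be a = be (inv a).
  (* [be a * be (inv a)] has to be [W (str a)], whence one square root for each string. *)
  have [s hs] : exists s : 'I_r -> K, forall l, s l ^+ 2 = W l.
    by apply: (fin_all_exists (P := fun l u => u ^+ 2 = W _)) => l; exact: root_exists.
  exists (fun a => s (Ordinal (str_lt a))) => a; rewrite -expr2 hs; split=> //.
  by congr s; apply: val_inj; rewrite /= (sid_inv sid).
have be0 a : be a != 0.
  by have [e _] := hbe a; apply: contra_eq_neq e => ->; rewrite mul0r eq_sym.
apply/orbit_ofP => //; exists (diag_mx (\row_a be a)); split.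
- by move=> i j ji; rewrite !mxE -val_eqE /= gtn_eqF.
- rewrite unitmxE det_diag unitfE prodf_seq_neq0; apply/allP => a _ /=; by rewrite mxE.
apply: same_point_sym.
suff -> : quadric_point z' = twist r str (fun l => z l * (W l / W l.+1)) (inv_mx inv K).
  apply: act_diag_twist => // a b /inv_mx_neq0 ->.
  by have [e1 e2] := hbe a; rewrite -e2.
apply: eq_twist => // l lr; rewrite Wrho /rho; have := hz l lr.
case: (z l =P 0) => [->|/eqP zl] e; first by rewrite mul0r; apply/eqP; rewrite -e.
by rewrite -e mulrC divfK.
Qed.

End Cell.

(** * Orbits in the cell *)

Section LocalRing.
Variables (K : fieldType) (n : nat) (x0 : ambient K n).
Implicit Types (f g h : ambient K n -> K) (P Q : 'M[K]_n -> Prop).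

(* The local ring at x0: degree 0 fractions of multihomogeneous functions. *)
Definition regular f : Prop := exists d F G, [/\ mhfun d F, mhfun d G, G x0 != 0 &
  forall x, G x != 0 -> f x = F x / G x].

Lemma regular_ext f g : regular f -> f =1 g -> regular g.
Proof.
by move=> [d [F [G [hF hG G0 e]]]] fg; exists d, F, G; split=> // x Gx; rewrite -fg e.
Qed.

Lemma regular_const a : regular (fun=> a).
Proof.
exists (fun=> 0%N), (fun=> a), (fun=> 1).
by split=> [|||x _]; rewrite ?oner_neq0 ?divr1 //; exact: mhfun_const.
Qed.

Lemma regularD f g : regular f -> regular g -> regular (fun x => f x + g x).
Proof.
move=> [d [F [G [hF hG G0 e]]]] [d' [F' [G' [hF' hG' G0' e']]]].
exists (fun i => d i + d' i)%N, (fun x => F x * G' x + G x * F' x), (fun x => G x * G' x).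
split; [by apply: mhfunD; apply: mhfunM|exact: mhfunM|exact: mulf_neq0|].
move=> x; rewrite mulf_eq0 negb_or => /andP[Gx Gx']; rewrite e // e' //.
by rewrite addf_div // [F' x * _]mulrC.
Qed.

Lemma regularM f g : regular f -> regular g -> regular (fun x => f x * g x).
Proof.
move=> [d [F [G [hF hG G0 e]]]] [d' [F' [G' [hF' hG' G0' e']]]].
exists (fun i => d i + d' i)%N, (fun x => F x * F' x), (fun x => G x * G' x).
split; [exact: mhfunM|exact: mhfunM|exact: mulf_neq0|].
move=> x; rewrite mulf_eq0 negb_or => /andP[Gx Gx']; rewrite e // e' //.
by rewrite mulf_div.
Qed.

Lemma regularV f : regular f -> f x0 != 0 -> regular (fun x => (f x)^-1).
Proof.
move=> [d [F [G [hF hG G0 e]]]] f0.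
have F0 : F x0 != 0 by move: f0; rewrite e // mulf_eq0 negb_or => /andP[].
exists (fun i => d i + d i)%N, (fun x => G x * G x), (fun x => F x * G x).
split; [exact: mhfunM|exact: mhfunM|exact: mulf_neq0|].
move=> x; rewrite mulf_eq0 negb_or => /andP[Fx Gx]; rewrite e //.
by rewrite invf_div -mulf_div divff // mulr1.
Qed.

Lemma regular_div f g : regular f -> regular g -> g x0 != 0 ->
  regular (fun x => f x / g x).
Proof. by move=> hf hg g0; apply: regularM => //; apply: regularV. Qed.

Lemma regularB f g : regular f -> regular g -> regular (fun x => f x - g x).
Proof.
move=> hf hg; apply: regular_ext (regularD hf (regularM (regular_const (-1)) hg)) _ => x.
by rewrite mulN1r.
Qed.

Lemma regular_sum (I : Type) (s : seq I) (P : pred I) (F : I -> ambient K n -> K) :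
  (forall i, P i -> regular (F i)) -> regular (fun x => \sum_(i <- s | P i) F i x).
Proof.
move=> hF; elim: s => [|i s IH].
  by apply: regular_ext (regular_const 0) _ => x; rewrite big_nil.
case Pi : (P i); last by apply: regular_ext IH _ => x; rewrite big_cons Pi.
by apply: regular_ext (regularD (hF i Pi) IH) _ => x; rewrite big_cons Pi.
Qed.

Lemma regular_prod (I : Type) (s : seq I) (P : pred I) (F : I -> ambient K n -> K) :
  (forall i, P i -> regular (F i)) -> regular (fun x => \prod_(i <- s | P i) F i x).
Proof.
move=> hF; elim: s => [|i s IH].
  by apply: regular_ext (regular_const 1) _ => x; rewrite big_nil.
case Pi : (P i); last by apply: regular_ext IH _ => x; rewrite big_cons Pi.
by apply: regular_ext (regularM (hF i Pi) IH) _ => x; rewrite big_cons Pi.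
Qed.

Lemma regularX f k : regular f -> regular (fun x => f x ^+ k).
Proof.
move=> hf; elim: k => [|k IH]; first exact: regular_const.
by apply: regular_ext (regularM hf IH) _ => x; rewrite exprS.
Qed.

Lemma regular_minor (A : ambient K n -> 'M[K]_n) I J :
  (forall i j, regular (fun x => A x i j)) -> regular (fun x => minor (A x) I J).
Proof.
move=> hA; apply: regular_sum => s _; apply: regularM; first exact: regular_const.
by apply: regular_prod => i _; apply: regular_ext (hA _ _) _ => x; rewrite mxE.
Qed.

Lemma regular_ratio (I J L M : {set 'I_n}) : #|I| = #|L| -> entry x0 L M != 0 ->
  regular (fun x => entry x I J / entry x L M).
Proof.
move=> e nz; exists (fun i => #|L| == i), (fun x => entry x I J), (fun x => entry x L M).
by split=> //; apply: mhfun_entry.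
Qed.

(** Neighbourhoods of [x0] are the sets h != 0. P is asked only of nonsingular matrices with
    compounds in one of them, as [x0] itself may be degenerate. *)
Definition generic P : Prop := exists h, [/\ regular h, h x0 != 0 &
  forall A, A^T = A -> A \in unitmx -> h (compounds A) != 0 -> P A].

Lemma genericW P Q : (forall A, A^T = A -> A \in unitmx -> P A -> Q A) ->
  generic P -> generic Q.
Proof.
move=> PQ [h [rh h0 hP]]; exists h; split=> // A sA uA /(hP A sA uA).
exact: PQ.
Qed.

Lemma genericI P Q : generic P -> generic Q -> generic (fun A => P A /\ Q A).
Proof.
move=> [h [rh h0 hP]] [h' [rh' h0' hQ]]; exists (fun x => h x * h' x).
split; [exact: regularM|exact: mulf_neq0|].
move=> A sA uA; rewrite mulf_eq0 negb_or => /andP[hA hA']; split; first exact: hP.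
exact: hQ.
Qed.

Lemma generic_neq0 f : regular f -> f x0 != 0 -> generic (fun A => f (compounds A) != 0).
Proof. by move=> rf f0; exists f. Qed.

Lemma generic_all (I : finType) (P : I -> 'M[K]_n -> Prop) :
  (forall i, generic (P i)) -> generic (fun A => forall i, P i A).
Proof.
move=> hP; have [h hh] := fin_all_exists hP; exists (fun x => \prod_i h i x); split.
- by apply: regular_prod => i _; have [] := hh i.
- by rewrite prodf_seq_neq0; apply/allP => i _; have [] := hh i.
move=> A sA uA; rewrite prodf_seq_neq0 => /allP nz i; have [_ _] := hh i; apply=> //.
exact: (nz i (mem_index_enum _)).
Qed.

Lemma generic_eq0 f : complete_quadrics x0 -> regular f ->
  generic (fun A => f (compounds A) = 0) -> f x0 = 0.
Proof.
move=> X0 [d [F [G [hF hG G0 e]]]] [h [[d' [F' [G' [hF' hG' G0' e']]]] h0 hA]].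
have F0' : F' x0 != 0 by move: h0; rewrite e' // mulf_eq0 negb_or => /andP[].
have hH := mhfunM (mhfunM hF hG) (mhfunM hF' hG').
have := X0 _ (zclosed_fun (Fs := fun f => f = fun x => F x * G x * (F' x * G' x)) _).
case=> [f' ->|x [A [sA uA xA]]|_ /(_ _ erefl)].
- by eexists; exact: hH.
- split=> [|f' ->]; first by apply: is_point_same xA _; exact: is_point_compounds.
  have [u u0 ->] := mhfun_same_point hH xA.
  apply/eqP; rewrite mulf_eq0 (negbTE u0) /= -[_ == 0]negbK; apply/negP.
  rewrite !mulf_eq0 !negb_or => /andP[/andP[FA GA] /andP[FA' GA']].
  have : f (compounds A) = 0.
    by apply: hA => //; rewrite e' // mulf_neq0 ?invr_eq0.
  by rewrite e // => /eqP; rewrite mulf_eq0 invr_eq0 (negbTE FA) (negbTE GA).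
- move/eqP; rewrite !mulf_eq0 (negbTE G0) (negbTE F0') (negbTE G0') !orbF => /eqP F0.
  by rewrite e // F0 mul0r.
Qed.

End LocalRing.

(** * Coordinates of the points of the cell *)

Section CellCoordinates.
Variables (n r : nat) (str : 'I_n -> nat) (inv : 'I_n -> 'I_n).
Hypothesis sid : string_involution_data r str inv.
Variable K : closedFieldType.
Hypothesis two_neq0 : 2%:R != 0 :> K.
Variable wt : 'I_n -> int.
Hypothesis wt_incr : forall i j : 'I_n, (i < j)%N -> wt i < wt j.
Implicit Types (I J L M : {set 'I_n}) (a b : 'I_n) (x y : ambient K n).
Local Notation upper := (upper str).
Local Notation top_set := (top_set r str).
Local Notation quadric_point := (quadric_point r str inv (K := K)).

Let str_lt := sid_lt sid.
Let invK := sid_invK sid.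
Let inv_inj := inv_inj invK.

Definition wsum I : int := \sum_(a in I) wt a.

Lemma act_lambda t x (c : Defs.coord n) : t != 0 ->
  act (lambda wt t) x c = t ^ (- (wsum (rows_of c) + wsum (cols_of c))) * x c.
Proof.
move=> t0.
have pE I : \prod_(a in I) (\row_i t ^ (- wt i)) 0 a = t ^ (- wsum I).
  rewrite /wsum -sumrN; elim/big_rec2: _ => [|a u v _ ->]; first by rewrite expr0z.
  by rewrite mxE -expfzDr.
by rewrite act_diag !pE mulrAC -expfzDr // opprD.
Qed.

(** lambda(t) multiplies a coordinate by t to minus its weight. Those at (I, [inv @: I]), I a top
    set, survive in the limit, so they are nonzero; a heavier coordinate of the same degree would
    blow up relative to them, so it is zero. *)
Record in_cell x : Prop := InCell {
  in_cell_complete : complete_quadrics x;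
  in_cell_top : forall I, top_set I -> (0 < #|I| < n)%N -> entry x I (inv @: I) != 0;
  in_cell_eq0 : forall I L M, top_set I -> (0 < #|I| < n)%N ->
    #|L| = #|I| -> #|M| = #|I| ->
    wsum I + wsum (inv @: I) < wsum L + wsum M -> entry x L M = 0 }.

Lemma bb_cell_in_cell x : bb_cell wt (quadric_point (fun=> 0)) x -> in_cell x.
Proof.
move=> [Xx [phi [_ hphi [s0 s00 e0]]]].
have id_nz : exists t : K, t != 0 by exists 1; exact: oner_neq0.
have ppoly (p : {poly K}) : polyfun (fun t => p.[t]) by exists p.
have main I : top_set I -> (0 < #|I| < n)%N -> exists c0, [/\ rows_of c0 = I,
    cols_of c0 = inv @: I, (phi c0).[0] != 0 & x c0 != 0].
  move=> tI hI; have [|c0 [r0 k0]] := @coord_ex n I (inv @: I) _ hI.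
    by rewrite card_imset.
  have nz : (phi c0).[0] != 0.
    have := e0 c0; rewrite !ffunE r0 k0 zfac_top // mul1r => e.
    by apply: contraNneq (inv_mx_minor_neq0 sid two_neq0 I) => z; rewrite e z mulr0.
  exists c0; split=> //; apply: contraNneq nz => x0.
  apply/eqP; apply: (@polyfun_density K (fun t => (phi c0).[t]) id (ppoly (phi c0))
    (polyfun_id K) id_nz _ 0) => t t0.
  have [s s1 e] := hphi t t0; have := e c0; rewrite ffunE act_lambda // x0 !mulr0.
  by [].
split=> // I.
  by move=> tI hI; have [c0 [<- <- _]] := main I tI hI; rewrite entryE.
move=> L M tI hI cL cM lt; have [c0 [r0 k0 nz x0]] := main I tI hI.
have [|c [rc kc]] := @coord_ex n L M (etrans cL (esym cM)); first by rewrite cL.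
rewrite -rc -kc entryE.
pose w c := wsum (rows_of c) + wsum (cols_of c).
pose k := absz (w c - w c0).
have kE : (k : int) = w c - w c0.
  by rewrite /k gez0_abs // subr_ge0 /w r0 k0 rc kc ltW.
have k0' : (0 < k)%N by rewrite -ltz_nat kE subr_gt0 /w r0 k0 rc kc.
(* Eliminating the common scalar between the coordinates c and c0 gives phi_c x_c0 t^k = x_c phi_c0
   for t != 0, with k > 0 the difference of weights; at t = 0 it forces x_c = 0. *)
have pf : polyfun (fun t => (phi c).[t] * x c0 * t ^+ k + - x c * (phi c0).[t]).
  apply: polyfunD; apply: polyfunM => //; try exact: polyfun_const.
    by apply: polyfunM => //; exact: polyfun_const.
  by apply: polyfunX; exact: polyfun_id.
have := polyfun_density pf (polyfun_id K) id_nz _ 0.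
rewrite expr0n gtn_eqF // mulr0 add0r => h; apply/eqP.
suff /h/eqP : forall t, t != 0 ->
    (phi c).[t] * x c0 * t ^+ k + - x c * (phi c0).[t] = 0.
  by rewrite mulf_eq0 oppr_eq0 (negbTE nz) orbF.
move=> t t0; have [s s1 e] := hphi t t0.
have := e c; rewrite [LHS]ffunE act_lambda // -/(w c) => ->.
have := e c0; rewrite [LHS]ffunE act_lambda // -/(w c0) => ->.
have -> : degree_of c0 = degree_of c by rewrite /degree_of r0 rc cL.
have -> : t ^ (- w c0) = t ^ (- w c) * t ^+ k.
  by rewrite exprnP kE -expfzDr //; congr (_ ^ _); lia.
ring.
Qed.

Lemma in_cell_same x y : in_cell x -> same_point x y -> in_cell y.
Proof.
move=> [Xx x1 x2] xy; have [s s0 e] := xy.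
have eE I J : exists2 u, u != 0 & entry y I J = u * entry x I J.
  rewrite /entry; case: insub => [c|]; last by exists 1; rewrite ?oner_neq0 ?mulr0.
  by exists (s (degree_of c)).
split.
- exact: zclosed_same (complete_quadrics_closed K n) xy Xx.
- move=> I tI hI; have [u u0 ->] := eE I (inv @: I).
  by rewrite mulf_neq0 // x1.
- move=> I L M tI hI cL cM lt; have [u _ ->] := eE L M.
  by rewrite (x2 I) // mulr0.
Qed.

(** The bijection of [minor_neq0] sends each letter to one at least as large, and [wt] increases. *)
Lemma upper_minor_wsum (g : 'M[K]_n) I L : upper_mx g -> #|I| = #|L| ->
  minor g I L != 0 -> I = L \/ wsum I < wsum L.
Proof.
move=> gu e /(minor_neq0 e)[f [fi fL fa]].
have le a : a \in I -> (a <= f a)%N.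
  by move=> /fa; apply: contraNleq => lt; rewrite gu.
have wL : wsum L = \sum_(a in I) wt (f a) by rewrite -fL /wsum big_imset.
have [/forall_inP eqf|] := boolP [forall a in I, f a == a].
  left; rewrite -fL -[LHS]imset_id; apply: eq_in_imset => a /eqf /eqP.
  by [].
rewrite negb_forall_in => /exists_inP[a aI nfa]; right.
rewrite wL /wsum (bigD1 a) //= [ltRHS](bigD1 a) //=; apply: ltr_leD.
  by apply: wt_incr; rewrite ltn_neqAle le // andbT eq_sym.
apply: ler_sum => b /andP[/le + _].
rewrite leq_eqVlt => /orP[/eqP/val_inj <- //|/wt_incr].
exact: ltW.
Qed.

(** A unipotent upper triangular g adds to a coordinate only heavier ones; above the leading
    coordinates these vanish. *)
Lemma in_cell_act (g : 'M[K]_n) x : upper_mx g -> (forall i, g i i = 1) ->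
  in_cell x -> in_cell (act g x).
Proof.
move=> gu g1 [Xx x1 x2].
have g_unit : g \in unitmx by rewrite unitmxE upper_mx_det // big1 // unitr1.
have mI I : minor g I I = 1 by rewrite minor_upper // big1.
have tail I I' J J' : #|I'| = #|I| -> #|J'| = #|J| -> (I', J') != (I, J) ->
    minor g I I' * entry x I' J' * minor g J J' != 0 ->
    entry x I' J' != 0 /\ wsum I + wsum J < wsum I' + wsum J'.
  move=> cI cJ ne; rewrite !mulf_eq0 !negb_or => /andP[/andP[mi xe] mj]; split=> //.
  have := upper_minor_wsum gu (esym cI) mi; have := upper_minor_wsum gu (esym cJ) mj.
  case=> [eJ|lJ] [eI|lI].
  - by rewrite eI eJ eqxx in ne.
  - by rewrite eJ ltrD2r.
  - by rewrite eI ltrD2l.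
  - exact: ltrD.
split; first exact: complete_quadrics_act.
- move=> I tI hI; have cinv : #|inv @: I| = #|I| by rewrite card_imset.
  rewrite entry_act // (bigD1 I) //= (bigD1 (inv @: I)) ?cinv //=.
  rewrite [X in _ + X + _]big1 ?addr0 => [|J' /andP[/eqP cJ nJ]].
    rewrite [X in _ + X]big1 ?addr0; first by rewrite !mI mul1r mulr1 x1.
    move=> I' /andP[/eqP cI nI]; rewrite big1 // => J' /eqP cJ.
    apply/eqP/negPn/negP => /tail [|||/negP xe lt]; rewrite ?cinv //.
      by apply: contra nI => /eqP[->].
    by apply: xe; apply/eqP; exact: (x2 I).
  apply/eqP/negPn/negP => /tail [|||/negP xe lt]; rewrite ?cinv //.
    by apply: contra nJ => /eqP[->].
  by apply: xe; apply/eqP; exact: (x2 I).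
- move=> I L M tI hI cL cM lt; rewrite entry_act ?cM ?cL // big1 // => I' /eqP cI.
  rewrite big1 // => J' /eqP cJ; apply/eqP/negPn/negP => nz.
  have [e|ne] := eqVneq (I', J') (L, M).
    by case: e nz => -> ->; rewrite (x2 I) // mulr0 mul0r eqxx.
  have [| |/negP xe lt'] := tail _ _ _ _ _ _ ne nz; rewrite ?cL ?cM //.
  by apply: xe; apply/eqP; apply: (x2 I) => //; exact: lt_trans lt'.
Qed.

End CellCoordinates.

(** [same_point] asks for a nonzero scalar in every degree; 1 fills the degrees that carry no
    coordinate. *)
Lemma same_point_degrees (K : fieldType) n (x y : ambient K n) (s : nat -> K) :
  (forall i, (0 < i < n)%N -> s i != 0) -> (forall c, y c = s (degree_of c) * x c) ->
  same_point x y.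
Proof.
move=> s0 e; exists (fun i => if (0 < i < n)%N then s i else 1) => [i|c].
  by case: ifP => [/s0 //|_]; exact: oner_neq0.
by have [_ h] := coordP c; rewrite e /degree_of h.
Qed.

(** * Block elimination near a point of the cell *)

Section Elimination.
Variables (n r : nat) (str : 'I_n -> nat) (inv : 'I_n -> 'I_n).
Hypothesis sid : string_involution_data r str inv.
Variable K : closedFieldType.
Variable wt : 'I_n -> int.
Hypothesis wt_incr : forall i j : 'I_n, (i < j)%N -> wt i < wt j.
Implicit Types (I J L M S : {set 'I_n}) (a b : 'I_n) (x y : ambient K n).
Local Notation upper := (upper str).
Local Notation top_set := (top_set r str).
Local Notation quadric_point := (quadric_point r str inv (K := K)).
Local Notation in_cell := (in_cell r str inv wt).

Let str_lt := sid_lt sid.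
Let invK := sid_invK sid.
Let inv_inj := inv_inj invK.

(** Cramer's coefficient of row s in row j, written with coordinates of the point: the numerator is
    the minor with row s replaced by row j, and the first factor is the sign of the increasing
    listing. *)
Definition elim_coef j s x : K := let S := upper (str j) in
  minor (1%:M + delta_mx s j) S (j |: S :\ s) * (entry x (j |: S :\ s) S / entry x S S).

Definition elim_mx x : 'M[K]_n := \matrix_(j, s)
  if s == j then 1 else if (str j < str s)%N then - elim_coef j s x else 0.

Lemma card_replace S j s : j \notin S -> s \in S -> #|j |: S :\ s| = #|S|.
Proof.
by move=> jS sS; rewrite cardsU1 !inE (negbTE jS) andbF /= [RHS](cardsD1 s) sS.
Qed.

Lemma wsum_replace S j s : j \notin S -> s \in S ->
  wsum wt (j |: S :\ s) + wt s = wsum wt S + wt j.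
Proof.
move=> jS sS; rewrite /wsum big_setU1 /=; last by rewrite !inE (negbTE jS) andbF.
by rewrite [in RHS](big_setD1 s) //=; ring.
Qed.

(** An entry with s < j involves the coordinate where s is replaced by j in the rows
    [upper (str j)]; this one is heavier than the leading coordinate, so it vanishes on the cell. *)
Lemma elim_mx_upper x : in_cell x -> upper_mx (elim_mx x).
Proof.
move=> cx j s sj; rewrite mxE -val_eqE /= ltn_eqF //; case: ifP => // js.
have sS : s \in upper (str j) by rewrite inE.
have jS : j \notin upper (str j) by rewrite inE ltnn.
rewrite /elim_coef (in_cell_eq0 cx (top_set_upper str_lt (str j))).
- by rewrite mul0r mulr0 oppr0.
- exact: card_upper_between js.
- exact: card_replace.
- by [].
by rewrite (inv_upper sid) ltrD2r -(ltrD2r (wt s)) wsum_replace // ltrD2l wt_incr.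
Qed.

Lemma elim_mx_diag x j : elim_mx x j j = 1.
Proof. by rewrite mxE eqxx. Qed.

Lemma elim_mx_regular x0 j s : in_cell x0 -> regular x0 (fun x => elim_mx x j s).
Proof.
move=> cx; apply: (@regular_ext _ _ _ (fun x => if s == j then 1 else
   if (str j < str s)%N then - elim_coef j s x else 0)); last by move=> x; rewrite mxE.
case: (s == j); first exact: regular_const.
case js : (str j < str s)%N; last exact: regular_const.
have sS : s \in upper (str j) by rewrite inE.
have jS : j \notin upper (str j) by rewrite inE ltnn.
apply: (@regular_ext _ _ _ (fun x => 0 - elim_coef j s x)); last by move=> x; rewrite sub0r.
apply: regularB; first exact: regular_const.
apply: regularM; first exact: regular_const.
apply: regular_ratio; first exact: card_replace.
have := in_cell_top cx (top_set_upper str_lt (str j)) (card_upper_between js).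
by rewrite (inv_upper sid).
Qed.

Lemma minor_add_delta j s S L : j \notin S -> s \in S -> #|L| = #|S| ->
  minor (1%:M + delta_mx s j : 'M[K]_n) S L != 0 -> L = S \/ L = j |: S :\ s.
Proof.
move=> jS sS cL /(minor_neq0 (esym cL))[f [fi fL fa]].
have fE a : a \in S -> f a = a \/ a = s /\ f a = j.
  move=> /fa; rewrite !mxE; case: (a =P f a) => [<-|_]; first by left.
  rewrite add0r; case: (a =P s) => [->|_] /=; last by rewrite eqxx.
  by case: (f s =P j) => [->|_]; [right|rewrite eqxx].
have fid a : a \in S -> a != s -> f a = a.
  by move=> aS /eqP as_; case: (fE a aS) => // -[].
have [fs|[_ fs]] := fE s sS; [left|right]; rewrite -fL.
  rewrite -[RHS]imset_id; apply: eq_in_imset => a aS.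
  by have [->|/(fid a aS)->] := eqVneq a s.
rewrite -{1}(setD1K sS) imsetU1 fs; congr (_ |: _).
rewrite -[RHS]imset_id; apply: eq_in_imset => a; rewrite !inE => /andP[as_ aS].
exact: fid.
Qed.

Lemma minor_add_delta1 j s S : j \notin S ->
  minor (1%:M + delta_mx s j : 'M[K]_n) S S = 1.
Proof.
move=> jS; rewrite (@eq_minor _ _ _ 1%:M) ?minor1 ?eqxx // => a b aS bS.
rewrite !mxE [b == j](_ : _ = false) ?andbF ?addr0 //.
by apply: contraNF jS => /eqP <-.
Qed.

(** By [minor_cramer] the coefficients solve the system that makes the combination of rows vanish in
    the columns of S. *)
Lemma elim_mx_row0 (A : 'M[K]_n) j t :
  (forall j s, (str j < str s)%N -> minor A (upper (str j)) (upper (str j)) != 0) ->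
  (str j < str t)%N -> (elim_mx (compounds A) *m A) j t = 0.
Proof.
move=> A0 jt; set S := upper (str j).
have tS : t \in S by rewrite inE.
have jS : j \notin S by rewrite inE ltnn.
have hS := card_upper_between jt; have AS0 := A0 j t jt; rewrite -/S in hS AS0.
(* The minor of (1 + delta_sj) A on S has two Cauchy-Binet terms, at S and at S with s replaced by
   j; the subtraction cancels the first. *)
have coefE s : s \in S -> elim_coef j s (compounds A) =
    (minor ((1%:M + delta_mx s j) *m A) S S - minor A S S) / minor A S S.
  move=> sS; have cS := card_replace jS sS.
  rewrite /elim_coef -/S !entry_compounds ?cS // mulrA; congr (_ / _).
  rewrite cauchy_binet // (bigD1 S) //= (bigD1 (j |: S :\ s)) /=; last first.
    rewrite cS eqxx /=; apply: contraNneq jS => <-; exact: setU11.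
  rewrite minor_add_delta1 // mul1r [X in _ + (_ + X)]big1 ?addr0 => [|L].
    by rewrite addrAC subrr add0r.
  move=> /andP[/andP[/eqP cL LS] LR]; apply/eqP; rewrite mulf_eq0; apply/orP; left.
  apply/negPn/negP => /(minor_add_delta jS sS cL)[e|e].
    by rewrite e eqxx in LS.
  by rewrite e eqxx in LR.
rewrite mxE (bigD1 j) //= elim_mx_diag mul1r.
rewrite (bigID (fun s => s \in S)) /= [X in _ + (_ + X)]big1 ?addr0; last first.
  move=> s /andP[/negbTE sj]; rewrite inE mxE sj => /negbTE ->; by rewrite mul0r.
have -> : \sum_(s | (s != j) && (s \in S)) elim_mx (compounds A) j s * A s t =
    - ((minor A S S)^-1 * \sum_(s in S)
        (minor ((1%:M + delta_mx s j) *m A) S S - minor A S S) * A s t).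
  rewrite big_distrr /= -sumrN; apply: eq_big => [s|s /andP[/negbTE sj sS]].
    by rewrite andbC; case: eqP => [->|_]; rewrite ?andbT //= andbF (negbTE jS).
  rewrite mxE sj; have := sS; rewrite inE => ->; rewrite coefE //.
  by rewrite mulNr mulrAC mulrC.
by rewrite minor_cramer // mulrA mulVf // mul1r subrr.
Qed.

(** In M A the entry (j, t) vanishes when t is in a later string than j. Multiplying by M^T adds to
    column t only columns of later strings, which keeps these zeros; symmetry gives the others. *)
Lemma elim_mx_block (A : 'M[K]_n) : A^T = A ->
  (forall j s, (str j < str s)%N -> minor A (upper (str j)) (upper (str j)) != 0) ->
  str_block str (elim_mx (compounds A) *m A *m (elim_mx (compounds A))^T).
Proof.
move=> As A0; set M := elim_mx _; set D := M *m A *m M^T.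
have D0 j t : (str j < str t)%N -> D j t = 0.
  move=> jt; rewrite mxE big1 // => u _; rewrite [M^T u t]mxE.
  have [->|ut] := eqVneq u t; first by rewrite elim_mx_row0 ?mul0r.
  rewrite [M t u]mxE (negbTE ut); case: ifP => tu; last by rewrite mulr0.
  by rewrite elim_mx_row0 ?mul0r // (ltn_trans jt).
have Ds : D^T = D by rewrite !trmx_mul trmxK As mulmxA.
move=> a b; case: (ltngtP (str a) (str b)) => // lt; first by rewrite D0 ?eqxx.
by rewrite -Ds mxE D0 ?eqxx.
Qed.

Definition top_of (i : nat) : {set 'I_n} :=
  odflt set0 [pick I : {set 'I_n} | (#|I| == i) && top_set I].

Lemma top_ofP i : (i <= n)%N -> #|top_of i| = i /\ top_set (top_of i).
Proof.
move=> le; rewrite /top_of; case: pickP => [I /andP[/eqP-> ->] //|none].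
have [I cI tI] := top_set_ex str_lt le.
by have := none I; rewrite cI eqxx tI.
Qed.

(** A coordinate of degree i nonzero throughout the cell: dividing by it turns homogeneous
    coordinates into regular functions. *)
Definition lead x i : K := entry x (top_of i) (inv @: top_of i).

Lemma lead_neq0 x i : in_cell x -> (0 < i < n)%N -> lead x i != 0.
Proof.
move=> cx hi; have [cT tT] := top_ofP (ltnW (proj2 (andP hi))).
by apply: (in_cell_top cx) => //; rewrite cT.
Qed.

Lemma lead_regular x0 c : in_cell x0 ->
  regular x0 (fun x => x c / lead x (degree_of c)).
Proof.
move=> cx; have [_ hc] := coordP c; have [cT tT] := top_ofP (ltnW (proj2 (andP hc))).
have := regular_ratio (x0 := x0) (cols_of c) (esym cT) (lead_neq0 cx hc).
by move=> h; apply: regular_ext h _ => x; rewrite entryE.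
Qed.

Lemma generic_forall_cond (x0 : ambient K n) (T : finType) (P : pred T)
    (Q : T -> 'M[K]_n -> Prop) :
  (forall i, P i -> generic x0 (Q i)) -> generic x0 (fun A => forall i, P i -> Q i A).
Proof.
move=> h; apply: generic_all => i; have [Pi|nPi] := boolP (P i).
  by apply: genericW (h i Pi).
exists (fun=> 1); split=> //; [exact: regular_const|exact: oner_neq0].
Qed.

(* Block elimination, the last strings first, with pivots the minors on the sets
   upper l: its coefficients are rational functions of the point, defined at x0. *)
Lemma block_reduction x0 : in_cell x0 -> exists y : ambient K n -> ambient K n,
  [/\ forall c, regular x0 (fun x => y x c),
      exists g, [/\ upper_mx g, forall i, g i i = 1 & same_point (act g x0) (y x0)] &
      generic x0 (fun A => exists D, [/\ D^T = D, D \in unitmx, str_block str D &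
                                        same_point (compounds D) (y (compounds A))])].
Proof.
move=> cx; pose nx x : ambient K n := [ffun c => x c / lead x (degree_of c)].
have nxE x : (forall i, (0 < i < n)%N -> lead x i != 0) -> same_point x (nx x).
  move=> lx; apply: (@same_point_degrees _ _ _ _ (fun i => (lead x i)^-1)) => [i /lx|c].
    by rewrite invr_eq0.
  by rewrite ffunE mulrC.
exists (fun x => act (elim_mx x) (nx x)); split.
- move=> c; apply: (@regular_ext _ _ _ (fun x =>
    \sum_(c' | degree_of c' == degree_of c) minor (elim_mx x) (rows_of c) (rows_of c') *
      (x c' / lead x (degree_of c')) * minor (elim_mx x) (cols_of c) (cols_of c'))).
    apply: regular_sum => c' _; apply: regularM.
      apply: regularM; last exact: lead_regular.
      by apply: regular_minor => *; exact: elim_mx_regular.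
    by apply: regular_minor => *; exact: elim_mx_regular.
  by move=> x; rewrite ffunE; apply: eq_bigr => c' _; rewrite ffunE.
- exists (elim_mx x0); split; [exact: elim_mx_upper|exact: elim_mx_diag|].
  by apply: act_same_point; apply: nxE => i; exact: lead_neq0.
have g1 : generic x0 (fun A => forall i : 'I_n, (0 < i)%N -> lead (compounds A) i != 0).
  apply: generic_forall_cond => i i0.
  have hi : (0 < i < n)%N by rewrite i0 ltn_ord.
  have [cT tT] := top_ofP (ltnW (ltn_ord i)).
  exists (fun x => lead x i / lead x i).
  split; [exact: regular_ratio (lead_neq0 cx hi)| |].
    by rewrite divff ?oner_neq0 // lead_neq0.
  by move=> A _ _; rewrite mulf_eq0 negb_or => /andP[].
have g2 : generic x0 (fun A => forall js : 'I_n * 'I_n, (str js.1 < str js.2)%N ->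
    minor A (upper (str js.1)) (upper (str js.1)) != 0).
  apply: generic_forall_cond => -[j s] /= js; have hS := card_upper_between js.
  have S0 := in_cell_top cx (top_set_upper str_lt (str j)) hS.
  rewrite (inv_upper sid) in S0.
  exists (fun x =>
    entry x (upper (str j)) (upper (str j)) / entry x (upper (str j)) (upper (str j))).
  split; [exact: regular_ratio|by rewrite divff ?oner_neq0|].
  by move=> A _ _; rewrite mulf_eq0 negb_or entry_compounds // => /andP[].
have g3 : generic x0 (fun A => \det (elim_mx (compounds A)) != 0).
  have rd : regular x0 (fun x => minor (elim_mx x) setT setT).
    by apply: regular_minor => *; exact: elim_mx_regular.
  have := generic_neq0 rd; rewrite minor_setT upper_mx_det; last exact: elim_mx_upper.
  rewrite big1 ?oner_neq0 => [|i _]; last exact: elim_mx_diag.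
  by move=> /(_ isT); apply: genericW => A _ _; rewrite minor_setT.
apply: genericW (genericI g1 (genericI g2 g3)) => A As Au [l1 [l2 l3]].
set M := elim_mx (compounds A).
exists (M *m A *m M^T); split.
- by rewrite !trmx_mul trmxK As mulmxA.
- by rewrite !unitmx_mul unitmx_tr Au unitmxE unitfE l3.
- by apply: elim_mx_block => // j s js; exact: (l2 (j, s)).
- rewrite -act_compounds; apply: act_same_point; apply: nxE => i /andP[i0 i_n].
  exact: (l1 (Ordinal i_n)).
Qed.

End Elimination.

(** * Every point of the cell lies in the orbit of some D_z *)

Section Reduction.
Variables (n r : nat) (str : 'I_n -> nat) (inv : 'I_n -> 'I_n).
Hypothesis sid : string_involution_data r str inv.
Variable K : closedFieldType.
Hypothesis two_neq0 : 2%:R != 0 :> K.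
Variable wt : 'I_n -> int.
Hypothesis wt_incr : forall i j : 'I_n, (i < j)%N -> wt i < wt j.
Hypothesis weight_neq : forall u v, str u = (str v).+1 ->
  string_weight inv wt u != string_weight inv wt v.
Hypothesis n_gt0 : (0 < n)%N.
Implicit Types (I J L M S : {set 'I_n}) (a b : 'I_n) (x y : ambient K n).
Local Notation upper := (upper str).
Local Notation top_set := (top_set r str).
Local Notation quadric_point := (quadric_point r str inv (K := K)).
Local Notation in_cell := (in_cell r str inv wt).
Local Notation inv_mx := (inv_mx inv K).
Local Notation lead := (lead r str inv).
Local Notation top_of := (top_of r str).
Local Notation rising := (rising str inv wt).

Let str_lt := sid_lt sid.
Let invK := sid_invK sid.
Let inv_inj := inv_inj invK.

(** A top set with exactly one letter in the string of a. Minors of a block diagonal D on such sets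
    isolate the entries of one string. *)
Definition closed_upper a : {set 'I_n} := a |: upper (str a).

Lemma notin_upper a b : str a = str b -> a \notin upper (str b).
Proof. by move=> e; rewrite inE e ltnn. Qed.

Lemma top_closed_upper a : top_set (closed_upper a).
Proof.
apply/(top_setP str_lt) => l; have [lt|le] := ltnP l (str a); [left|right].
  by rewrite subUset sub1set inE lt /=; apply: upper_mono; exact: ltnW.
by apply: subset_trans (upper_mono str le) (subsetU1 _ _).
Qed.

Lemma inv_closed_upper a : inv @: closed_upper a = closed_upper (inv a).
Proof. by rewrite /closed_upper imsetU1 (inv_upper sid) (sid_inv sid). Qed.

Lemma card_closed_upper a : #|closed_upper a| = #|upper (str a)|.+1.
Proof. by rewrite cardsU1 notin_upper. Qed.

Lemma closed_upper_bounds a : inv a != a -> (0 < #|closed_upper a| < n)%N.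
Proof.
move=> ia; rewrite card_closed_upper /= -card_closed_upper.
rewrite -[ltnRHS]card_ord -cardsT; apply: proper_card; rewrite properT.
apply: contraNneq ia => e; have : inv a \in closed_upper a by rewrite e inE.
by rewrite !inE (sid_inv sid) ltnn orbF.
Qed.

Section Entries.
Variables (x0 : ambient K n) (y : ambient K n -> ambient K n).
Hypotheses (y_regular : forall c, regular x0 (fun x => y x c))
  (x0_complete : complete_quadrics x0) (y_cell : in_cell (y x0))
  (y_generic : generic x0 (fun A => exists D, [/\ D^T = D, D \in unitmx, str_block str D &
                                        same_point (compounds D) (y (compounds A))])).

Lemma entry_regular I J : regular x0 (fun x => entry (y x) I J).
Proof.
by rewrite /entry; case: insub => [c|]; [exact: y_regular|exact: regular_const].
Qed.

(** By [block_entry_compounds] this is D a b up to a factor depending only on the string, so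
    quotients within a string are quotients of entries of D. *)
Definition block_entry a b x : K := entry (y x) (closed_upper a) (closed_upper b) *
  swap_sign K (upper (str a)) a b.

Lemma block_entry_regular a b : regular x0 (block_entry a b).
Proof. exact: regularM (entry_regular _ _) (regular_const _ _). Qed.

Lemma block_entry_compounds D s x a b : str a = str b -> inv a != a ->
  str_block str D -> (forall c, y x c = s (degree_of c) * compounds D c) ->
  block_entry a b x =
    s #|closed_upper a| * (D a b * minor D (upper (str a)) (upper (str a))).
Proof.
move=> ab ia Db e; have cab : #|closed_upper a| = #|closed_upper b|.
  by rewrite !card_closed_upper ab.
have [c [rc kc]] := coord_ex cab (closed_upper_bounds ia).
rewrite /block_entry -rc -kc entryE e ffunE /degree_of rc kc -mulrA; congr (_ * _).
rewrite /closed_upper -ab; apply: minor_setU1_swap; try by rewrite notin_upper.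
move=> t; rewrite inE => at_; apply/eqP/negPn/negP => /Db e'.
by rewrite -ab in e'; rewrite e' ltnn in at_.
Qed.

(** Each string of D is rescaled to agree with [inv_mx] at (a, [inv a]). What remains are the
    diagonal entries of the two-letter strings, which are regular at [x0]. *)
Definition block_mx_of x : 'M[K]_n := \matrix_(a, b)
  if b == inv a then inv_mx a b
  else if b == a then inv_mx a (inv a) * (block_entry a a x / block_entry a (inv a) x)
  else 0.

Lemma block_entry_neq0 a : inv a != a -> block_entry a (inv a) x0 != 0.
Proof.
move=> ia; rewrite mulf_neq0 //.
  rewrite -inv_closed_upper; apply: (in_cell_top y_cell); first exact: top_closed_upper.
  exact: closed_upper_bounds.
by apply: swap_sign_neq0; rewrite notin_upper // (sid_inv sid).
Qed.

Lemma block_mx_regular a b : regular x0 (fun x => block_mx_of x a b).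
Proof.
apply: (@regular_ext _ _ _ (fun x => if b == inv a then inv_mx a b
  else if b == a then inv_mx a (inv a) * (block_entry a a x / block_entry a (inv a) x)
  else 0)); last by move=> x; rewrite [RHS]mxE.
case bia : (b == inv a); first exact: regular_const.
case ba : (b == a); last exact: regular_const.
have ia : inv a != a by apply: contraFneq bia => ->.
have reg := block_entry_regular.
apply: regularM; first exact: regular_const.
by apply: regular_div => //; exact: block_entry_neq0.
Qed.

Lemma block_mx_inv a x : block_mx_of x a (inv a) = inv_mx a (inv a).
Proof. by rewrite mxE eqxx. Qed.

(** For a the larger letter of its string, the diagonal entry at a comes from a coordinate heavier
    than the leading one of its degree. *)
Lemma block_mx_dominated a b : (inv a < b)%N -> block_mx_of x0 a b = 0.
Proof.
move=> lt; rewrite mxE -val_eqE /= gtn_eqF //; case: eqP => // ba.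
rewrite ba in lt; have ia : inv a != a by rewrite -val_eqE /= ltn_eqF.
rewrite /block_entry (in_cell_eq0 y_cell (top_closed_upper (inv a))).
- by rewrite mul0r mul0r mulr0.
- by apply: closed_upper_bounds; rewrite invK eq_sym.
- by rewrite !card_closed_upper (sid_inv sid).
- by rewrite !card_closed_upper (sid_inv sid).
rewrite inv_closed_upper invK ltrD2r /wsum /closed_upper (sid_inv sid).
rewrite !big_setU1 ?notin_upper ?(sid_inv sid) //= ltrD2r; exact: wt_incr.
Qed.

Lemma block_mx_minor I : minor (block_mx_of x0) I (inv @: I) = minor inv_mx I (inv @: I).
Proof.
apply: minor_dominant => //.
- exact: block_mx_dominated.
- move=> a b lt; apply/eqP/negPn/negP => /inv_mx_neq0 e.
  by rewrite e ltnn in lt.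
- by move=> a; rewrite block_mx_inv.
Qed.

Lemma block_mx_minor_neq0 I : minor (block_mx_of x0) I (inv @: I) != 0.
Proof. by rewrite block_mx_minor; exact: (inv_mx_minor_neq0 sid). Qed.

(* Generically the block diagonal matrix D is block_mx_of with rescaled rows. *)
Lemma generic_twist : generic x0 (fun A => exists z,
  same_point (twist r str z (block_mx_of (compounds A))) (y (compounds A))).
Proof.
have g1 : generic x0 (fun A => forall a, inv a != a ->
    block_entry a (inv a) (compounds A) != 0).
  apply: generic_forall_cond => a ia; apply: generic_neq0; last exact: block_entry_neq0.
  exact: block_entry_regular.
apply: genericW (genericI g1 y_generic) => A As Au [be0 [D [Ds Du Db [s s0 e]]]].
pose x := compounds A; pose d a := D a (inv a) / inv_mx a (inv a).
have i0 a : inv_mx a (inv a) != 0 by exact: inv_mx_inv.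
have dinv a : d (inv a) = d a.
  rewrite /d invK -{1}Ds mxE; congr (_ / _).
  by rewrite -{1}(inv_mx_tr sid K) mxE.
have DE a b : D a b = d a * block_mx_of x a b.
  rewrite mxE; case: (b =P inv a) => [->|bia]; first by rewrite divfK.
  case: (b =P a) => [ba|ba]; last first.
    rewrite mulr0; apply/eqP/negPn/negP => /Db /(sid_eq sid)[]; [exact: ba|exact: bia].
  have ia : inv a != a by apply/eqP => e'; apply: bia; rewrite ba e'.
  have := be0 a ia; rewrite -/x ba.
  rewrite !(block_entry_compounds _ ia Db e) ?(sid_inv sid) //.
  rewrite !mulf_eq0 !negb_or => /and3P[h1 h2 h3].
  by rewrite /d; field; rewrite ?h1 ?h2 ?h3 ?i0.
have d0 a : d a != 0.
  have := congr1 (fun M : 'M_n => M a a) (mulmxV Du); rewrite !mxE eqxx => h.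
  apply: contraNneq (oner_neq0 K) => da; rewrite -[1]/(true%:R) -h big1 // => b _.
  by rewrite DE da mul0r mul0r.
pose W := string_value str 1 d.
have WE a : W (str a) = d a by apply: (string_valueE sid).
have W0 l : W l != 0.
  by rewrite /W /string_value; case: pickP => [a _|_]; rewrite ?oner_neq0.
exists (fun l => W l / W l.+1).
apply: same_point_trans (ex_intro2 _ _ s s0 e).
exists (wscale r str W) => [i|c]; first exact: wscale_neq0.
have [ec _] := coordP c; rewrite !ffunE.
have -> : D = diag_mx (\row_a W (str a)) *m block_mx_of x.
  by apply/matrixP => a b; rewrite mul_diag_mx [RHS]mxE [X in _ = X * _]mxE WE DE.
rewrite minor_row_scale //; under eq_bigr => a _ do rewrite mxE.
by rewrite (prod_str str_lt) // -mulrA.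
Qed.

Let a0 : 'I_n := Ordinal n_gt0.
Let letter (l : nat) : 'I_n := odflt a0 [pick a | str a == l].

Lemma str_letter l : (l < r)%N -> str (letter l) = l.
Proof.
move=> /(sid_onto sid)[a al]; rewrite /letter; case: pickP => [b /eqP //|/(_ a)].
by rewrite al eqxx.
Qed.

Definition exchange (l : nat) : {set 'I_n} := swap_set str (letter l.+1) (letter l).

(** In [twist z E] the coordinate at [upper l] is the minor of E, and the one at [exchange l] is the
    minor times z l. Solving for z l, the common scalar cancels. *)
Definition ratio_of (l : nat) x : K :=
  (entry (y x) (exchange l) (inv @: exchange l) *
     minor (block_mx_of x) (upper l) (upper l)) /
  (entry (y x) (upper l) (upper l) *
     minor (block_mx_of x) (exchange l) (inv @: exchange l)).

Lemma card_exchange l : (l.+1 < r)%N -> #|exchange l| = #|upper l|.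
Proof. by move=> lr; rewrite card_swap_set // !str_letter // ltnW. Qed.

Lemma zfac_exchange (z : nat -> K) l : (l.+1 < r)%N -> zfac r str z (exchange l) = z l.
Proof.
move=> lr; have sl := str_letter (ltnW lr).
have e : str (letter l.+1) = (str (letter l)).+1 by rewrite sl str_letter.
rewrite /zfac (bigD1 (Ordinal (ltnW lr))) //= expo_swap_set // sl eqxx expr1.
rewrite big1 ?mulr1 // => k kl; rewrite expo_swap_set // sl.
by rewrite (_ : (k == l :> nat) = false) ?expr0 //; apply/negbTE.
Qed.

Lemma ratio_denominator l : (l.+1 < r)%N ->
  entry (y x0) (upper l) (upper l) *
     minor (block_mx_of x0) (exchange l) (inv @: exchange l) != 0.
Proof.
move=> lr; rewrite mulf_neq0 ?block_mx_minor_neq0 //.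
have := in_cell_top y_cell (top_set_upper str_lt l) (card_upper_bounds sid lr).
by rewrite (inv_upper sid).
Qed.

Lemma ratio_numerator_regular l : regular x0 (fun x =>
  entry (y x) (exchange l) (inv @: exchange l) * minor (block_mx_of x) (upper l) (upper l)).
Proof.
apply: regularM; first exact: entry_regular.
by apply: regular_minor => *; exact: block_mx_regular.
Qed.

Lemma ratio_denominator_regular l : regular x0 (fun x =>
  entry (y x) (upper l) (upper l) *
     minor (block_mx_of x) (exchange l) (inv @: exchange l)).
Proof.
apply: regularM; first exact: entry_regular.
by apply: regular_minor => *; exact: block_mx_regular.
Qed.

Definition ratio (l : nat) x : K := if (l.+1 < r)%N then ratio_of l x else 0.

Lemma ratio_regular l : regular x0 (ratio l).
Proof.
rewrite /ratio; case lr : (l.+1 < r)%N; last exact: regular_const.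
apply: regular_div; last exact: ratio_denominator.
  exact: ratio_numerator_regular.
exact: ratio_denominator_regular.
Qed.

Lemma generic_twist_ratio : generic x0 (fun A =>
  same_point (twist r str (ratio^~ (compounds A)) (block_mx_of (compounds A)))
             (y (compounds A))).
Proof.
have g1 : generic x0 (fun A => forall l : 'I_r, (l.+1 < r)%N ->
    entry (y (compounds A)) (upper l) (upper l) *
     minor (block_mx_of (compounds A)) (exchange l) (inv @: exchange l) != 0).
  apply: generic_forall_cond => l lr.
  exact: (generic_neq0 (ratio_denominator_regular l) (ratio_denominator lr)).
have g2 : generic x0 (fun A => forall l : 'I_r,
    minor (block_mx_of (compounds A)) (upper l) (upper l) != 0).
  apply: generic_all => l.
  apply: (@generic_neq0 _ _ _ (fun x => minor (block_mx_of x) (upper l) (upper l))).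
    by apply: regular_minor => *; exact: block_mx_regular.
  by rewrite -{2}(inv_upper sid) block_mx_minor_neq0.
apply: genericW (genericI generic_twist (genericI g1 g2)) => A As Au [[z zy] [d0 m0]].
rewrite (_ : twist _ _ (ratio^~ _) _ = twist r str z (block_mx_of (compounds A))) //.
apply: eq_twist => // l lr; rewrite /ratio lr /ratio_of; have lr' := ltnW lr.
have [s s0 e] := zy; have hU := card_upper_bounds sid lr.
have yE I J : #|I| = #|upper l| -> #|J| = #|upper l| -> entry (y (compounds A)) I J =
    s #|upper l| * (zfac r str z I * minor (block_mx_of (compounds A)) I J).
  move=> cI cJ; have [|c [rc kc]] := coord_ex (etrans cI (esym cJ)); first by rewrite cI.
  by rewrite -rc -kc entryE e ffunE /degree_of rc cI.
have := d0 (Ordinal lr') lr; have := m0 (Ordinal lr').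
rewrite /= !yE ?card_imset ?card_exchange //.
rewrite zfac_exchange // zfac_top ?top_set_upper // mul1r => h1.
rewrite !mulf_eq0 !negb_or => /andP[/andP[h2 _] h3].
by field; rewrite h1 h2 h3.
Qed.

(** Near [x0] the tuples agree up to scalars; cross multiplication with leading coordinates gives
    one equation between regular functions for each c, to which [generic_eq0] applies. *)
Lemma twist_at_point :
  same_point (twist r str (ratio^~ x0) (block_mx_of x0)) (y x0).
Proof.
pose T := top_of; pose m i := minor (block_mx_of x0) (T i) (inv @: T i).
apply: (@same_point_degrees _ _ _ _ (fun i => lead (y x0) i / m i)) => [i hi|c].
  rewrite mulf_neq0 ?invr_eq0 ?block_mx_minor_neq0 //.
  exact: lead_neq0 y_cell hi.
have [ec hc] := coordP c; have [cT tT] := top_ofP sid (ltnW (proj2 (andP hc))).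
rewrite ffunE; set i := degree_of c.
have {}cT : #|T i| = i := cT; have {}hc : (0 < i < n)%N := hc.
have mi : m i != 0 by exact: block_mx_minor_neq0.
apply: (mulIf mi); transitivity (lead (y x0) i * (zfac r str (ratio^~ x0) (rows_of c) *
  minor (block_mx_of x0) (rows_of c) (cols_of c))); last by field.
apply/eqP; rewrite -subr_eq0; apply/eqP.
pose f x := y x c * minor (block_mx_of x) (T i) (inv @: T i) - lead (y x) i *
   (zfac r str (ratio^~ x) (rows_of c) * minor (block_mx_of x) (rows_of c) (cols_of c)).
have regm I J : regular x0 (fun x => minor (block_mx_of x) I J).
  by apply: regular_minor => *; exact: block_mx_regular.
apply: (generic_eq0 (f := f)) => //.
  apply: regularB; first by apply: regularM.
  apply: regularM; first exact: entry_regular.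
  apply: regularM => //; apply: regular_prod => l _; apply: regularX; exact: ratio_regular.
apply: genericW generic_twist_ratio => A As Au [s s0 e]; rewrite /f.
have eT : #|T i| = #|inv @: T i| by rewrite card_imset.
have hT : (0 < #|T i| < n)%N by rewrite cT.
have [c' [rc' kc']] := coord_ex eT hT.
rewrite /lead -/T -kc' -rc' entryE !e !ffunE rc' kc' (zfac_top _ tT) mul1r.
have -> : degree_of c' = i by rewrite /degree_of rc' cT.
by rewrite -/i; ring.
Qed.

(** A nonzero ratio means that the coordinate at [exchange l] is not heavier than the one at
    [upper l]. Passing from the latter to the former replaces the weight of string l + 1 by that of
    string l; [weight_neq] gives strictness. *)
Lemma ratio_rising l : (l.+1 < r)%N -> ratio l x0 != 0 -> rising l.
Proof.
move=> lr; rewrite /ratio lr /ratio_of !mulf_eq0 !negb_or -!andbA => /andP[nz _].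
have sl := str_letter (ltnW lr); have sl1 := str_letter lr.
set v := letter l in sl; set u := letter l.+1 in sl1.
have vU : v \notin upper l by rewrite inE sl ltnn.
have uU : u \in upper l by rewrite inE sl1.
have ivU : inv v \notin upper l by rewrite inE (sid_inv sid) sl ltnn.
have iuU : inv u \in upper l by rewrite inE (sid_inv sid) sl1.
have exE : exchange l = v |: upper l :\ u by rewrite /exchange /swap_set -/u -/v sl.
have iexE : inv @: exchange l = inv v |: upper l :\ inv u.
  rewrite exE imsetU1; congr (_ |: _); rewrite -[in RHS](inv_upper sid).
  apply/setP => b; rewrite !inE; apply/imsetP/andP => [[a]|[bu /imsetP[a aU be]]].
    by rewrite !inE => /andP[au aU] ->; rewrite (inj_eq inv_inj) au imset_f // inE.
  exists a; rewrite // !inE; rewrite inE in aU; rewrite aU andbT.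
  by apply: contraNneq bu => <-; rewrite be.
have le : wsum wt (exchange l) + wsum wt (inv @: exchange l) <=
    wsum wt (upper l) + wsum wt (upper l).
  rewrite leNgt; apply: contraNN nz => lt; apply/eqP.
  apply: (in_cell_eq0 y_cell (top_set_upper str_lt l)) => //.
  - exact: (card_upper_bounds sid).
  - exact: card_exchange.
  - by rewrite card_imset // card_exchange.
  - by rewrite (inv_upper sid).
have e1 := wsum_replace wt vU uU; have e2 := wsum_replace wt ivU iuU.
rewrite -exE in e1; rewrite -iexE in e2.
have le' : string_weight inv wt v <= string_weight inv wt u by rewrite /string_weight; lia.
have ne : string_weight inv wt u != string_weight inv wt v.
  by apply: weight_neq; rewrite sl sl1.
have const a b : str a = str b -> string_weight inv wt a = string_weight inv wt b.
  by move=> /(sid_eq sid)[->|->] //; rewrite (string_weight_inv sid).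
move=> a b al bl; rewrite (const a v) ?sl // (const b u) ?sl1 //.
by rewrite lt_neqAle le' andbT eq_sym.
Qed.

End Entries.

(* The entries E p p, for p the smaller letter of a two-letter string, are
   removed by adding to row (and column) p a multiple of row (and column) inv p. *)
Lemma normalize_block_mx (E : 'M[K]_n) :
  (forall a b, E a b != 0 -> b = inv a \/ b = a) ->
  (forall a, E a (inv a) = inv_mx a (inv a)) ->
  (forall a b : 'I_n, (inv a < b)%N -> E a b = 0) ->
  exists g : 'M[K]_n, [/\ upper_mx g, forall i, g i i = 1, str_block str g &
    g *m E *m g^T = inv_mx].
Proof.
move=> E_supp E_inv E_dom.
pose c a : K := if (a < inv a)%N then - E a a else 0.
pose C : 'M[K]_n := \matrix_(a, b) if b == inv a then c a else 0.
have CM (X : 'M[K]_n) a b : (C *m X) a b = c a * X (inv a) b.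
  rewrite mxE (bigD1 (inv a)) //= mxE eqxx big1 ?addr0 // => d /negbTE da.
  by rewrite mxE da mul0r.
have MC (X : 'M[K]_n) a b : (X *m C^T) a b = X a (inv b) * c b.
  rewrite mxE (bigD1 (inv b)) //= !mxE eqxx big1 ?addr0 // => d /negbTE da.
  by rewrite !mxE da mulr0.
have gE a b : (1%:M + C) a b = (a == b)%:R + if b == inv a then c a else 0 by rewrite !mxE.
exists (1%:M + C); split.
- move=> a b lt; rewrite gE -val_eqE /= gtn_eqF // add0r; case: eqP => // e.
  by rewrite /c -e ltnNge (ltnW lt).
- move=> a; rewrite gE eqxx; case: eqP => [e|_]; last by rewrite addr0.
  by rewrite /c -e ltnn addr0.
- move=> a b; rewrite gE; case: (a =P b) => [-> //|_]; rewrite add0r.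
  by case: (b =P inv a) => [->|_]; rewrite ?(sid_inv sid) ?eqxx.
apply/matrixP => a b.
have XE a' b' : ((1%:M + C) *m E) a' b' = E a' b' + c a' * E (inv a') b'.
  by rewrite mulmxDl mul1mx mxE CM.
have -> : (1%:M + C)^T = 1%:M + C^T by rewrite linearD /= trmx1.
rewrite mulmxDr mulmx1 [LHS]mxE MC !XE.
have E0 a' b' : b' <> inv a' -> b' <> a' -> E a' b' = 0.
  by move=> n1 n2; apply/eqP/negPn/negP => /E_supp[].
have c0 a' : (inv a' <= a')%N -> c a' = 0 by rewrite /c ltnNge => ->.
have [->|/eqP bia] := eqVneq b (inv a).
  rewrite invK E_inv; case: (ltngtP a (inv a)) => [lt|lt|/val_inj e].
  - by rewrite (E_dom (inv a)) ?invK // [c (inv a)]c0 ?invK ?(ltnW lt) // !mulr0 !addr0.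
  - by rewrite (E_dom a a) // c0 ?(ltnW lt) // !mul0r !addr0 mul0r addr0.
  - by rewrite -e c0 -?e // !mul0r mulr0 !addr0.
have iab : inv a <> b by move=> e; apply: bia; rewrite e.
have [ba|/eqP ba] := eqVneq b a.
  rewrite ba in bia iab *.
  have -> : inv_mx a a = 0 by rewrite mxE; case: (inv a =P a).
  case: (ltngtP a (inv a)) => [lt|lt|/val_inj //].
    have Eia : E (inv a) a = inv_mx (inv a) a by have := E_inv (inv a); rewrite invK.
    rewrite (E_dom (inv a) (inv a)) ?invK // E_inv Eia.
    rewrite /c lt !mxE eqxx invK eqxx; case: (a =P inv a) => // _.
    case: (inv a =P a) => // _; by field.
  by rewrite (E_dom a a) // c0 ?(ltnW lt) // !mul0r mulr0 !addr0.
have iba : inv b <> inv a by move=> /inv_inj.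
have ib_a : inv b <> a by move=> e; apply: bia; rewrite -e invK.
rewrite !E0 ?invK //.
by rewrite !(mulr0, mul0r, addr0) mxE; case: (inv a =P b).
Qed.

Theorem cell_orbits x : bb_cell wt (quadric_point (fun=> 0)) x ->
  exists2 z : nat -> K, forall l, (l.+1 < r)%N -> z l != 0 -> rising l &
    orbit_of x (quadric_point z).
Proof.
move=> /(bb_cell_in_cell sid two_neq0) cx.
have [y [y_reg [g [gu g1 gy]] y_gen]] := block_reduction sid wt_incr cx.
have cy : in_cell (y x) by apply: in_cell_same gy; apply: in_cell_act.
have tw := twist_at_point y_reg (in_cell_complete cx) cy y_gen.
exists (ratio y ^~ x) => [l lr|]; first exact: ratio_rising cy l lr.
have [|||h [hu h1 hb hE]] := @normalize_block_mx (block_mx_of y x).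
- move=> a b; rewrite mxE; case: (b =P inv a) => [->|_]; first by left.
  by case: (b =P a) => [->|_]; [right|rewrite eqxx].
- by move=> a; rewrite block_mx_inv.
- exact: block_mx_dominated cy.
have unit1 (m : 'M[K]_n) : upper_mx m -> (forall i, m i i = 1) -> m \in unitmx.
  by move=> mu m1; rewrite unitmxE upper_mx_det // big1 // unitr1.
(* g performs the block elimination; h is itself block diagonal, so it commutes with the twist, and
   normalizes the blocks. *)
apply/orbit_ofP => //; exists (h *m g); split.
- exact: upper_mxM.
- by rewrite unitmx_mul !unit1.
rewrite -act_mul; apply: same_point_trans (act_same_point h gy) _.
apply: same_point_trans (act_same_point h (same_point_sym tw)) _.
rewrite act_twist // hE; exact: same_point_refl.
Qed.


End Reduction.

(** * The orbit of maximum dimension *)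

Section MaximalOrbit.
Variables (n r : nat) (str : 'I_n -> nat) (inv : 'I_n -> 'I_n).
Hypothesis sid : string_involution_data r str inv.
Variable K : closedFieldType.
Hypothesis two_neq0 : 2%:R != 0 :> K.
Variable wt : 'I_n -> int.
Hypothesis wt_incr : forall i j : 'I_n, (i < j)%N -> wt i < wt j.
Hypothesis weight_neq : forall u v, str u = (str v).+1 ->
  string_weight inv wt u != string_weight inv wt v.
Hypothesis n_gt0 : (0 < n)%N.
Variable asc : nat -> bool.
Hypothesis ascP : forall l, (l.+1 < r)%N -> asc l <-> rising str inv wt l.
Local Notation quadric_point := (quadric_point r str inv (K := K)).
Local Notation cell := (bb_cell wt (quadric_point (fun=> 0))).

Definition generic_quadric : ambient K n := quadric_point (fun l => (asc l)%:R).
Local Notation O := (orbit_of generic_quadric).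

Lemma generic_quadric_complete : complete_quadrics generic_quadric.
Proof.
apply: (twist_complete (sid_lt sid)); [exact: (inv_mx_tr sid)|exact: (inv_mx_block sid)|].
exact: (inv_mx_unit sid).
Qed.

Lemma generic_quadric_point : is_point generic_quadric.
Proof. exact: zclosed_point (complete_quadrics_closed K n) generic_quadric_complete. Qed.

Lemma generic_orbit_sub_cell : subset O cell.
Proof.
apply: (orbit_sub_cell sid two_neq0 wt_incr) => l lr; have [h _] := ascP lr.
by case: (asc l) h => [h _|_]; [exact: h|rewrite eqxx].
Qed.

Lemma orbit_sub_closure z : (forall l, (l.+1 < r)%N -> z l != 0 -> asc l) ->
  subset (orbit_of (quadric_point z)) (zclosure O).
Proof.
move=> zasc y [g gB e].
have cl := zclosure_closed (orbit_of_point generic_quadric_point).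
apply: (zclosed_same cl e); have g_unit := in_borel_unit gB.
pose zt t l := z l + t * ((asc l)%:R - z l).
(* Only ascents enter q: at the other bars the line stays at 0, so off the roots of q its points
   have the zeros of [generic_quadric]. *)
pose q t := \prod_(l < r | asc l) zt t l.
have -> : quadric_point z = quadric_point (zt 0).
  by apply: (eq_twist (sid_lt sid)) => l _; rewrite /zt mul0r addr0.
have zt_poly l : polyfun (fun t => zt t l) by exact: polyfun_segment.
apply: (@orbit_curve K n _ (fun t => act g (quadric_point (zt t))) q) => //.
- exact: generic_quadric_point.
- apply: polyfun_act => [i j|]; [exact: polyfun_const|exact: polyfun_twist].
- exact: polyfun_prod.
- by exists 1; rewrite /q big1 ?oner_neq0 // => l al; rewrite /zt al mul1r addrC subrK.
- move=> t; rewrite /q prodf_seq_neq0 => /allP qt.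
  apply: (orbit_of_sub n_gt0 (x := generic_quadric) (y := quadric_point (zt t))).
    apply: (torus_orbit sid) => // l lr; case al : (asc l); last first.
      rewrite /zt al (_ : z l = 0) ?subr0 ?mulr0 ?addr0 //.
      by apply/eqP/negPn/negP => /(zasc l lr); rewrite al.
    have := qt (Ordinal (ltnW lr)) (mem_index_enum _).
    by rewrite /= al oner_eq0 => /negbTE ->.
  by apply/orbit_ofP => //; exists g; split=> //; [case: gB|exact: same_point_refl].
- by apply: is_point_act => //; exact: (quadric_point_is_point sid).
Qed.

(** The clause on equal dimensions carries uniqueness: either z has no zero at an ascent and
    [torus_orbit] gives O, or [rank1_at] keeps [generic_quadric] out of the closure of O' and the
    dimension is strictly smaller. *)
Lemma orbit_in_cell_dim O' d : is_orbit O' -> subset O' cell -> has_dim O d ->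
  exists2 d', has_dim O' d' & (d' <= d)%N /\ (d' = d -> same_set O' O).
Proof.
move=> [x Xx O'x] O'cell Od.
have Ox : O' x by apply/O'x; exact: orbit_of_refl.
have [z zr xz] := cell_orbits sid two_neq0 wt_incr weight_neq n_gt0 (O'cell x Ox).
have zasc l : (l.+1 < r)%N -> z l != 0 -> asc l by move=> lr /(zr l lr) /ascP ->.
have O'z : same_set O' (orbit_of (quadric_point z)).
  move=> y; have [h1 h2] := orbit_of_eq n_gt0 xz y; have [h3 h4] := O'x y.
  by split=> [/h3/h1|/h2/h4].
have zp : is_point (quadric_point z) by exact: (quadric_point_is_point sid).
have [d' hd'] := has_dim_ex (orbit_of_point zp) (zclosure_orbit_irreducible n_gt0 zp).
exists d'; first by apply: has_dim_same hd' => y; have [] := O'z y.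
have [full|] := classic (forall l, (l.+1 < r)%N -> asc l -> z l != 0).
  have e : same_set O' O.
    move=> y; have [h1 h2] := O'z y.
    have [|h3 h4] := orbit_of_eq n_gt0 (x := quadric_point z) (y := generic_quadric) _ y.
      apply: (torus_orbit sid) => // l lr; case al : (asc l).
        by rewrite oner_eq0; apply/negbTE/full.
      by rewrite eqxx; apply/negPn/negP => /(zasc l lr); rewrite al.
    by split=> [/h1/h3|/h4/h2].
  split=> //; have [_ max] := Od; apply: max.
  have [ch _] := has_dim_same (S' := O) (fun y => iff_trans (iff_sym (O'z y)) (e y)) hd'.
  exact: ch.
move=> /not_all_ex_not[l nl].
have [lr nl'] := imply_to_and _ _ nl.
have [al /negP/negPn/eqP zl] := imply_to_and _ _ nl'.
have lt : (d' < d)%N.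
  apply: (has_dim_lt (orbit_of_point generic_quadric_point)
    (zclosure_orbit_irreducible n_gt0 generic_quadric_point) (orbit_sub_closure zasc)
    (zclosure_sub (orbit_of_refl generic_quadric)) _ hd' Od).
  move=> /(quadric_point_rank1 sid two_neq0 lr zl); apply: (quadric_point_not_rank1 sid) => //.
  by rewrite al oner_neq0.
by split=> [|e]; [exact: ltnW|rewrite e ltnn in lt].
Qed.

Theorem generic_orbit_max : max_orbit_in cell O /\
  forall O', max_orbit_in cell O' -> same_set O' O.
Proof.
have [d Od] := has_dim_ex (orbit_of_point generic_quadric_point)
  (zclosure_orbit_irreducible n_gt0 generic_quadric_point).
have maxO : max_orbit_in cell O.
  split; [|exact: generic_orbit_sub_cell|].
    by exists generic_quadric; first exact: generic_quadric_complete.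
  exists d => // O' iO' sO'; have [d' hd' [le _]] := orbit_in_cell_dim iO' sO' Od.
  by exists d'.
split=> // O' [iO' sO' [d1 hd1 max1]].
have [d2 hd2 [le eq]] := orbit_in_cell_dim iO' sO' Od; apply: eq.
(* O competes against O', so the dimension of O is at most that of O'. *)
have [iO sO _] := maxO; have [d3 hd3 le3] := max1 _ iO sO.
have dim_unique S e1 e2 : has_dim (K := K) (n := n) S e1 -> has_dim S e2 -> (e1 <= e2)%N.
  by move=> [c1 _] [_ m2]; exact: m2.
apply/eqP; rewrite eqn_leq le /=.
exact: leq_trans (dim_unique _ _ _ Od hd3) (leq_trans le3 (dim_unique _ _ _ hd1 hd2)).
Qed.

End MaximalOrbit.

(** * Barred permutations and the map sigma *)

Section BarredPermutations.
Variable n : nat.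
Implicit Types (w : seq 'I_n) (s g : seq (seq 'I_n)) (a b u v : 'I_n).

Lemma alphabet_mem w a : (a \in alphabet w) = (a \in w).
Proof. by rewrite mem_filter mem_enum andbT. Qed.

Lemma alphabet_uniq w : uniq (alphabet w).
Proof. by rewrite filter_uniq ?enum_uniq. Qed.

Lemma alphabet_perm w : uniq w -> perm_eq (alphabet w) w.
Proof. by move=> uw; apply: uniq_perm => // [|a]; rewrite ?alphabet_uniq ?alphabet_mem. Qed.

Lemma eq_alphabet w w' : w =i w' -> alphabet w = alphabet w'.
Proof. by move=> e; apply: eq_filter => a; rewrite e. Qed.

Lemma string_fun_mem w a : uniq w -> a \in w -> string_fun w a \in w.
Proof.
move=> uw aw; apply: mem_nth.
by rewrite -(perm_size (alphabet_perm uw)) index_mem alphabet_mem.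
Qed.

Lemma flatten_uniq_mem (T : eqType) (ss : seq (seq T)) (w : seq T) :
  uniq (flatten ss) -> w \in ss -> uniq w.
Proof.
elim: ss => //= v ss IH; rewrite cat_uniq => /and3P[uv _ uss].
by rewrite inE => /orP[/eqP -> //|]; exact: IH.
Qed.

Lemma string_ofE s a l : uniq (flatten s) -> (l < size s)%N -> a \in nth [::] s l ->
  string_of s a = l.
Proof.
elim: s l => [//|w s IH] [|l] /=; rewrite cat_uniq => /and3P[uw dis us] ls aw.
  by rewrite /string_of /= aw.
rewrite /string_of /=; case: ifP => [aw'|_]; last by rewrite [find _ _](IH l).
case/hasP: dis; exists a => //; apply/flattenP; exists (nth [::] s l) => //.
exact: mem_nth.
Qed.

Lemma string_of_lt s a : (string_of s a < size s)%N = (a \in flatten s).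
Proof.
rewrite -has_find; apply/hasP/flattenP => -[w ws aw]; by exists w.
Qed.

Lemma mem_string_of s a : a \in flatten s -> a \in nth [::] s (string_of s a).
Proof.
move=> /flattenP[w ws aw]; apply: (nth_find [::] (a := fun w => a \in w)).
by apply/hasP; exists w.
Qed.

Lemma involution_ofE s w a : uniq (flatten s) -> w \in s -> a \in w ->
  involution_of s a = string_fun w a.
Proof.
move=> us /(nthP [::])[l ls <-] aw; congr string_fun.
by rewrite (string_ofE us ls aw).
Qed.

Lemma mu_involution_shapeP s : mu_involution (shape s) s ->
  [/\ uniq (flatten s), forall a, a \in flatten s, forall w, w \in s -> w != [::]
    & forall w a, w \in s -> a \in w -> string_fun w (string_fun w a) = a].
Proof.
move=> /and4P[/andP[n0 _] pe _ al]; split.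
- by rewrite (perm_uniq pe) enum_uniq.
- by move=> a; rewrite (perm_mem pe) mem_enum.
- by move=> w ws; apply: contraNneq n0 => we; apply/mapP; exists w; rewrite // we.
- move=> w a ws aw; have /forall_inP/(_ a aw)/eqP := allP al w ws.
  exact.
Qed.

Section Barred.
Variable s : seq (seq 'I_n).
Hypothesis sB : barred_permutation s.
Local Notation str := (string_of s).
Local Notation inv := (involution_of s).

Let s_mu : mu_involution (shape s) s. Proof. by have /andP[] := sB. Qed.
Let s_uniq : uniq (flatten s). Proof. by have [] := mu_involution_shapeP s_mu. Qed.
Let s_all a : a \in flatten s. Proof. by have [] := mu_involution_shapeP s_mu. Qed.

Lemma barred_string w : w \in s -> (exists a, w = [:: a]) \/
  exists i j : 'I_n, (i < j)%N /\ w = [:: j; i].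
Proof.
move=> ws; have /andP[_ /allP/(_ w ws)] := sB.
have [_ _ /(_ w ws) + _] := mu_involution_shapeP s_mu.
case: w ws => [|a [|b [|c w]]] //= _ _; first by left; exists a.
by rewrite andbT => ba; right; exists b, a.
Qed.

Lemma string_fun1 a : string_fun [:: a] a = a.
Proof.
have : string_fun [:: a] a \in [:: a] by apply: string_fun_mem; rewrite ?mem_head.
by rewrite inE => /eqP.
Qed.

Lemma alphabet2 (i j : 'I_n) : (i < j)%N -> alphabet [:: j; i] = [:: i; j].
Proof.
move=> ij; have tr : transitive (fun a b : 'I_n => a < b)%N.
  by move=> ? ? ?; exact: ltn_trans.
apply: (irr_sorted_eq tr); first by move=> a; rewrite ltnn.
- apply: sorted_filter => //; have := iota_ltn_sorted 0 n.
  by rewrite -val_enum_ord sorted_map.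
- by rewrite /= ij.
- by move=> a; rewrite alphabet_mem !inE orbC.
Qed.

Lemma string_fun2 (i j : 'I_n) : (i < j)%N ->
  string_fun [:: j; i] i = j /\ string_fun [:: j; i] j = i.
Proof.
move=> ij; rewrite /string_fun alphabet2 //= eqxx.
by rewrite -val_eqE /= ltn_eqF // eqxx.
Qed.

Lemma string_letters a : nth [::] s (str a) =i [:: a; inv a].
Proof.
have ws : nth [::] s (str a) \in s by rewrite mem_nth // string_of_lt.
have aw := mem_string_of (s_all a); rewrite (involution_ofE s_uniq ws aw).
case: (barred_string ws) => [[c e]|[i [j [ij e]]]]; rewrite e in aw *.
  rewrite !inE in aw; rewrite (eqP aw) string_fun1 => b.
  by rewrite !inE orbb.
have [f1 f2] := string_fun2 ij; rewrite !inE in aw.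
by case/orP: aw => /eqP ->; rewrite ?f1 ?f2 => b; rewrite !inE // orbC.
Qed.

Lemma barred_string_involution : string_involution_data (size s) str inv.
Proof.
have strE a l : (l < size s)%N -> a \in nth [::] s l -> str a = l by exact: string_ofE.
have inv_in a : inv a \in nth [::] s (str a) by rewrite string_letters !inE eqxx orbT.
have sl a : (str a < size s)%N by rewrite string_of_lt.
have str_inv a : str (inv a) = str a by apply: strE.
have ws a : nth [::] s (str a) \in s by exact: mem_nth.
split=> //.
- move=> a; rewrite (involution_ofE s_uniq (ws a) (inv_in a)).
  rewrite (involution_ofE s_uniq (ws a) (mem_string_of (s_all a))).
  have [_ _ _ h] := mu_involution_shapeP s_mu; apply: h => //.
  exact: mem_string_of.
- move=> a b e; have := mem_string_of (s_all b); rewrite -e string_letters !inE.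
  by case/orP => /eqP; [left|right].
- move=> l ls; have lw := mem_nth [::] ls.
  have [_ _ /(_ _ lw) + _] := mu_involution_shapeP s_mu.
  case e : (nth [::] s l) => [//|a w] _; exists a; apply: strE => //.
  by rewrite e mem_head.
Qed.

Lemma max_letter_string a : max_letter (nth [::] s (str a)) = maxn a (inv a).
Proof.
rewrite /max_letter (eq_big_idem _ _ maxnn (string_letters a)).
by rewrite !big_cons big_nil /= maxn0.
Qed.

Definition ascent (l : nat) : bool :=
  (max_letter (nth [::] s l) < max_letter (nth [::] s l.+1))%N.

Let sid := barred_string_involution.
Let invK : involutive inv. Proof. by have [] := sid. Qed.

Section Weights.
Variable wt : 'I_n -> int.
Hypothesis wt_adm : admissible wt.
Local Notation weight := (string_weight inv wt).

(** Let v be the larger letter of its string. If it is fixed by [inv], both letters of u are smaller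
    and monotonicity applies twice; otherwise use the inequality between sums of pairs, with [inv v]
    and v on the larger side. *)
Lemma weight_lt u v : (maxn u (inv u) < maxn v (inv v))%N -> weight u < weight v.
Proof.
have [_ inc pairs _] := wt_adm.
have key a b : (inv b <= b)%N -> (a < b)%N -> (inv a < b)%N -> weight a < weight b.
  move=> bb ab iab; rewrite /string_weight; have [lt|eqb|/val_inj ->] := ltngtP (inv b) b.
  - by rewrite [ltRHS]addrC; exact: pairs.
  - by rewrite leqNgt eqb in bb.
  - by rewrite ltrD // inc.
rewrite gtn_max; have [le|/ltnW le] := leqP (inv v) v.
  by move=> /andP[? ?]; exact: key.
move=> /andP[? ?].
by rewrite -(string_weight_inv sid _ v); apply: key; rewrite ?invK.
Qed.

Lemma max_letter_neq u v : str u != str v -> maxn u (inv u) != maxn v (inv v).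
Proof.
apply: contra_neq => e; suff [h|h] : u = v \/ u = inv v \/ inv u = v \/ inv u = inv v.
- by rewrite h.
- have si := sid_inv sid; case: h => [->|[<-|h]]; rewrite ?si //.
  by rewrite -(si u) h si.
move: e; case: (leqP u (inv u)) => _; case: (leqP v (inv v)) => _ /val_inj; tauto.
Qed.

Lemma ascent_rising l : (l.+1 < size s)%N -> ascent l <-> rising str inv wt l.
Proof.
move=> ls; split.
  move=> al u v ul vl; apply: weight_lt.
  by rewrite -!max_letter_string ul vl.
have [v vl] := sid_onto sid ls; have [u ul] := sid_onto sid (ltnW ls).
move=> /(_ u v ul vl) lt; have -> : ascent l = (maxn u (inv u) < maxn v (inv v))%N.
  by rewrite /ascent -!max_letter_string ul vl.
rewrite ltnNge.
apply/negP; rewrite leq_eqVlt => /orP[/eqP e|/weight_lt lt'].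
  have : str v != str u by rewrite vl ul gtn_eqF.
  by move=> /max_letter_neq; rewrite e eqxx.
by have := lt_trans lt lt'; rewrite ltxx.
Qed.

Lemma string_weight_neq u v : str u = (str v).+1 -> weight u != weight v.
Proof.
move=> uv; have /max_letter_neq : str u != str v by rewrite uv gtn_eqF.
rewrite neq_ltn => /orP[/weight_lt lt|/weight_lt lt]; first by rewrite lt_eqF.
by rewrite eq_sym lt_eqF.
Qed.

End Weights.

Section QuadricOf.
Variable K : fieldType.

(** With z in {0, 1}, [zfac] is 1 on the sets whose exponents vanish outside [asc] and 0 on the
    others. The hypothesis on [string_of s'] says that strings are merged across [asc], which turns
    this condition into [from_top s']. *)
Lemma quadric_of_point (s' : seq (seq 'I_n)) (asc : nat -> bool) :
  involution_of s' =1 inv ->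
  (forall a b, (string_of s' b <= string_of s' a)%N <->
     forall l, (str a <= l < str b)%N -> asc l) ->
  quadric_of K s' = quadric_point (size s) str inv (fun l => (asc l)%:R : K).
Proof.
move=> e_inv e_str.
have mxE' : involution_mx K s' = inv_mx inv K by apply/matrixP => a b; rewrite !mxE e_inv.
have topE (I : {set 'I_n}) : from_top s' I =
    [forall l : 'I_(size s), ~~ asc l ==> (expo str l I == 0%N)].
  apply/forall_inP/forallP => [h l|h a aI].
    apply/implyP => nl; rewrite expo_eq0.
    have [//|/subsetPn[a aI au]] := boolP (I \subset upper str l); rewrite /=.
    apply/subsetP => b bu; apply/negPn/negP => bI.
    have /forall_inP/(_ b) := h a aI; rewrite inE bI => /(_ isT)/e_str/(_ l).
    rewrite !inE -leqNgt in au bu *; rewrite au bu => /(_ isT) al.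
    by rewrite al in nl.
  apply/forall_inP => b; rewrite inE => bI; apply/e_str => l /andP[al lb].
  apply/negPn/negP => nl; have ls : (l < size s)%N by apply: ltn_trans lb (sid_lt sid b).
  have := h (Ordinal ls); rewrite /= nl /= expo_eq0 => /orP[/subsetP/(_ a aI)|/subsetP/(_ b)].
    by rewrite inE ltnNge al.
  by rewrite inE lb (negbTE bI) => /(_ isT).
apply/ffunP => c; rewrite !ffunE mxE'; have [ec _] := coordP c.
have [->|nz] := eqVneq (minor (inv_mx inv K) (rows_of c) (cols_of c)) 0.
  by rewrite mulr0; case: ifP.
have ex l : expo str l (cols_of c) = expo str l (rows_of c).
  by rewrite /expo -(block_minor_card (@inv_mx_block _ _ _ _ sid K) ec nz) ec.
have -> : from_top s' (cols_of c) = from_top s' (rows_of c).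
  by rewrite !topE; apply: eq_forallb => l; rewrite ex.
rewrite andbb topE; case: ifP => [/forallP h|/negbT/forallPn[l]].
  rewrite [zfac _ _ _ _]big1 ?mul1r // => l _; have := h l.
  by case: (asc l) => /= [_|/eqP ->]; rewrite ?expr1n ?expr0.
rewrite negb_imply -lt0n => /andP[/negbTE al gt0].
by rewrite /zfac (bigD1 l) //= al expr0n gtn_eqF // !mul0r.
Qed.

Lemma quadric_of_barred : quadric_of K s = quadric_point (size s) str inv (fun=> 0 : K).
Proof.
rewrite (@quadric_of_point s (fun=> false)) // => a b; split=> [ba l|h].
  by case/andP => al lb; have := leq_ltn_trans al (leq_trans lb ba); rewrite ltnn.
by rewrite leqNgt; apply/negP => lt; have := h (str a); rewrite leqnn lt => /(_ isT).
Qed.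

End QuadricOf.

End Barred.
End BarredPermutations.

Lemma flatten_flatten (T : Type) (sss : seq (seq (seq T))) :
  flatten (flatten sss) = flatten (map flatten sss).
Proof. by elim: sss => //= ss sss IH; rewrite flatten_cat IH. Qed.

(** * Runs of ascents *)

Section Runs.
Variable n : nat.
Implicit Types (w : seq 'I_n) (s g : seq (seq 'I_n)) (a b : 'I_n).

Lemma ascending_runs_cons w s : exists g rs, ascending_runs (w :: s) = (w :: g) :: rs.
Proof.
rewrite /=; case: (ascending_runs s) => [|[|v g] rs]; try by exists [::], [::].
by case: ifP; [exists (v :: g), rs|exists [::], ((v :: g) :: rs)].
Qed.

Lemma flatten_ascending_runs s : flatten (ascending_runs s) = s.
Proof.
elim: s => //= w [|v s] // IH.
have [g [rs e]] := ascending_runs_cons v s; rewrite e in IH *.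
by case: ifP => _; rewrite /= -?[v :: g ++ _]/(flatten ((v :: g) :: rs)) IH.
Qed.

Lemma ascending_runs_neq0 s g : g \in ascending_runs s -> g != [::].
Proof.
elim: s g => //= w [|v s] IH g; first by rewrite inE => /eqP ->.
have [h [rs e]] := ascending_runs_cons v s; rewrite e in IH *.
have {}IH g' : g' \in rs -> g' != [::] by move=> g'rs; apply: IH; rewrite inE g'rs orbT.
case: ifP => _; rewrite !inE; first by case/orP=> [/eqP -> //|/IH].
by case/or3P=> [/eqP -> //|/eqP -> //|/IH].
Qed.

(** A new run starts at each retained bar, so the index of a run counts the descents before it. *)
Lemma find_ascending_runs s (p : pred (seq 'I_n)) : has p s ->
  find (has p) (ascending_runs s) = (\sum_(0 <= k < find p s) ~~ ascent s k)%N.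
Proof.
elim: s => //= w [|v s] IH; first by rewrite orbF /= => ->; rewrite big_geq.
have [g [rs e]] := ascending_runs_cons v s; rewrite e in IH *.
have [pw _|npw /= ps] := boolP (p w); first by case: ifP; rewrite /= pw big_geq.
have {}IH := IH ps.
rewrite big_nat_recl // {1}/ascent /=.
under eq_bigr => k _ do rewrite -[ascent _ k.+1]/(ascent (v :: s) k).
rewrite -[if p v then _ else _]/(find p (v :: s)) -IH.
by case: ifP => _; rewrite /= (negbTE npw) /=.
Qed.

End Runs.

(** * The degenerate involution sigma(pi) *)

Section Sigma.
Variables (n : nat) (s : seq (seq 'I_n)).
Hypothesis sB : barred_permutation s.
Implicit Types (g : seq (seq 'I_n)) (a b : 'I_n).
Local Notation str := (string_of s).
Local Notation inv := (involution_of s).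

Let s_mu : mu_involution (shape s) s. Proof. by have /andP[] := sB. Qed.
Let s_uniq : uniq (flatten s). Proof. by have [] := mu_involution_shapeP s_mu. Qed.
Let s_all a : a \in flatten s. Proof. by have [] := mu_involution_shapeP s_mu. Qed.
Let sid := barred_string_involution sB.
Let invK : involutive inv. Proof. by have [] := sid. Qed.

Lemma run_subset g w : g \in ascending_runs s -> w \in g -> w \in s.
Proof.
by move=> gr wg; rewrite -(flatten_ascending_runs s); apply/flattenP; exists g.
Qed.

Lemma run_uniq g : g \in ascending_runs s -> uniq (flatten g).
Proof.
move=> gr; have := s_uniq; rewrite -{1}(flatten_ascending_runs s) flatten_flatten.
by move=> /flatten_uniq_mem; apply; exact: map_f.
Qed.

Lemma mem_run_inv g a : g \in ascending_runs s -> a \in flatten g -> inv a \in flatten g.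
Proof.
move=> gr /flattenP[w wg aw]; apply/flattenP; exists w => //.
have ws := run_subset gr wg; rewrite (involution_ofE s_uniq ws aw).
by apply: string_fun_mem => //; exact: flatten_uniq_mem ws.
Qed.

Lemma merge_runE g : g \in ascending_runs s ->
  merge_run g = [seq inv a | a <- alphabet (flatten g)].
Proof.
move=> gr; apply/eq_in_map => a; rewrite alphabet_mem => /flattenP[w wg aw].
rewrite (involution_ofE (run_uniq gr) wg aw).
by rewrite (involution_ofE s_uniq (run_subset gr wg) aw).
Qed.

Lemma mem_merge_run g : g \in ascending_runs s -> merge_run g =i flatten g.
Proof.
move=> gr a; rewrite merge_runE //; apply/mapP/idP => [[b + ->]|ag].
  by rewrite alphabet_mem; exact: mem_run_inv.
by exists (inv a); rewrite ?invK // alphabet_mem mem_run_inv.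
Qed.

Lemma merge_run_uniq g : g \in ascending_runs s -> uniq (merge_run g).
Proof.
by move=> gr; rewrite merge_runE // map_inj_uniq ?alphabet_uniq //; exact: can_inj invK.
Qed.

Lemma string_fun_merge_run g a : g \in ascending_runs s -> a \in flatten g ->
  string_fun (merge_run g) a = inv a.
Proof.
move=> gr ag; rewrite /string_fun (eq_alphabet (mem_merge_run gr)) merge_runE //.
have ia : a \in alphabet (flatten g) by rewrite alphabet_mem.
by rewrite (nth_map a) ?index_mem // nth_index.
Qed.

Lemma sigma_perm : perm_eq (flatten (sigma s)) (flatten s).
Proof.
rewrite -[in X in perm_eq _ X](flatten_ascending_runs s) flatten_flatten.
have h g : g \in ascending_runs s -> perm_eq (merge_run g) (flatten g).
  move=> gr; apply: uniq_perm; [exact: merge_run_uniq|exact: run_uniq|exact: mem_merge_run].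
rewrite /sigma; elim: (ascending_runs s) h => //= g rs IH h.
apply: perm_cat; first by apply: h; rewrite mem_head.
by apply: IH => g' g'rs; apply: h; rewrite inE g'rs orbT.
Qed.

Lemma sigma_mu_involution : mu_involution (shape (sigma s)) (sigma s).
Proof.
have pe : perm_eq (flatten (sigma s)) (enum 'I_n).
  by apply: perm_trans sigma_perm _; have /and4P[] := s_mu.
apply/and4P; split=> //.
- apply/andP; split.
    apply/mapP => -[w /mapP[g gr ->]] /esym/eqP; rewrite size_eq0 => /eqP m0.
    have := ascending_runs_neq0 gr; case eg : g => [//|w' g'] _.
    have ws : w' \in s by apply: (run_subset gr); rewrite eg mem_head.
    have [_ _ /(_ _ ws) + _] := mu_involution_shapeP s_mu.
    case ew : w' => [//|a w''] _; have := mem_merge_run gr a.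
    by rewrite m0 eg ew /= mem_head.
  by rewrite -size_flatten (perm_size pe) size_enum_ord.
- apply/allP => w /mapP[g gr ->]; apply/forall_inP => a.
  rewrite mem_merge_run // => ag; rewrite (string_fun_merge_run gr ag).
  by rewrite string_fun_merge_run ?invK // mem_run_inv.
Qed.

Lemma run_of_letter a : exists2 g, g \in ascending_runs s & a \in flatten g.
Proof.
have := s_all a; rewrite -{1}(flatten_ascending_runs s) flatten_flatten.
by move=> /flattenP[w /mapP[g gr ->] ag]; exists g.
Qed.

Lemma involution_of_sigma : involution_of (sigma s) =1 inv.
Proof.
move=> a; have [g gr ag] := run_of_letter a.
rewrite (@involution_ofE _ (sigma s) (merge_run g)).
- exact: string_fun_merge_run.
- by rewrite (perm_uniq sigma_perm).
- exact: map_f.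
- by rewrite mem_merge_run.
Qed.

Lemma string_of_sigma a :
  string_of (sigma s) a = (\sum_(0 <= k < str a) ~~ ascent s k)%N.
Proof.
have hs : has (fun w => a \in w) s by apply/hasP; apply/flattenP.
rewrite -(find_ascending_runs hs) /string_of /sigma find_map; apply: eq_in_find => g gr /=.
by rewrite mem_merge_run //; apply/flattenP/hasP.
Qed.

Lemma string_of_sigma_le a b : (string_of (sigma s) b <= string_of (sigma s) a)%N <->
  forall l, (str a <= l < str b)%N -> ascent s l.
Proof.
rewrite !string_of_sigma; have [ba|ab] := leqP (str b) (str a).
  split=> [_ l /andP[al lb]|_].
    by have := leq_ltn_trans al (leq_trans lb ba); rewrite ltnn.
  by rewrite [leqRHS](big_cat_nat (n := str b)) //= leq_addr.
rewrite [leqLHS](big_cat_nat (n := str a)) ?(ltnW ab) //=.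
rewrite -[leqRHS]addn0 leq_add2l leqn0 sum_nat_seq_eq0; split.
  move=> /allP h l lab; have := h l; rewrite mem_index_iota => /(_ lab) /=.
  by rewrite eqb0 negbK.
by move=> h; apply/allP => l; rewrite mem_index_iota => /h /= ->.
Qed.

Lemma quadric_of_sigma (K : fieldType) :
  quadric_of K (sigma s) = quadric_point (size s) str inv (fun l => (ascent s l)%:R : K).
Proof.
apply: quadric_of_point => //; [exact: involution_of_sigma|exact: string_of_sigma_le].
Qed.

End Sigma.

(** The entries 0, 1 and 1/2 of the matrix are preserved by every morphism of fields. *)
Lemma base_change_quadric_of (k K : fieldType) (iota : {rmorphism k -> K}) n
    (s : seq (seq 'I_n)) : base_change iota (quadric_of k s) = quadric_of K s.
Proof.
apply/ffunP => c; rewrite !ffunE; case: ifP => _; last exact: rmorph0.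
rewrite -det_map_mx; congr (\det _); apply/matrixP => i j; rewrite !mxE.
case: ifP => _; last exact: rmorph0.
by case: ifP => _; rewrite ?rmorph1 // fmorphV rmorph_nat.
Qed.

Theorem proposition6p9
  (k : fieldType) (k_char0 : [pchar k] =i pred0)
  (K : closedFieldType) (iota : {rmorphism k -> K})
  (n : nat) (n_gt0 : (0 < n)%N)
  (a : 'I_n -> int) (a_adm : admissible a)
  (pi : seq (seq 'I_n)) (pi_barred : barred_permutation pi) :
  let Q (s : seq (seq 'I_n)) := base_change iota (quadric_of k s) in
  let cell := bb_cell a (Q pi) in
  exists O : ambient K n -> Prop,
    [/\ max_orbit_in cell O,
        forall O', max_orbit_in cell O' -> same_set O' O
      & exists mu, mu_involution mu (sigma pi) /\ O (Q (sigma pi))].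
Proof.
rewrite /= !base_change_quadric_of quadric_of_barred // quadric_of_sigma //.
(* Characteristic 0 keeps the entries 1/2 of the two-cycles from degenerating to 0. *)
have two_neq0 : 2%:R != 0 :> K.
  rewrite -(rmorph_nat iota) fmorph_eq0; apply/eqP => two0.
  by have := k_char0 2%N; rewrite !inE two0 eqxx.
have [_ a_inc _ _] := a_adm.
have [maxO uniqO] := generic_orbit_max (barred_string_involution pi_barred) two_neq0 a_inc
  (string_weight_neq pi_barred a_adm) n_gt0 (ascent_rising pi_barred a_adm).
exists (orbit_of (generic_quadric (size pi) (string_of pi) (involution_of pi) K
  (ascent pi))).
split=> //; exists (shape (sigma pi)); split; first exact: sigma_mu_involution.
exact: orbit_of_refl.
Qed.
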